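(* Let $0<b<a$ and put $c=a/b$. Let $f_{a,b}^{(\nu)}$ be the density of the first hitting time $\tau_{a,b}^{(\nu)}$ to $b$ of a Bessel process with index $\nu$ starting from $a$. As $t\to\infty$, the following hold. (1) If $\nu=0$, then $$f_{a,b}^{(0)}(t)=2\log c\cdot t^{-1}(\log t)^{-2}\,(1+o(1)).$$ (2) If $0<|\nu|<1/2$, then $$f_{a,b}^{(\nu)}(t)=\frac{b^{2|\nu|}\,(c^{|\nu|}-c^{-|\nu|})}{c^{\nu}\,2^{|\nu|}\,\Gamma(|\nu|)}\,t^{-|\nu|-1}\,(1+o(1)).$$
   Context: The Bessel process with index $\nu\in\mathbb{R}$ is the diffusion process on $[0,\infty)$ with infinitesimal generator $\frac12\frac{d^2}{dx^2}+\frac{2\nu+1}{2x}\frac{d}{dx}$. For $0<b<a$, $\tau_{a,b}^{(\nu)}$ is its first hitting time to $b$ when started from $a$ (equal to $+\infty$ if $b$ is never hit). Its Laplace transform is, for $\lambda>0$, $$E[e^{-\lambda\tau_{a,b}^{(\nu)}}]=\frac{a^{-\nu}K_\nu(a\sqrt{2\lambda})}{b^{-\nu}K_\nu(b\sqrt{2\lambda})},$$ where $K_\nu$ is the modified Bessel function of the second kind (Macdonald function). The density $f_{a,b}^{(\nu)}$ is the continuous function on $(0,\infty)$ with $P(\tau_{a,b}^{(\nu)}\le t)=\int_0^t f_{a,b}^{(\nu)}(s)\,ds$ for all $t>0$ (its total mass is less than $1$ when $\nu>0$). $\Gamma$ is the Gamma function. For $|\nu|<1/2$ this density is given explicitly as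 follows. With $I_\mu$ the modified Bessel function of the first kind, set for $\mu\ge0$, $x>0$ $$L_{\mu,c}(x)=\frac{\cos(\pi\mu)\{I_\mu(cx)K_\mu(x)-I_\mu(x)K_\mu(cx)\}}{\{K_\mu(x)\}^2+\pi^2\{I_\mu(x)\}^2+2\pi\sin(\pi\mu)K_\mu(x)I_\mu(x)},\qquad q(t,a,b)=\frac{a-b}{\sqrt{2\pi t^3}}\,e^{-(a-b)^2/(2t)}.$$ Then $$f_{a,b}^{(\nu)}(t)=c^{-\nu}q(t,a,b)\left\{c^{-|\nu|}-\int_0^\infty\frac1x e^{-(c-1)x}L_{|\nu|,c}(x)\,dx\right\}+\frac{c^{-\nu}}{b}\int_0^\infty L_{|\nu|,c}(x)\left(\frac{1}{\sqrt{2\pi t^3}}\int_{a-b}^\infty \xi\, e^{-\frac{\xi^2}{2t}-\frac{x\xi}{b}}\,d\xi\right)dx.$$ *)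

(* Defs.v *)
From HB Require Import structures.
From mathcomp Require Import all_boot all_order all_algebra.
From mathcomp Require Import all_classical all_reals all_analysis.

Set Implicit Arguments.
Unset Strict Implicit.
Unset Printing Implicit Defensive.

Import Order.TTheory GRing.Theory Num.Theory.
Import numFieldNormedType.Exports.

Local Open Scope classical_set_scope.
Local Open Scope ring_scope.

Section SpecialFunctions.
Variable R : realType.
Implicit Types z mu x : R.

(* The Euler integral; it gives the Gamma function for z > 0 only, which is the
   only range in which it is used. *)
Definition Gamma z : R :=
  \int[lebesgue_measure]_(u in `]0, +oo[) (u `^ (z - 1) * expR (- u)).

(* Intended for mu >= 0 and x > 0. *)
Definition besselI mu x : R :=
  limn (series (fun k =>
    (x / 2) `^ (mu + 2 * k%:R) / (k`!%:R * Gamma (mu + k%:R + 1)))).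

(* K_mu(x) = int_0^oo exp(- x cosh u) cosh(mu u) du, for x > 0 and every real
   order mu. *)
Definition besselK mu x : R :=
  \int[lebesgue_measure]_(u in `[0, +oo[)
    (expR (- x * ((expR u + expR (- u)) / 2)) *
     ((expR (mu * u) + expR (- (mu * u))) / 2)).

End SpecialFunctions.

Section BesselProcess.
Variable R : realType.
Implicit Types (nu a b : R) (phi : R -> R).

Definition bessel_operator nu phi (x : R) : R :=
  2^-1 * derive1n 2 phi x + (2 * nu + 1) / (2 * x) * derive1 phi x.

Definition C2c_pos phi : Prop :=
  [/\ forall x, derivable phi x 1,
      forall x, derivable (derive1 phi) x 1,
      continuous (derive1n 2 phi) &
      exists l r : R, 0 < l /\ forall x, x \notin `[l, r] -> phi x = 0].

(* [p t x] is the law at time t of the process started from x; only t >= 0 and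
   x >= 0 are constrained.  The last clause says that, on twice continuously
   differentiable functions with compact support in (0, +oo), the generator of
   the semigroup, in the sup norm on [0, +oo), is [bessel_operator nu].  Nothing
   is prescribed at the boundary point 0, which a path started from a > b can
   reach only after having hit b > 0. *)
Definition bessel_semigroup nu
    (p : R -> R.-pker (measurableTypeR R) ~> (measurableTypeR R)) : Prop :=
  [/\ forall t x : R, 0 <= t -> 0 <= x -> p t x [set y : R | 0 <= y] = 1%E,
      forall (x : R) (B : set (measurableTypeR R)), 0 <= x -> measurable B ->
        p 0 x B = \d_x B,
      forall (s t x : R) (B : set (measurableTypeR R)),
        0 <= s -> 0 <= t -> 0 <= x -> measurable B ->
        p (s + t) x B = (\int[p s x]_y p t y B)%E &
      forall phi, C2c_pos phi -> forall e : R, 0 < e ->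
        \forall h \near 0^'+, forall x : R, 0 <= x ->
          `| ((\int[p h x]_y phi y) - phi x) / h - bessel_operator nu phi x |
          <= e].

Section Process.
Context d (T : measurableType d) (P : probability T R).
Implicit Types X : R -> T -> R.

Definition natural_filtration X (t : R) : set (set T) :=
  <<s [set A | exists s : R, exists B : set (measurableTypeR R),
        [/\ 0 <= s <= t, measurable B & A = X s @^-1` B]] >>.

Definition markov_process
    (p : R -> R.-pker (measurableTypeR R) ~> (measurableTypeR R)) X : Prop :=
  forall (s t : R) (A : set T) (B : set (measurableTypeR R)),
    0 <= s <= t -> natural_filtration X s A -> measurable B ->
    P (A `&` X t @^-1` B) = (\int[P]_(w in A) p (t - s)%R (X s w) B)%E.

(* [X t] is the position at time t >= 0; the values at t < 0 are irrelevant. *)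
Definition bessel_process nu a X : Prop :=
  [/\ forall t : R, 0 <= t ->
        measurable_fun [set: T] (X t : T -> measurableTypeR R),
      forall (t : R) w, 0 <= t -> 0 <= X t w,
      forall w, {within `[0, +oo[, continuous (fun t : R => X t w)},
      {ae P, forall w, X 0 w = a} &
      exists2 p, bessel_semigroup nu p & markov_process p X].

Definition hitting_time X b (w : T) : \bar R :=
  ereal_inf [set t%:E | t in [set t : R | 0 <= t /\ X t w = b]].

(* The continuous density of a (possibly infinite) positive random time. *)
Definition continuous_density (tau : T -> \bar R) (f : R -> R) : Prop :=
  (forall t : R, 0 < t -> {for t, continuous f}) /\
  (forall t : R, 0 < t ->
     P [set w | (tau w <= t%:E)%E] =
     (\int[lebesgue_measure]_(s in `]0%R, t]) (f s)%:E)%E).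

End Process.
End BesselProcess.

Section ExplicitDensity.
Variable R : realType.
Implicit Types mu nu a b c t x : R.

Definition hitting_L mu c x : R :=
  cos (pi * mu) *
    (besselI mu (c * x) * besselK mu x - besselI mu x * besselK mu (c * x)) /
  (besselK mu x ^+ 2 + pi ^+ 2 * besselI mu x ^+ 2 +
   2 * pi * sin (pi * mu) * besselK mu x * besselI mu x).

Definition hitting_q t a b : R :=
  (a - b) / Num.sqrt (2 * pi * t ^+ 3) * expR (- (a - b) ^+ 2 / (2 * t)).

(* The known closed form, valid for `|nu| < 1/2, of the density at t of the
   hitting time of b by a Bessel process with index nu started from a > b. *)
Definition hitting_density_formula nu a b t : R :=
  let c := a / b in
  c `^ (- nu) * hitting_q t a b *
    (c `^ (- `|nu|) -
     \int[lebesgue_measure]_(x in `]0, +oo[)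
       (x^-1 * expR (- (c - 1) * x) * hitting_L `|nu| c x)) +
  c `^ (- nu) / b *
    \int[lebesgue_measure]_(x in `]0, +oo[)
      (hitting_L `|nu| c x *
       ((Num.sqrt (2 * pi * t ^+ 3))^-1 *
        \int[lebesgue_measure]_(xi in `[a - b, +oo[)
          (xi * expR (- (xi ^+ 2 / (2 * t)) - x * xi / b)))).

End ExplicitDensity.

(* f(t) = g(t) (1 + o(1)) as t -> +oo. *)
Definition asymp_eq_pinfty (R : realType) (f g : R -> R) : Prop :=
  exists2 e : R -> R, e t @[t --> +oo] --> 0 &
    \forall t \near +oo, f t = g t * (1 + e t).

(* Main.v *)
(** Only the closed form of the density is used.  Write [m = |nu|] and
    [h = b / sqrt t].  Its first term is O(t^(-3/2)), which is negligible.
    In the second, the substitutions [xi = sqrt t * x] and [x = h * y] turn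
    [1/b] times the double integral into
    [(2 pi)^(-1/2) t^(-1) * int_0^oo L(h y) G((c - 1) h, y) dy], with
    [G(d, y) = int_d^oo x exp(-x^2/2 - x y) dx].  As [h -> 0] the function [L]
    behaves like a multiple of [h^(2m) y^(2m)] if [m > 0] and like
    [ln c / (ln h)^2] if [m = 0].  The bound
    [G(d, y) <= exp(-d y) (1 + d y) 4 / (1 + y)^2] compensates the growth
    [exp((c - 1) x)] of [L], so dominated convergence applies.  The limiting
    integral [int y^(2m) G(0, y) dy] is [Gamma(2m + 1) int x^(-2m) exp(-x^2/2) dx];
    it is combined with the factor [cos (pi m)] of [L] through
    [cos(pi s/2) Gamma(s) int x^(-s) exp(-x^2/2) dx
       = sqrt(pi/2) int u^(s-1) exp(-u^2/2) du] for [0 < s < 1]. *)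

Require Import Defs.
From HB Require Import structures.
From mathcomp Require Import all_boot all_order all_algebra.
From mathcomp Require Import all_classical all_reals all_analysis.
From mathcomp Require Import measurable_realfun lebesgue_integral_under.
From mathcomp Require Import ring lra.
Import Order.TTheory GRing.Theory Num.Theory.
Import numFieldNormedType.Exports.
Local Open Scope classical_set_scope.
Local Open Scope ring_scope.

Set Implicit Arguments.
Unset Strict Implicit.
Unset Printing Implicit Defensive.

(** * Integrals over the half-line *)

(** At infinity crude bounds on [hitting_L] suffice: after x = h y the cutoff (c - 1) h of the inner
    integral produces exactly the factor exp(-(c - 1) x) that cancels its growth. What must be exact
    is the behaviour at 0. For m > 0 it is a pure power, which scales. For m = 0 the logarithm does
    not scale: comparing ln (h y) with ln h costs a factor in ln y, and this is why the common
    domination allows y^p + y^(-p). In that case K_0(x) - K_0(c x) is needed up to o(1), but K_0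
    itself only up to O(1), so all estimates are phrased through differences of K_0. The closing
    identity of the overview takes the place of the reflection and duplication formulas of Gamma and
    removes the cosine from the answer. Its natural proof integrates u^(s-1) e^(-x^2/2) cos (u x) in
    both orders, but this double integral does not converge absolutely; hence the detour through
    angles below pi/2, carried out in real form. *)

Section HalfLine.
Context {R : realType}.
Local Notation mu := (@lebesgue_measure R).
Local Notation pos := (`]0%R, +oo[%classic : set R).
Implicit Types f g F : R -> R.

Definition intble f := mu.-integrable pos (EFin \o f).
Definition intpos f : R := \int[mu]_(x in pos) f x.

Lemma in_posE x : pos x = (0 < x) :> Prop.
Proof. by rewrite /= in_itv/= andbT. Qed.

Lemma measurable_pos : measurable (pos : set (measurableTypeR R)).
Proof. exact: measurable_itv. Qed.
Hint Resolve measurable_pos : core.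

Lemma measurable_cont_pos f : (forall x : R, 0 < x -> {for x, continuous f}) ->
  measurable_fun pos f.
Proof.
move=> cf; apply: open_continuous_measurable_fun; first exact: interval_open.
by move=> x; rewrite inE in_posE => /cf.
Qed.

Lemma intble_le f g : measurable_fun pos f -> intble g ->
  (forall x, 0 < x -> `|f x| <= g x) -> intble f.
Proof.
move=> mf ig fg; apply: (le_integrable _ _ _ ig) => //.
  exact/measurable_EFinP.
move=> x; rewrite in_posE => x0 /=; rewrite lee_fin.
by rewrite (le_trans (fg _ x0))// ler_norm.
Qed.

Lemma intble_measurable f : intble f -> measurable_fun pos f.
Proof. by move=> /measurable_int/measurable_EFinP. Qed.

Lemma eq_intble f g : (forall x, 0 < x -> f x = g x) -> intble f -> intble g.
Proof.
move=> fg; apply: eq_integrable => //= x; rewrite inE in_posE => x0.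
by rewrite fg.
Qed.

Lemma eq_intpos f g : (forall x, 0 < x -> f x = g x) -> intpos f = intpos g.
Proof.
by move=> fg; apply: eq_Rintegral => x; rewrite inE in_posE => /fg.
Qed.

Lemma intbleZ k f : intble f -> intble (fun x => k * f x).
Proof. by move=> /(integrableZl measurable_pos k). Qed.

Lemma intbleD f g : intble f -> intble g -> intble (fun x => f x + g x).
Proof. by move=> fi gi; have := integrableD measurable_pos fi gi. Qed.

Lemma intbleN f : intble f -> intble (fun x => - f x).
Proof. by move=> fi; have := integrableN fi. Qed.

Lemma intbleB f g : intble f -> intble g -> intble (fun x => f x - g x).
Proof. by move=> fi gi; apply: intbleD => //; exact: intbleN. Qed.

Lemma intposZ k f : intble f -> intpos (fun x => k * f x) = k * intpos f.
Proof. exact: RintegralZl. Qed.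

Lemma intposD f g : intble f -> intble g ->
  intpos (fun x => f x + g x) = intpos f + intpos g.
Proof. exact: RintegralD. Qed.

Lemma intposB f g : intble f -> intble g ->
  intpos (fun x => f x - g x) = intpos f - intpos g.
Proof. exact: RintegralB. Qed.

Lemma intpos_le f g : intble f -> intble g ->
  (forall x, 0 < x -> f x <= g x) -> intpos f <= intpos g.
Proof.
by move=> fi gi fg; apply: le_Rintegral => // x; rewrite in_posE => /fg.
Qed.

Lemma intpos_ge0 f : (forall x, 0 < x -> 0 <= f x) -> 0 <= intpos f.
Proof. by move=> f0; apply: Rintegral_ge0 => x; rewrite in_posE => /f0. Qed.

Lemma intpos_norm f g : intble f -> intble g ->
  (forall x, 0 < x -> `|f x| <= g x) -> `|intpos f| <= intpos g.
Proof.
move=> fi gi fg; apply: le_trans (le_normr_Rintegral measurable_pos fi) _.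
apply: intpos_le => //; apply: intble_le gi _ => [|x x0].
  by apply: measurableT_comp => //; exact: intble_measurable.
by rewrite normr_id fg.
Qed.

Lemma EFin_intpos f : intble f ->
  (\int[mu]_(x in pos) (f x)%:E)%E = (intpos f)%:E.
Proof. by move=> fi; rewrite /intpos /Rintegral fineK//; exact: integrable_fin_num. Qed.

Lemma intpos_dct (f_ : nat -> R -> R) f g :
  (forall n, measurable_fun pos (f_ n)) -> measurable_fun pos f ->
  intble g -> (forall n x, 0 < x -> `|f_ n x| <= g x) ->
  (forall x, 0 < x -> f_ n x @[n --> \oo] --> f x) ->
  intpos (f_ n) @[n --> \oo] --> intpos f.
Proof.
move=> mf_ mf ig fg ff.
have ifn n : intble (f_ n) by apply: intble_le ig _ => // x; exact: fg.
have h1 : {ae mu, forall x, pos x ->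
    (fun n => (EFin \o f_ n) x) @ \oo --> (EFin \o f) x}.
  apply: aeW => x; rewrite in_posE => x0; apply/cvg_EFin.
    by apply: nearW.
  exact: ff.
have h2 : {ae mu, forall x n, pos x -> (`|(EFin \o f_ n) x| <= (EFin \o g) x)%E}.
  by apply: aeW => x n; rewrite in_posE => x0 /=; rewrite lee_fin fg.
have [fi _ h3] := dominated_convergence measurable_pos
  (fun n => (measurable_EFinP _ _).2 (mf_ n)) ((measurable_EFinP _ _).2 mf)
  h1 ig h2.
have : ((intpos (f_ n))%:E)%E @[n --> \oo] --> (intpos f)%:E.
  rewrite -(EFin_intpos fi); apply: cvg_trans h3.
  by apply: near_eq_cvg; apply: nearW => n; rewrite -(EFin_intpos (ifn n)).
by move/fine_cvgP => -[].
Qed.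

(** Compact boxes away from 0, where [F] need not extend; the shift by two makes the interval
    nondegenerate already for [n = 0]. *)
Let box n := `[n.+2%:R^-1, n.+2%:R]%classic : set R.

Lemma box_pos n x : box n x -> 0 < x.
Proof. by rewrite /box/= in_itv/= => /andP[+ _]; apply: lt_le_trans. Qed.

Lemma box_lt n : n.+2%:R^-1 < n.+2%:R :> R.
Proof.
rewrite (@lt_trans _ _ 1)//; first by rewrite invf_lt1// ltr1n.
by rewrite ltr1n.
Qed.

Lemma cup_box : \bigcup_n box n = pos.
Proof.
apply/seteqP; split => [x [n _]|x]; first by rewrite in_posE; exact: box_pos.
rewrite in_posE => x0.
pose n := Num.truncn (x + x^-1); exists n => //.
have h : x + x^-1 < n.+2%:R.
  by rewrite (lt_trans (truncnS_gt _))// ltr_nat.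
have xV : 0 < x^-1 by rewrite invr_gt0.
rewrite /box/= in_itv/= invf_ple ?posrE//; apply/andP; split; lra.
Qed.

Lemma nd_box : nondecreasing_seq box.
Proof.
move=> m n mn; rewrite subsetEset => x; rewrite /box/= !in_itv/= => /andP[a b].
apply/andP; split; last by rewrite (le_trans b)// ler_nat.
by rewrite (le_trans _ a)// lef_pV2 ?posrE// ler_nat.
Qed.

Lemma ftc_box n f F : (forall x : R, 0 < x -> is_derive x 1 F (f x)) ->
  (forall x : R, 0 < x -> {for x, continuous f}) ->
  (\int[mu]_(x in box n) (f x)%:E)%E = (F n.+2%:R - F n.+2%:R^-1)%:E.
Proof.
move=> dF cf.
have cF x : 0 < x -> {for x, continuous F}.
  by move=> x0; apply/differentiable_continuous/derivable1_diffP; case: (dF _ x0).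
rewrite (@continuous_FTC2 _ f F)//.
- exact: box_lt.
- apply: continuous_in_subspaceT => x; rewrite inE => /box_pos; exact: cf.
- split.
  + move=> x; rewrite in_itv/= => /andP[h _].
    have x0 : 0 < x by rewrite (lt_trans _ h).
    by case: (dF _ x0).
  + apply: cvg_at_right_filter; exact: cF.
  + apply: cvg_at_left_filter; exact: cF.
- move=> x; rewrite in_itv/= => /andP[h _].
  have x0 : 0 < x by rewrite (lt_trans _ h).
  by rewrite derive1E; case: (dF _ x0).
Qed.

Lemma cvg_box F (l0 l1 : R) : F x @[x --> 0^'+] --> l0 -> F x @[x --> +oo] --> l1 ->
  F n.+2%:R - F n.+2%:R^-1 @[n --> \oo] --> l1 - l0.
Proof.
move=> F0 F1; apply: cvgB.
  move/cvg_pinftyP : F1 => /(_ (fun n => n.+2%:R)); apply.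
  have := @cvgr_idn R; rewrite -(cvg_shiftn 2).
  by under eq_fun do rewrite addn2.
move/cvg_at_rightP : F0 => /(_ (fun n => n.+2%:R^-1)); apply; split => //.
have := @cvg_harmonic R; rewrite -(cvg_shiftn 1).
by under eq_fun do rewrite addn1.
Qed.

(** Monotone convergence over the boxes: for [f >= 0], finiteness of the two limits of [F] yields
    integrability together with the value. *)
Lemma ftc_ge0 f F l0 l1 : (forall x : R, 0 < x -> is_derive x 1 F (f x)) ->
  (forall x : R, 0 < x -> {for x, continuous f}) ->
  (forall x, 0 < x -> 0 <= f x) ->
  F x @[x --> 0^'+] --> l0 -> F x @[x --> +oo] --> l1 ->
  intble f /\ intpos f = l1 - l0.
Proof.
move=> dF cf f0 F0 F1.
have mf := measurable_cont_pos cf.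
have : (\int[mu]_(x in box n) (f x)%:E)%E @[n --> \oo] -->
    (\int[mu]_(x in pos) (f x)%:E)%E.
  rewrite -cup_box; apply: ge0_nondecreasing_set_cvg_integral.
  - exact: nd_box.
  - by move=> i; exact: measurable_itv.
  - move=> i; apply/measurable_EFinP; apply: measurable_funS mf => //.
    by move=> x /box_pos; rewrite in_posE.
  - by move=> i x /box_pos x0; rewrite lee_fin f0.
under eq_fun do rewrite (ftc_box _ dF cf).
move=> h.
have fE : (\int[mu]_(x in pos) (f x)%:E)%E = (l1 - l0)%:E.
  by apply: (cvg_unique _ h) => //; apply/cvg_EFin; [exact: nearW|exact: cvg_box].
split; last by rewrite /intpos /Rintegral fE.
apply/integrableP; split; first exact/measurable_EFinP.
under eq_integral => x.
  rewrite inE in_posE => x0; rewrite /= ger0_norm ?f0//; over.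
by rewrite fE ltry.
Qed.

(** For an integrand of varying sign integrability is an input, and dominated convergence by [|f|]
    replaces monotone convergence. *)
Lemma ftc_pos f F l0 l1 : (forall x : R, 0 < x -> is_derive x 1 F (f x)) ->
  (forall x : R, 0 < x -> {for x, continuous f}) ->
  intble f ->
  F x @[x --> 0^'+] --> l0 -> F x @[x --> +oo] --> l1 ->
  intpos f = l1 - l0.
Proof.
move=> dF cf fi F0 F1.
have fE n : intpos (f \_ (box n)) = F n.+2%:R - F n.+2%:R^-1.
  rewrite /intpos -Rintegral_mkcondr setIidr; last first.
    by move=> x /box_pos; rewrite in_posE.
  by rewrite /Rintegral (ftc_box _ dF cf).
suff h : intpos (f \_ (box n)) @[n --> \oo] --> intpos f.
  move: h; under eq_fun do rewrite fE.
  by move=> h; exact: (cvg_unique _ h (cvg_box F0 F1)).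
have fi' : intble (fun x => `|f x|).
  by have := integrable_abse fi.
have mf := intble_measurable fi.
apply: intpos_dct fi' _ _ => //.
- move=> n; apply: measurable_funTS; apply/(measurable_restrictT _ _).1.
    exact: measurable_itv.
  apply: measurable_funS mf => //.
  by move=> x /box_pos; rewrite in_posE.
- by move=> n x x0; rewrite patchE; case: ifPn => //; rewrite normr0.
- move=> x x0.
  have [m _ xm] : (\bigcup_n box n) x by rewrite cup_box in_posE.
  apply: cvg_near_cst; exists m => // n /= mn.
  by rewrite patchE mem_set//; move: (x) xm; apply/subsetPset/nd_box.
Qed.

End HalfLine.

(** * Differentiation under the integral, scaling and Fubini on the half-line *)

Section HalfLineIntegrals.
Context {R : realType}.
Local Notation mu := (@lebesgue_measure R).
Local Notation pos := (`]0%R, +oo[%classic : set R).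
Implicit Types f g F : R -> R.
Hint Resolve measurable_pos : core.

Lemma is_derive_under (f df : R -> R -> R) g (u v a : R) : u < a -> a < v ->
  (forall x, u < x < v -> intble (f x)) ->
  (forall x y : R, u < x < v -> 0 < y -> is_derive x 1 (f ^~ y) (df x y)) ->
  intble g ->
  (forall x y, u < x < v -> 0 < y -> `|df x y| <= g y) ->
  is_derive a (1 : R) (fun x => intpos (f x)) (intpos (df a)).
Proof.
move=> ua av fi dfE gi dfg.
have Ia : (`]u, v[%classic : set R) a by rewrite /= in_itv/= ua av.
have If x : (`]u, v[%classic : set R) x -> mu.-integrable pos (EFin \o f x).
  by rewrite /= in_itv/=; exact: fi.
have Id x y : (`]u, v[%classic : set R) x -> pos y -> derivable (f ^~ y) x 1.
  rewrite /= !in_itv/= andbT => xI y0.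
  by case: (dfE _ _ xI y0).
have dE x y : u < x < v -> 0 < y -> partial1of2 f x y = df x y.
  by move=> xI y0; rewrite partial1of2E; case: (dfE _ _ xI y0).
have Ig : mu.-integrable pos (EFin \o (fun y => `|g y|)).
  by have := integrable_abse gi.
have gub x y : (`]u, v[%classic : set R) x -> pos y -> `|partial1of2 f x y| <= `|g y|.
  rewrite /= !in_itv/= andbT => xI y0.
  by rewrite dE// (le_trans (dfg _ _ xI y0))// ler_norm.
have g0 y : 0 <= `|g y| by [].
apply: DeriveDef.
  exact: (derivable_under_integral measurable_pos Ia If Id g0 Ig gub).
have := differentiation_under_integral measurable_pos Ia If Id g0 Ig gub.
rewrite derive1E => ->.
by apply: eq_Rintegral => y; rewrite inE in_posE => y0; rewrite dE// ua av.
Qed.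

(** By uniqueness of Lebesgue measure: [k] times the image measure gives every interval []a, b]] its
    length. *)
Lemma lebesgue_measure_scale (k : R) (A : set R) : 0 < k -> measurable A ->
  pushforward mu ( *%R k : measurableTypeR R -> measurableTypeR R) A = ((k^-1)%:E * mu A)%E.
Proof.
move=> k0 mA.
have mk : measurable_fun setT ( *%R k : measurableTypeR R -> measurableTypeR R).
  exact: mulrl_measurable.
pose kn := NngNum (ltW k0).
pose m : {measure set (measurableTypeR R) -> \bar R} :=
  mscale kn (pushforward mu ( *%R k : measurableTypeR R -> measurableTypeR R)).
rewrite (@lebesgue_measure_unique _ (m mk) _ A mA).
  by rewrite /m/= /mscale/= muleA -EFinM mulVf ?gt_eqF// mul1e.
move=> _ [[a b]] _ <-; rewrite /m/= /mscale/= /pushforward.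
have -> : ( *%R k) @^-1` `]a, b] = `](k^-1 * a)%R, (k^-1 * b)%R]%classic.
  apply/seteqP; split => x /=; rewrite !in_itv/= ![k^-1 * _]mulrC.
    by rewrite ltr_pdivrMr// ler_pdivlMr// ![x * k]mulrC.
  by rewrite ltr_pdivrMr// ler_pdivlMr// ![x * k]mulrC.
rewrite !lebesgue_measure_itv/= !lte_fin ltr_pM2l ?invr_gt0//.
case: ifPn => _; last by rewrite mule0.
by rewrite -EFinB -EFinB -EFinM; congr EFin; field; rewrite gt_eqF.
Qed.

Lemma ge0_integral_scale (k : R) (f : R -> \bar R) : 0 < k ->
  measurable_fun pos f -> (forall x, (0 < x)%R -> 0 <= f x)%E ->
  (\int[mu]_(x in pos) f (k * x)%R = (k^-1)%:E * \int[mu]_(x in pos) f x)%E.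
Proof.
move=> k0 mf f0.
have mk : measurable_fun setT ( *%R k : measurableTypeR R -> measurableTypeR R).
  exact: mulrl_measurable.
have kpos : ( *%R k) @^-1` pos = pos.
  by apply/seteqP; split => x /=; rewrite !in_itv/= !andbT pmulr_rgt0.
transitivity (\int[pushforward mu ( *%R k : measurableTypeR R -> measurableTypeR R)]_(x in pos) f x)%E.
  rewrite -[in LHS]kpos; symmetry.
  apply: (ge0_integral_pushforward mk) => //.
  by move=> x; rewrite inE in_posE => /f0.
have k0' : 0 <= k^-1 by rewrite invr_ge0 ltW.
rewrite -(ge0_integral_mscale _ measurable_pos (NngNum k0'))//; last first.
  by move=> x; rewrite in_posE => /f0.
by apply: eq_measure_integral => // A mA _; exact: lebesgue_measure_scale.
Qed.

Lemma measurable_scale (k : R) f : 0 < k -> measurable_fun pos f ->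
  measurable_fun pos (fun x => f (k * x)).
Proof.
move=> k0 mf; apply: (measurable_comp (F := pos)) => //.
by move=> _ [x + <-]; rewrite !in_posE => x0; rewrite mulr_gt0.
Qed.

Lemma intble_scale (k : R) f : 0 < k -> intble f -> intble (fun x => f (k * x)).
Proof.
move=> k0 fi; have mf := intble_measurable fi.
apply/integrableP; split.
  by apply/measurable_EFinP; exact: measurable_scale.
rewrite (ge0_integral_scale k0 (f := fun x => `|(f x)%:E|%E))//.
  have /integrableP[_ h] := fi.
  by rewrite lte_mul_pinfty// ?lee_fin// invr_ge0 ltW.
by apply: measurableT_comp => //; exact/measurable_EFinP.
Qed.

Lemma intpos_scale (k : R) f : 0 < k -> intble f ->
  intpos (fun x => f (k * x)) = k^-1 * intpos f.
Proof.
move=> k0 fi; have mf := intble_measurable fi.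
have ki := intble_scale k0 fi.
apply: EFin_inj; rewrite EFinM -!EFin_intpos//.
rewrite integralE [in RHS]integralE.
have mf' : measurable_fun pos (EFin \o f) by exact/measurable_EFinP.
rewrite muleBr//; last first.
  by apply: fin_num_adde_defl; rewrite ?fin_numN (integrable_neg_fin_num measurable_pos fi).
congr (_ - _)%E.
- transitivity (\int[mu]_(x in pos) (EFin \o f)^\+ (k * x)%R)%E.
    by apply: eq_integral => x _; rewrite !funeposE.
  apply: (ge0_integral_scale k0 (measurable_funepos mf')) => x _.
  exact: funepos_ge0.
- transitivity (\int[mu]_(x in pos) (EFin \o f)^\- (k * x)%R)%E.
    by apply: eq_integral => x _; rewrite !funenegE.
  apply: (ge0_integral_scale k0 (measurable_funeneg mf')) => x _.
  exact: funeneg_ge0.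
Qed.

(** Superlevel sets of a monotone function are intervals. The Bessel functions, and the Gaussian
    tail as a function of [y], are shown to be measurable this way. *)
Lemma measurable_mono_pos f : (forall x y, 0 < x -> x <= y -> f x <= f y) ->
  measurable_fun pos f.
Proof.
move=> f_nd mD; move: mD.
apply: (measurability (@RGenCInfty.G R)) => [|/= _ [_] [r] -> <-].
  exact: RGenCInfty.measurableE.
apply: is_interval_measurable => s t/= [].
rewrite !in_itv/= !andbT => s0 fs [_ ft] u /andP[su ut].
have u0 : 0 < u by rewrite (lt_le_trans s0).
by split; rewrite in_itv/= andbT// (le_trans fs)// f_nd.
Qed.

(** [f] is extended by zero off the quadrant; by Tonelli, the majorant [g] of the inner integrals of
    [|f|] gives integrability for the product measure. *)
Lemma fubini_pos (f : R -> R -> R) g :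
  measurable_fun [set: measurableTypeR R * measurableTypeR R]
    (fun z => f z.1 z.2) ->
  (forall x, 0 < x -> intble (f x)) ->
  (forall y, 0 < y -> intble (f ^~ y)) ->
  intble g -> (forall x, 0 < x -> intpos (fun y => `|f x y|) <= g x) ->
  intpos (fun x => intpos (f x)) = intpos (fun y => intpos (f ^~ y)).
Proof.
move=> mf fx fy gi fg.
pose F : measurableTypeR R * measurableTypeR R -> \bar R := (fun z : measurableTypeR R * measurableTypeR R =>
  (f z.1 z.2)%:E) \_ (pos `*` pos).
have mF : measurable_fun [set: measurableTypeR R * measurableTypeR R] F.
  apply/(measurable_restrictT _ _).1; first exact: measurableX.
  by apply: measurable_funTS; exact/measurable_EFinP.
have FE x y : F (x, y) = (if (0 < x) && (0 < y) then f x y else 0)%:E.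
  rewrite /F patchE; case: ifPn => [|].
    by rewrite inE => -[/=]; rewrite !in_itv/= !andbT => -> ->.
  rewrite notin_setE; case: ifPn => // /andP[x0 y0] []; split => /=;
  by rewrite in_itv/= andbT.
have sec1 x : (\int[mu]_y F (x, y) =
    (if (0 < x)%R then intpos (f x) else 0%R)%:E)%E.
  case: ifPn => x0; last first.
    by rewrite integral0_eq// => y _; rewrite FE (negbTE x0).
  rewrite -(EFin_intpos (fx _ x0)) [RHS]integral_mkcond.
  apply: eq_integral => y _; rewrite FE x0/= patchE mem_setE in_itv/= andbT.
  by case: ifPn.
have sec2 y : (\int[mu]_x F (x, y) =
    (if (0 < y)%R then intpos (f ^~ y) else 0%R)%:E)%E.
  case: ifPn => y0; last first.
    by rewrite integral0_eq// => x _; rewrite FE (negbTE y0) andbF.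
  rewrite -(EFin_intpos (fy _ y0)) [RHS]integral_mkcond.
  apply: eq_integral => x _; rewrite FE y0/= andbT patchE mem_setE in_itv/= andbT.
  by case: ifPn.
have Fi : (mu \x mu)%E.-integrable
    [set: measurableTypeR R * measurableTypeR R] F.
  apply/integrable12ltyP => //.
  have /integrableP[_] := gi.
  apply: le_lt_trans; rewrite [leRHS]integral_mkcond.
  apply: ge0_le_integral => //.
  - by move=> x _; exact: integral_ge0.
  - apply: (measurable_fun_fubini_tonelli_F (abse \o F)) => //.
    exact: measurableT_comp.
    by move=> x; exact: abse_ge0.
  - apply/(measurable_restrictT _ _).1 => //.
    by apply: measurableT_comp => //; exact: (measurable_int _ gi).
  move=> x _; rewrite patchE mem_setE in_itv/= andbT; case: ifPn => x0.
    apply: (@le_trans _ _ (g x)%:E); last by rewrite lee_fin ler_norm.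
    apply: (@le_trans _ _ (intpos (fun y => `|f x y|))%:E).
      rewrite -EFin_intpos; last by have := integrable_abse (fx _ x0).
      rewrite [leRHS]integral_mkcond.
      rewrite le_eqVlt; apply/orP; left; apply/eqP.
      apply: eq_integral => y _; rewrite FE x0/= patchE mem_setE in_itv/= andbT.
      by case: ifPn => // _; rewrite normr0.
    by rewrite lee_fin fg.
  by rewrite integral0_eq// => y _; rewrite FE (negbTE x0)/= normr0.
have := Fubini Fi.
under eq_integral do rewrite sec1.
under [in X in _ = X -> _]eq_integral do rewrite sec2.
rewrite /intpos /Rintegral => h.
rewrite integral_mkcond [in RHS]integral_mkcond; congr fine.
transitivity (\int[mu]_x (if (0 < x)%R then intpos (f x) else 0%R)%:E)%E.
  apply: eq_integral => x _; rewrite patchE mem_setE in_itv/= andbT.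
  by case: ifPn.
rewrite h.
apply: eq_integral => x _; rewrite patchE mem_setE in_itv/= andbT.
by case: ifPn.
Qed.

End HalfLineIntegrals.

(** * Differentiation rules for real functions *)

Section Derive1.
Context {R : realType}.
Implicit Types (f g : R -> R) (x a b : R).

Lemma is_derive1_cst x c : is_derive x (1 : R) (fun _ : R => c : R) 0.
Proof. exact: is_derive_cst. Qed.

Lemma is_derive1_id x : is_derive x (1 : R) (fun t : R => t) 1.
Proof. exact: is_derive_id. Qed.

Lemma is_derive1_add f g x a b : is_derive x 1 f a -> is_derive x 1 g b ->
  is_derive x 1 (fun t => f t + g t) (a + b).
Proof. by move=> fa gb; exact: is_deriveD. Qed.

Lemma is_derive1_opp f x a : is_derive x 1 f a ->
  is_derive x 1 (fun t => - f t) (- a).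
Proof. by move=> fa; exact: is_deriveN. Qed.

Lemma is_derive1_mul f g x a b : is_derive x 1 f a -> is_derive x 1 g b ->
  is_derive x 1 (fun t => f t * g t) (a * g x + f x * b).
Proof.
move=> fa gb; apply: (@is_derive_eq _ _ _ _ _ _ _ _ (is_deriveM fa gb)).
by rewrite addrC /GRing.scale/= [g x * a]mulrC.
Qed.

Lemma is_derive1_expR f x a : is_derive x 1 f a ->
  is_derive x 1 (fun t => expR (f t)) (expR (f x) * a).
Proof. by move=> fa; exact: (is_derive1_comp (is_derive_expR _)). Qed.

Lemma is_derive1_cos f x a : is_derive x 1 f a ->
  is_derive x 1 (fun t => cos (f t)) (- sin (f x) * a).
Proof. by move=> fa; exact: (is_derive1_comp (is_derive_cos _)). Qed.

Lemma is_derive1_sin f x a : is_derive x 1 f a ->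
  is_derive x 1 (fun t => sin (f t)) (cos (f x) * a).
Proof. by move=> fa; exact: (is_derive1_comp (is_derive_sin _)). Qed.

Lemma is_derive1_pow p x : 0 < x ->
  is_derive x 1 (fun t : R => t `^ p) (p * x `^ (p - 1)).
Proof. by move=> x0; exact: is_derive1_powR. Qed.

Lemma is_derive1_powf f p x a : 0 < f x -> is_derive x 1 f a ->
  is_derive x 1 (fun t => f t `^ p) (p * f x `^ (p - 1) * a).
Proof. by move=> f0 fa; exact: (is_derive1_comp (is_derive1_pow p f0)). Qed.

Lemma is_derive1_sqr f x a : is_derive x 1 f a ->
  is_derive x 1 (fun t => f t ^+ 2) (2 * f x * a).
Proof.
move=> fa; under eq_fun do rewrite expr2.
by apply: (is_derive_eq (is_derive1_mul fa fa)); ring.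
Qed.

Lemma is_derive1_inv f x a : f x != 0 -> is_derive x 1 f a ->
  is_derive x 1 (fun t => (f t)^-1) (- a / f x ^+ 2).
Proof.
move=> f0 fa; have [df <-] := fa.
apply: DeriveDef; first exact: derivableV.
by rewrite deriveV// /GRing.scale/= mulNr mulNr mulrC.
Qed.

Lemma is_derive1_continuous f x a : is_derive x 1 f a -> {for x, continuous f}.
Proof. by case=> df _; exact/differentiable_continuous/derivable1_diffP. Qed.

Lemma cvg_to_at_right {T : Type} {F : set_system T} {FF : Filter F} (f : T -> R) a :
  f @ F --> a -> (\forall x \near F, a < f x) -> f @ F --> a^'+.
Proof.
move=> fa fp A; rewrite /at_right /within /= => /fa hA.
by near=> x; near: x; apply: filterS2 hA fp => x /=; apply.
Unshelve. all: by end_near. Qed.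

End Derive1.

(** Derivatives are computed from the syntax of the function; positivity and nonvanishing conditions
    for powers and inverses remain as goals unless they are assumed. *)
Ltac is_derive1 := repeat first [
    notypeclasses refine (is_derive1_cst _ _)
  | notypeclasses refine (is_derive1_id _)
  | notypeclasses refine (is_derive1_add _ _)
  | notypeclasses refine (is_derive1_opp _)
  | notypeclasses refine (is_derive1_mul _ _)
  | notypeclasses refine (is_derive1_expR _)
  | notypeclasses refine (is_derive1_cos _)
  | notypeclasses refine (is_derive1_sin _)
  | notypeclasses refine (is_derive1_sqr _)
  | notypeclasses refine (is_derive1_pow _ _)
  | notypeclasses refine (is_derive1_powf _ _ _)
  | notypeclasses refine (is_derive1_inv _ _) ]; try assumption.
Ltac is_derive1_by :=
  notypeclasses refine (is_derive_eq _ _); [is_derive1 | cbv beta].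

Ltac continuous1 := eapply is_derive1_continuous; is_derive1.

(** * The dominating functions x^p / (1 + x)^2 *)

Section DominatingFunctions.
Context {R : realType}.
Local Notation mu := (@lebesgue_measure R).
Local Notation pos := (`]0%R, +oo[%classic : set R).
Implicit Types (f g : R -> R) (x p : R).

Lemma cvgy_inv1D : (fun x : R => (1 + x)^-1) @ +oo --> (0 : R).
Proof.
apply/cvgrPdist_le => e e0; near=> x.
have x0 : 0 < x by near: x; exact: nbhs_pinfty_gt.
rewrite sub0r normrN ger0_norm ?invr_ge0 ?addr_ge0 ?(ltW x0)//.
rewrite invf_ple ?posrE ?addr_gt0//.
have : e^-1 <= x by near: x; apply: nbhs_pinfty_ge; rewrite num_real.
lra.
Unshelve. all: by end_near. Qed.

Lemma cvgy_powN p : 0 < p -> (fun x : R => (1 + x) `^ (- p)) @ +oo --> (0 : R).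
Proof.
move=> p0.
have h : (fun x : R => ((1 + x)^-1) `^ p) @ +oo --> (0 : R).
  apply: (@cvg_comp _ _ _ (fun x : R => (1 + x)^-1) (fun y => y `^ p) _ _ _ _
    (powR_cvg0 p0)).
  apply: cvg_to_at_right; first exact: cvgy_inv1D.
  near=> x; have x0 : 0 < x by near: x; exact: nbhs_pinfty_gt.
  by rewrite invr_gt0 addr_gt0.
apply: cvg_trans h; apply: near_eq_cvg; near=> x.
have x0 : 0 < x by near: x; exact: nbhs_pinfty_gt.
have x1 : 0 < 1 + x by rewrite addr_gt0.
by rewrite -powR_inv1 ?(ltW x1)// -powRrM mulN1r.
Unshelve. all: by end_near. Qed.

(** These are the majorants of the later dominated convergence arguments: [p > -1] serves at 0 and
    [p < 1] at infinity. *)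
Lemma intble_pow1D p : -1 < p < 1 -> intble (fun x => x `^ p / (1 + x) ^+ 2).
Proof.
move=> /andP[p1 p2].
have mf : measurable_fun pos (fun x => x `^ p / (1 + x) ^+ 2).
  apply: measurable_cont_pos => x x0; continuous1 => //.
  by rewrite expf_eq0/= gt_eqF// addr_gt0.
have pow2 (x q : R) : 0 < x -> (1 + x) `^ (q - 2) = (1 + x) `^ q / (1 + x) ^+ 2.
  move=> x0; have x1 : 0 < 1 + x by rewrite addr_gt0.
  by rewrite powRB ?(gt_eqF x1) ?implybT// -powR_mulrn// ltW.
(* For [p >= 0], x^p is at most (1 + x)^p, and (1 + x)^(p - 2) has an explicit primitive. *)
have [p0|p0] := leP 0 p.
  have [gi _] : intble (fun x => (1 - p) * (1 + x) `^ (p - 2)) /\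
      intpos (fun x => (1 - p) * (1 + x) `^ (p - 2)) = 0 - (- 1).
    apply: (@ftc_ge0 R _ (fun x => - (1 + x) `^ (- (1 - p)))).
    - move=> x x0; is_derive1_by; first by rewrite addr_gt0.
      by rewrite (_ : - (1 - p) - 1 = p - 2); ring.
    - move=> x x0; continuous1; by rewrite addr_gt0.
    - by move=> x x0; rewrite mulr_ge0 ?powR_ge0// subr_ge0 ltW.
    - apply: cvgN; apply: cvg_at_right_filter.
      have : continuous_at (0 : R) (fun x : R => (1 + x) `^ (- (1 - p))).
        by continuous1; rewrite addr0.
      by rewrite /continuous_at/= addr0 powR1.
    - by rewrite -oppr0; apply: cvgN; apply: cvgy_powN; rewrite subr_gt0.
  apply: (intble_le mf (intbleZ (1 - p)^-1 gi)) => x x0.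
  have x1 : 0 < 1 + x by rewrite addr_gt0.
  rewrite mulrA mulVf ?mul1r ?subr_eq0 ?gt_eqF//.
  rewrite ger0_norm ?mulr_ge0 ?powR_ge0 ?invr_ge0 ?sqr_ge0//.
  rewrite pow2// ler_wpM2r ?invr_ge0 ?sqr_ge0//.
  by rewrite ge0_ler_powR ?nnegrE ?(ltW x0) ?(ltW x1)//; lra.
(* For [p < 0], (1 + x)^(-p) is at least 1, and x^p (1 + x)^(-p - 2) is, up to the factor p + 1, the
   derivative of (x / (1 + x))^(p + 1). *)
have q0 : 0 < p + 1 by lra.
have [gi _] : intble (fun x => (p + 1) * (x `^ p * (1 + x) `^ (- p - 2))) /\
    intpos (fun x => (p + 1) * (x `^ p * (1 + x) `^ (- p - 2))) = 1 - 0.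
  apply: (@ftc_ge0 R _ (fun x => (x / (1 + x)) `^ (p + 1))).
  - move=> x x0; have x1 : 0 < 1 + x by rewrite addr_gt0.
    is_derive1_by; rewrite ?divr_gt0 ?gt_eqF//.
    rewrite addrK powRM ?invr_ge0 ?(ltW x0) ?(ltW x1)//.
    rewrite pow2//.
    have -> : (1 + x)^-1 `^ p = (1 + x) `^ (- p).
      by rewrite -powR_inv1 ?(ltW x1)// -powRrM mulN1r.
    by field; rewrite gt_eqF.
  - move=> x x0; have x1 : 0 < 1 + x by rewrite addr_gt0.
    by continuous1.
  - by move=> x x0; rewrite !mulr_ge0 ?powR_ge0// ltW.
  - apply: (@squeeze_cvgr _ _ _ _ (fun=> 0) (fun x => x `^ (p + 1))).
    + near=> x; rewrite powR_ge0/=.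
      have x0 : 0 < x by near: x; exact: nbhs_right_gt.
      have x1 : 0 < 1 + x by rewrite addr_gt0.
      rewrite ge0_ler_powR ?nnegrE ?divr_ge0 ?(ltW x0) ?(ltW x1) ?(ltW q0)//.
      by rewrite ler_pdivrMr// ler_peMr ?(ltW x0)// lerDl ltW.
    + exact: cvg_cst.
    + exact: powR_cvg0.
  - apply: (@cvg_comp _ _ _ (fun x : R => x / (1 + x)) (fun y => y `^ (p + 1))
      _ (nbhs (1 : R))); last first.
      have : continuous_at (1 : R) (fun y : R => y `^ (p + 1)) by continuous1.
      by rewrite /continuous_at/= powR1.
    have : (fun x : R => 1 - (1 + x)^-1) @ +oo --> (1 : R).
      by rewrite -[X in _ --> X]subr0; apply: cvgB; [exact: cvg_cst|exact: cvgy_inv1D].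
    apply: cvg_trans; apply: near_eq_cvg; near=> x.
    have x0 : 0 < x by near: x; exact: nbhs_pinfty_gt.
    by field; rewrite gt_eqF// addr_gt0.
apply: (intble_le mf (intbleZ (p + 1)^-1 gi)) => x x0.
have x1 : 0 < 1 + x by rewrite addr_gt0.
rewrite mulrA mulVf ?mul1r ?gt_eqF//.
rewrite ger0_norm ?mulr_ge0 ?powR_ge0 ?invr_ge0 ?sqr_ge0//.
rewrite ler_wpM2l ?powR_ge0// pow2// ler_peMl ?invr_ge0 ?sqr_ge0//.
rewrite -[leLHS](powRr0 (1 + x)) ler_powR ?lerDl ?(ltW x0)//; lra.
Unshelve. all: by end_near. Qed.

End DominatingFunctions.

(** * The Gamma function and Gaussian integrals *)

Section GammaFunction.
Context {R : realType}.
Local Notation mu := (@lebesgue_measure R).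
Local Notation pos := (`]0%R, +oo[%classic : set R).
Implicit Types (f g F dF : R -> R) (x p z k : R).
Hint Resolve measurable_pos : core.

Lemma intpos_gt0 f : intble f -> (forall x, 0 < x -> 0 < f x) -> 0 < intpos f.
Proof.
move=> fi f0; rewrite lt_neqAle intpos_ge0 ?andbT; last first.
  by move=> x /f0/ltW.
apply/eqP => f00.
have mf : measurable_fun pos (EFin \o f).
  by apply/measurable_EFinP; exact: intble_measurable.
have : (\int[mu]_(x in pos) `|(EFin \o f) x| = 0)%E.
  under eq_integral => x.
    rewrite inE in_posE => x0; rewrite /= ger0_norm ?(ltW (f0 _ x0))//; over.
  by rewrite EFin_intpos// -f00.
move/(ae_eq_integral_abs mu measurable_pos mf) => -[N [mN N0 posN]].
have : (mu pos <= mu N)%E.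
  apply: le_measure; rewrite ?inE// => x; rewrite in_posE => x0; apply: posN => /=.
  rewrite in_itv/= andbT => /(_ x0) []; apply/eqP; rewrite gt_eqF//; exact: f0.
by rewrite N0 lebesgue_measure_itv/= ltry.
Qed.

Lemma powexp_le z : 0 <= z -> exists2 C, 0 <= C &
  forall u : R, 0 <= u -> (1 + u) `^ z * expR (- u) <= C / (1 + u) ^+ 2.
Proof.
(* This [n] is at least z + 2, and exp (1 + u) is at least (1 + u)^n / n!; hence the constant n!
   e. *)
move=> z0; pose n := (Num.truncn z).+3.
exists (n`!%:R * expR 1) => [|u u0]; first by rewrite mulr_ge0 ?expR_ge0.
have u1 : 0 < 1 + u by rewrite ltr_pwDl.
rewrite ler_pdivlMr ?exprn_gt0// mulrAC expRN ler_pdivrMr ?expR_gt0//.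
rewrite -mulrA -expRD -ler_pdivrMl ?ltr0n ?fact_gt0//.
have := @expR_ge1Dxn _ (1 + u) n.-1 (ltW u1); rewrite -/n.
apply: le_trans; rewrite (@le_trans _ _ ((1 + u) ^+ n / n`!%:R))//; last first.
  by rewrite lerDr.
rewrite mulrC ler_wpM2r ?invr_ge0//.
rewrite -!powR_mulrn ?(ltW u1)// -powRD ?(gt_eqF u1) ?implybT//.
rewrite ler_powR ?lerDl// /n.
have := truncnS_gt z; rewrite -natr1 -[(Num.truncn z).+3]addn2 natrD -natr1.
lra.
Qed.

Lemma intble_pow1 p k : -1 < p < 1 ->
  intble (fun x => k * (x `^ p / (1 + x) ^+ 2)).
Proof. by move=> p1; apply: intbleZ; exact: intble_pow1D. Qed.

Lemma intble_powexp1 z : 0 < z -> intble (fun u => u `^ (z - 1) * expR (- u)).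
Proof.
move=> z0.
have mf : measurable_fun pos (fun u : R => u `^ (z - 1) * expR (- u)).
  by apply: measurable_cont_pos => x x0; continuous1.
have [z1|z1] := leP 1 z.
  have [|C C0 CE] := @powexp_le (z - 1); first by rewrite subr_ge0.
  have h : -1 < (0 : R) < 1 by rewrite ltrN10 ltr01.
  apply: (intble_le mf (intble_pow1 C h)) => u u0.
  rewrite ger0_norm ?mulr_ge0 ?powR_ge0 ?expR_ge0// powRr0 mul1r.
  apply: le_trans (CE _ (ltW u0)); rewrite ler_wpM2r ?expR_ge0//.
  by rewrite ge0_ler_powR ?nnegrE ?subr_ge0 ?addr_ge0 ?(ltW u0)// lerDr.
have [C C0 CE] := @powexp_le 0 (lexx _).
have h : -1 < z - 1 < 1 by apply/andP; split; lra.
apply: (intble_le mf (intble_pow1 C h)) => u u0.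
rewrite ger0_norm ?mulr_ge0 ?powR_ge0 ?expR_ge0// mulrCA ler_wpM2l ?powR_ge0//.
by apply: le_trans (CE _ (ltW u0)); rewrite powRr0 mul1r.
Qed.

Lemma cvgy_powexp z : 0 <= z -> (fun u : R => u `^ z * expR (- u)) @ +oo --> (0 : R).
Proof.
move=> z0; have [C C0 CE] := powexp_le z0.
apply: (@squeeze_cvgr _ _ _ _ (fun=> 0) (fun x => C * (1 + x)^-1)).
- near=> x.
  have x0 : 0 < x by near: x; exact: nbhs_pinfty_gt.
  have x1 : 0 < 1 + x by rewrite addr_gt0.
  rewrite mulr_ge0 ?powR_ge0 ?expR_ge0//=.
  apply: (@le_trans _ _ ((1 + x) `^ z * expR (- x))).
    rewrite ler_wpM2r ?expR_ge0// ge0_ler_powR ?nnegrE ?(ltW x0) ?(ltW x1)//.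
    by rewrite lerDr.
  apply: (le_trans (CE _ (ltW x0))); rewrite ler_wpM2l// lef_pV2 ?posrE ?exprn_gt0//.
  by rewrite expr2 ler_peMl ?(ltW x1)// lerDl ltW.
- exact: cvg_cst.
- rewrite -[X in _ --> X](mulr0 C); apply: cvgM; first exact: cvg_cst.
  exact: cvgy_inv1D.
Unshelve. all: by end_near. Qed.

Lemma GammaE z : Gamma z = intpos (fun u => u `^ (z - 1) * expR (- u)).
Proof. by []. Qed.

Lemma Gamma_gt0 z : 0 < z -> 0 < Gamma z.
Proof.
move=> z0; apply: intpos_gt0; first exact: intble_powexp1.
by move=> x x0; rewrite mulr_gt0 ?powR_gt0 ?expR_gt0.
Qed.

Lemma GammaS z : 0 < z -> Gamma (z + 1) = z * Gamma z.
Proof.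
move=> z0; have z1 : 0 < z + 1 by rewrite addr_gt0.
have i0 := intble_powexp1 z0; have i1 := intble_powexp1 z1.
apply/eqP; rewrite -subr_eq0 !GammaE -intposZ// -intposB//; last exact: intbleZ.
apply/eqP; rewrite -[RHS](subr0 0).
apply: (@ftc_pos R _ (fun u => - (u `^ z * expR (- u)))).
- move=> u u0; is_derive1_by.
  by rewrite /= addrK; ring.
- by move=> u u0; continuous1.
- by apply: intbleB => //; exact: intbleZ.
- rewrite -[X in _ --> X]oppr0; apply: cvgN.
  have : u `^ z * expR (- u) @[u --> 0^'+] --> (0 : R) * expR (- 0).
    apply: cvgM; first exact: powR_cvg0.
    apply: cvg_at_right_filter.
    have : continuous_at (0 : R) (fun u : R => expR (- u)) by continuous1.
    exact.
  by rewrite mul0r.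
- by rewrite -[X in _ --> X]oppr0; apply: cvgN; apply: cvgy_powexp; exact: ltW.
Qed.

Lemma Gamma1 : Gamma (1 : R) = 1.
Proof.
rewrite GammaE.
rewrite (eq_intpos (g := fun u => expR (- u))); last first.
  by move=> x x0; rewrite subrr powRr0 mul1r.
have [|||||_ ->] := @ftc_ge0 R (fun u => expR (- u)) (fun u => - expR (- u)) (- 1) 0.
- by move=> x x0; is_derive1_by; ring.
- by move=> x x0; continuous1.
- by move=> x x0; rewrite expR_ge0.
- apply: cvgN; apply: cvg_at_right_filter.
  have : continuous_at (0 : R) (fun u : R => expR (- u)) by continuous1.
  by rewrite /continuous_at oppr0 expR0.
- by rewrite -[X in _ --> X]oppr0; apply: cvgN; exact: cvgr_expR.
- by rewrite opprK add0r.
Qed.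

Lemma intble_powexp z k : 0 < z -> 0 < k ->
  intble (fun u => u `^ (z - 1) * expR (- (k * u))).
Proof.
move=> z0 k0.
have := intbleZ (k `^ (1 - z)) (intble_scale k0 (intble_powexp1 z0)).
apply: eq_intble => x x0; rewrite powRM ?(ltW x0) ?(ltW k0)//.
rewrite !mulrA -powRD ?(gt_eqF k0) ?implybT//.
by rewrite (_ : 1 - z + (z - 1) = 0) ?powRr0 ?mul1r//; ring.
Qed.

Lemma intpos_powexp z k : 0 < z -> 0 < k ->
  intpos (fun u => u `^ (z - 1) * expR (- (k * u))) = k `^ (- z) * Gamma z.
Proof.
move=> z0 k0; have h := intble_powexp1 z0.
rewrite (eq_intpos (g := fun u => k `^ (1 - z) *
    ((k * u) `^ (z - 1) * expR (- (k * u))))); last first.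
  move=> x x0; rewrite powRM ?(ltW x0) ?(ltW k0)//.
  rewrite !mulrA -powRD ?(gt_eqF k0) ?implybT//.
  by rewrite (_ : 1 - z + (z - 1) = 0) ?powRr0 ?mul1r//; ring.
rewrite intposZ; last exact: (intble_scale k0 h).
rewrite (intpos_scale k0 h) mulrA -[k^-1]powR_inv1 ?(ltW k0)//.
rewrite -powRD ?(gt_eqF k0) ?implybT// GammaE.
by congr (_ `^ _ * _); ring.
Qed.

(** A primitive of the new integrand is [H] composed with [F], where [H w] is the integral of [g]
    over (0, w]; its limits at 0 and at infinity come from dominated convergence. The sign
    conditions make [ftc_ge0] applicable, which also gives integrability. *)
Lemma intpos_subst g F dF : intble g -> (forall x, 0 < x -> 0 <= g x) ->
  (forall x : R, 0 < x -> {for x, continuous g}) ->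
  (forall x, 0 < x -> 0 < F x) -> (forall x, 0 < x -> 0 <= dF x) ->
  (forall x : R, 0 < x -> is_derive x 1 F (dF x)) ->
  (forall x : R, 0 < x -> {for x, continuous dF}) ->
  F @ 0^'+ --> (0 : R) -> F @ +oo --> +oo ->
  intble (fun x => g (F x) * dF x) /\
  intpos (fun x => g (F x) * dF x) = intpos g.
Proof.
move=> gi g0 cg F0 dF0 FD cdF Fl Fr.
pose H w := \int[mu]_(x in `]0, w]) g x.
have HE : H = fun w => intpos (g \_ `]0, w]).
  apply/funext => w; rewrite /H /intpos -Rintegral_mkcondr setIidr// => x /=.
  by rewrite !in_itv/= => /andP[-> _].
have mgw w : measurable_fun pos (g \_ `]0, w]).
  apply: measurable_funTS; apply/(measurable_restrictT _ _).1.
    exact: measurable_itv.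
  apply: measurable_funS (intble_measurable gi) => // x /=.
  by rewrite !in_itv/= => /andP[-> _].
have gw w x : 0 < x -> `|(g \_ `]0, w]) x| <= g x.
  move=> x0; rewrite patchE; case: ifPn => _; first by rewrite ger0_norm// g0.
  by rewrite normr0 g0.
have dH (w : R) : 0 < w -> is_derive w (1 : R) H (g w).
  move=> w0.
  have gi' : mu.-integrable [set` Interval (BRight 0) (BRight (w + 1))] (EFin \o g).
    apply: integrableS gi => // x /=.
    by rewrite !in_itv/= => /andP[-> _].
  have [||h1 h2] := @continuous_FTC1 R g (BRight 0) w (w + 1) _ gi' _ (cg _ w0).
  - by rewrite ltrDl.
  - by rewrite /= ?lte_fin ?bnd_simp.
  - by apply: DeriveDef; [exact: h1|rewrite -derive1E; exact: h2].
have Hy : H @ +oo --> intpos g.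
  rewrite HE; apply/cvg_pinftyP => u uy.
  apply: (@intpos_dct R (fun n => g \_ `]0, u n]) g g) => //.
    exact: (intble_measurable gi).
    by move=> n x; exact: gw.
  move=> x x0; apply: cvg_near_cst.
  move/cvgryPge : uy => /(_ x); apply: filterS => n xn.
  by rewrite patchE mem_set//= in_itv/= x0.
have H0 : H @ 0^'+ --> (0 : R).
  rewrite HE; apply/cvg_at_rightP => u [u0 ul].
  have h0 : intpos (fun=> 0 : R) = 0 by rewrite /intpos Rintegral_cst// mul0r.
  rewrite -[X in _ --> X]h0.
  apply: (@intpos_dct R (fun n => g \_ `]0, u n]) (fun=> 0) g) => //.
    by move=> n x; exact: gw.
  move=> x x0; apply: cvg_near_cst.
  move/cvgr_lt : ul => /(_ x x0); apply: filterS => n xn.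
  by rewrite patchE memNset//= in_itv/= x0/= leNgt xn.
have [|||||h1 h2] := @ftc_ge0 R (fun x => g (F x) * dF x) (H \o F) 0 (intpos g).
- move=> x x0; apply: (is_derive1_comp (dH _ (F0 _ x0))); exact: FD.
- move=> x x0; apply: (@continuousM _ _ (g \o F)); last exact: cdF.
  apply: continuous_comp; last exact: cg (F0 _ x0).
  exact: is_derive1_continuous (FD _ x0).
- by move=> x x0; rewrite mulr_ge0 ?g0 ?dF0 ?F0.
- apply: (@cvg_comp _ _ _ F H _ (0^'+)); last exact: H0.
  apply: cvg_to_at_right => //; near=> x.
  have x0 : 0 < x by near: x; exact: nbhs_right_gt.
  exact: F0.
- by apply: (@cvg_comp _ _ _ F H _ _ _ Fr).
by split => //; rewrite h2 subr0.
Unshelve. all: by end_near. Qed.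

End GammaFunction.

(** * Gaussian integrals and rotation of the Gamma integral *)

Section GaussianIntegrals.
Context {R : realType}.
Local Notation mu := (@lebesgue_measure R).
Local Notation pos := (`]0%R, +oo[%classic : set R).
Implicit Types (f g F dF : R -> R) (x p z k s u th : R).
Hint Resolve measurable_pos : core.

Lemma squeeze_norm0 {T : Type} {F : set_system T} {FF : Filter F} (f g : T -> R) :
  (\forall x \near F, `|f x| <= g x) -> g @ F --> (0 : R) -> f @ F --> (0 : R).
Proof.
move=> fg g0; apply/cvgr0Pnorm_le => e e0.
move/cvgr0Pnorm_le : g0 => /(_ _ e0); apply: filterS2 fg => x fx gx.
by rewrite (le_trans fx)// (le_trans (ler_norm _)).
Qed.

Lemma continuous_at_right f (a b : R) : {for a, continuous f} -> f a = b ->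
  f @ a^'+ --> b.
Proof. by move=> fa <-; apply: cvg_at_right_filter; exact: fa. Qed.

Lemma gaussian_integral : intble (fun x : R => expR (- (x ^+ 2 / 2))) /\
  intpos (fun x : R => expR (- (x ^+ 2 / 2))) = Num.sqrt (pi / 2).
Proof.
pose k : R := (Num.sqrt 2)^-1.
have k0 : 0 < k by rewrite invr_gt0 sqrtr_gt0.
have gi : intble (@gauss_fun R).
  by apply: integrableS integrableT_gauss.
have gk x : gauss_fun (k * x) = expR (- (x ^+ 2 / 2)).
  by rewrite /gauss_fun exprMn /k exprVn sqr_sqrtr// mulrC.
have ge : intpos (@gauss_fun R) = Num.sqrt pi / 2.
  rewrite /intpos /Rintegral integral_itv_obnd_cbnd; last first.
    by apply/measurable_EFinP; exact: intble_measurable.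
  by rewrite integral0y_gauss.
split.
  by have := intble_scale k0 gi; apply: eq_intble => x _.
rewrite -(eq_intpos (f := fun x => gauss_fun (k * x)))//.
rewrite (intpos_scale k0 gi) ge invrK sqrtrM ?pi_ge0// sqrtrV//.
rewrite -[in X in _ * (_ / X)](sqr_sqrtr (ler0n R 2)).
by field; rewrite gt_eqF// sqrtr_gt0.
Qed.

Lemma intpos_powgauss z : 0 < z ->
  intble (fun u => u `^ (z - 1) * expR (- (u ^+ 2 / 2))) /\
  intpos (fun u => u `^ (z - 1) * expR (- (u ^+ 2 / 2))) =
    2 `^ (z / 2 - 1) * Gamma (z / 2).
Proof.
move=> z0; have z2 : 0 < z / 2 by rewrite divr_gt0.
have gi := intble_powexp1 z2.
have [||||||||i e] := intpos_subst (F := fun u => u ^+ 2 / 2) (dF := id) gi.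
- by move=> x x0; rewrite mulr_ge0 ?powR_ge0 ?expR_ge0.
- by move=> x x0; continuous1.
- by move=> x x0; rewrite divr_gt0 ?exprn_gt0.
- by move=> x x0; exact: ltW.
- by move=> x x0; is_derive1_by; rewrite /=; field.
- by move=> x x0; continuous1.
- by apply: continuous_at_right; [continuous1|rewrite expr0n/= mul0r].
- apply/cvgryPge => A; near=> x.
  have x2 : 2 <= x by near: x; apply: nbhs_pinfty_ge; rewrite num_real.
  have xA : A <= x by near: x; apply: nbhs_pinfty_ge; rewrite num_real.
  rewrite (le_trans xA)// ler_pdivlMr// expr2; nra.
have E x : 0 < x -> 2 `^ (z / 2 - 1) * ((x ^+ 2 / 2) `^ (z / 2 - 1) *
    expR (- (x ^+ 2 / 2)) * x) = x `^ (z - 1) * expR (- (x ^+ 2 / 2)).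
  move=> x0.
  have -> : 2 `^ (z / 2 - 1) * ((x ^+ 2 / 2) `^ (z / 2 - 1) *
    expR (- (x ^+ 2 / 2)) * x) = 2 `^ (z / 2 - 1) * (x ^+ 2 / 2) `^ (z / 2 - 1)
    * x * expR (- (x ^+ 2 / 2)) by ring.
  rewrite -powRM ?divr_ge0 ?sqr_ge0// mulrCA divff// mulr1.
  rewrite -powR_mulrn ?(ltW x0)// -powRrM -[X in _ * X * _](powRr1 (ltW x0)).
  rewrite -powRD ?(gt_eqF x0) ?implybT//; by congr (_ `^ _ * _); field.
split; first by have := intbleZ (2 `^ (z / 2 - 1)) i; apply: eq_intble.
by rewrite -(eq_intpos E) intposZ// e.
Unshelve. all: by end_near. Qed.

Lemma intpos_xgauss : intble (fun x : R => x * expR (- (x ^+ 2 / 2))) /\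
  intpos (fun x : R => x * expR (- (x ^+ 2 / 2))) = 1.
Proof.
have [i e] := intpos_powgauss (ltr0n R 2).
have E x : 0 < x -> x `^ (2 - 1) * expR (- (x ^+ 2 / 2)) =
    x * expR (- (x ^+ 2 / 2)).
  by move=> x0; rewrite (_ : 2 - 1 = 1) ?powRr1 ?(ltW x0)//; ring.
split; first exact: eq_intble E i.
by rewrite -(eq_intpos E) e divff// Gamma1 subrr powRr0 mulr1.
Qed.

Lemma cvgy_powexpk z k : 0 <= z -> 0 < k ->
  (fun u : R => u `^ z * expR (- (k * u))) @ +oo --> (0 : R).
Proof.
move=> z0 k0.
have h : (fun u : R => k `^ (- z) * ((k * u) `^ z * expR (- (k * u)))) @ +oo
    --> (0 : R).
  rewrite -[X in _ --> X](mulr0 (k `^ (- z))); apply: cvgM; first exact: cvg_cst.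
  apply: (@cvg_comp _ _ _ (fun u => k * u) (fun u => u `^ z * expR (- u)) _ +oo).
    apply/cvgryPge => A; near=> x.
    have h : k^-1 * A <= x by near: x; apply: nbhs_pinfty_ge; rewrite num_real.
    by rewrite -ler_pdivrMl.
  exact: cvgy_powexp.
apply: cvg_trans h; apply: near_eq_cvg; near=> x.
have x0 : 0 < x by near: x; exact: nbhs_pinfty_gt.
rewrite powRM ?(ltW x0) ?(ltW k0)// !mulrA -powRD ?(gt_eqF k0) ?implybT//.
by rewrite addNr powRr0 mul1r.
Unshelve. all: by end_near. Qed.

Lemma norm_cos_le1 x : `|cos x| <= 1.
Proof. by rewrite ler_norml cos_geN1 cos_le1. Qed.

Lemma norm_sin_le1 x : `|sin x| <= 1.
Proof. by rewrite ler_norml sin_geN1 sin_le1. Qed.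

Lemma expR_sqr_le x : expR (- (x ^+ 2 / 2)) <= expR (1 / 2) * expR (- x).
Proof.
rewrite -expRD ler_expR; have := sqr_ge0 (x - 1); rewrite sqrrB expr1n mulr1.
lra.
Qed.

Section RotatedGamma.
Variables (s phi th1 : R).
Hypotheses (s0 : 0 < s) (th10 : 0 < th1) (th1p : th1 < pi / 2).

(** The real part of exp(i (phi - s th)) u^(s-1) exp(-u e^(-i th)). Formally its integral is the
    real part of exp(i phi) Gamma(s): the phase [- s th] is chosen to make the integral independent
    of the angle. *)
Let a th u := u `^ (s - 1) *
  (expR (- (cos th * u)) * cos (sin th * u + (phi - s * th))).
Let da th u := u `^ (s - 1) * (expR (- (cos th * u)) *
  (sin th * u * cos (sin th * u + (phi - s * th)) -
   (cos th * u - s) * sin (sin th * u + (phi - s * th)))).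

Let cos1 : 0 < cos th1.
Proof. by have := @pi_gt0 R => pi0; rewrite cos_gt0_pihalf// th1p andbT; move: th10; lra. Qed.

Let cos_th th : - th1 < th < th1 -> cos th1 <= cos th.
Proof.
move=> t; have {t} t : `|th| < th1 by rewrite ltr_norml.
have pi0 := @pi_gt0 R; have t0 := normr_ge0 th.
move: th1p => tp; rewrite -[leRHS]cos_norm ltW// ltr_cos// in_itv/=; apply/andP; split; lra.
Qed.

Let expcos_le th u : - th1 < th < th1 -> 0 < u ->
  expR (- (cos th * u)) <= expR (- (cos th1 * u)).
Proof.
by move=> t u0; rewrite ler_expR lerN2 ler_pM2r// cos_th.
Qed.

Lemma intble_rotated th : - th1 < th < th1 -> intble (a th).
Proof.
move=> t; apply: intble_le (intble_powexp s0 cos1) _ => [|u u0].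
  by apply: measurable_cont_pos => u u0; rewrite /a; continuous1.
rewrite /a !normrM (ger0_norm (powR_ge0 _ _)) (ger0_norm (expR_ge0 _)).
rewrite ler_wpM2l ?powR_ge0//; apply: le_trans (expcos_le t u0).
by rewrite ler_piMr ?expR_ge0// norm_cos_le1.
Qed.

Let g u := 2 * (u `^ (s + 1 - 1) * expR (- (cos th1 * u))) +
  s * (u `^ (s - 1) * expR (- (cos th1 * u))).

Let gi : intble g.
Proof.
apply: intbleD; apply: intbleZ; apply: intble_powexp => //.
by rewrite addr_gt0.
Qed.

Let da_le th u : - th1 < th < th1 -> 0 < u -> `|da th u| <= g u.
Proof.
move=> t u0; rewrite /da /g !normrM (ger0_norm (powR_ge0 _ _)).
rewrite (ger0_norm (expR_ge0 _)) addrK.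
have us : u `^ s = u * u `^ (s - 1) by rewrite mulr_powRB1// ltW.
have -> : 2 * (u `^ s * expR (- (cos th1 * u))) +
    s * (u `^ (s - 1) * expR (- (cos th1 * u))) =
    u `^ (s - 1) * (expR (- (cos th1 * u)) * (2 * u + s)) by rewrite us; ring.
rewrite ler_wpM2l ?powR_ge0// ler_pM ?expR_ge0 ?expcos_le//.
set y := _ + (phi - _).
have := norm_cos_le1 y; have := norm_sin_le1 y.
have := norm_cos_le1 th; have := norm_sin_le1 th.
set A := sin th; set B := cos th; set C := sin y; set D := cos y => hA hB hC hD.
have h1 : `|A * u * D| <= u.
  rewrite !normrM (ger0_norm (ltW u0)) -[leRHS]mulr1 ler_pM// ?mulr_ge0// ?(ltW u0)//.
  by rewrite ler_piMl// ltW//.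
have h2 : `|(B * u - s) * C| <= u + s.
  rewrite normrM -[leRHS]mulr1 ler_pM// (le_trans (ler_normB _ _))//.
  rewrite normrM (gtr0_norm u0) (gtr0_norm s0) lerD2r ler_piMl// ltW//.
apply: (le_trans (ler_normB _ _)); lra.
Qed.

Let da_cont th (u : R) : 0 < u -> {for u, continuous (da th)}.
Proof. by move=> u0; rewrite /da; continuous1. Qed.

Let intble_da th : - th1 < th < th1 -> intble (da th).
Proof.
move=> t; apply: intble_le gi _; last by move=> u; exact: da_le.
by apply: measurable_cont_pos; exact: da_cont.
Qed.

(* The derivative of the integrand with respect to the angle is also the
   derivative in [u] of [u^s e^(-u cos th) sin (u sin th + phi - s th)]. *)
Let intpos_da th : - th1 < th < th1 -> intpos (da th) = 0.
Proof.
move=> t; rewrite -[RHS](subr0 0).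
have Fle u : 0 < u -> `|u `^ s * (expR (- (cos th * u)) *
    sin (sin th * u + (phi - s * th)))| <= u `^ s * expR (- (cos th1 * u)).
  move=> u0; rewrite !normrM (ger0_norm (powR_ge0 _ _)) (ger0_norm (expR_ge0 _)).
  rewrite ler_wpM2l ?powR_ge0//; apply: le_trans (expcos_le t u0).
  by rewrite ler_piMr ?expR_ge0// norm_sin_le1.
apply: (@ftc_pos R _ (fun u => u `^ s * (expR (- (cos th * u)) *
    sin (sin th * u + (phi - s * th))))).
- move=> u u0; is_derive1_by; rewrite /da.
  have -> : u `^ s = u * u `^ (s - 1) by rewrite mulr_powRB1// ltW.
  ring.
- exact: da_cont.
- exact: intble_da.
- apply: (@squeeze_norm0 _ _ _ _ (fun u => u `^ s)); last exact: powR_cvg0.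
  near=> u; have u0 : 0 < u by near: u; exact: nbhs_right_gt.
  apply: (le_trans (Fle _ u0)); rewrite ler_piMr ?powR_ge0// expR_le1 oppr_le0.
  by rewrite mulr_ge0 ?(ltW u0) ?(ltW cos1).
- apply: (@squeeze_norm0 _ _ _ _ (fun u => u `^ s * expR (- (cos th1 * u)))).
    near=> u; have u0 : 0 < u by near: u; exact: nbhs_pinfty_gt.
    exact: Fle.
  by apply: cvgy_powexpk => //; exact: ltW.
Unshelve. all: by end_near. Qed.

Lemma rotated_derive th : - th1 < th < th1 ->
  is_derive th 1 (fun t => intpos (a t)) 0.
Proof.
move=> t; have /andP[t1 t2] := t; rewrite -(intpos_da t).
apply: (is_derive_under t1 t2 intble_rotated _ gi).
- by move=> x u xt u0; rewrite /a; is_derive1_by; rewrite /da; ring.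
- by move=> x u xt u0; exact: da_le.
Qed.

End RotatedGamma.

(** With [phi = s * th] the phase cancels at angle [th], while at angle 0 the integrand is
    [cos (s * th)] times that of [Gamma s]; the integral is constant in between. *)
Lemma rotated_Gamma s th : 0 < s -> 0 <= th -> th < pi / 2 ->
  intble (fun u => u `^ (s - 1) * (expR (- (cos th * u)) * cos (sin th * u))) /\
  intpos (fun u => u `^ (s - 1) * (expR (- (cos th * u)) * cos (sin th * u))) =
    Gamma s * cos (s * th).
Proof.
move=> s0 t0 tp; have pi0 := @pi_gt0 R.
(* The midpoint of [th] and pi/2, so that [th] lies strictly inside the range of angles on which the
   domination by exp(-u cos t1) is uniform. *)
pose t1 := (th + pi / 2) / 2.
have t1p : t1 < pi / 2 by rewrite /t1; lra.
have t10 : 0 < t1 by rewrite /t1; lra.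
have tt1 : - t1 < th < t1 by apply/andP; rewrite /t1; split; lra.
have ai := intble_rotated (s * th) s0 t10 t1p tt1.
have E u : u `^ (s - 1) * (expR (- (cos th * u)) *
    cos (sin th * u + (s * th - s * th))) =
  u `^ (s - 1) * (expR (- (cos th * u)) * cos (sin th * u)).
  by rewrite subrr addr0.
split; first by apply: eq_intble ai => u _; exact: E.
rewrite -(eq_intpos (fun u _ => E u)).
have dA := rotated_derive (s * th) s0 t10 t1p.
set A := fun t => intpos _ in dA; rewrite -/(A th).
have A0 : A 0 = Gamma s * cos (s * th).
  rewrite /A GammaE [RHS]mulrC -intposZ; last exact: intble_powexp1.
  by apply: eq_intpos => u u0; rewrite cos0 sin0 mul1r mul0r mulr0 subr0 add0r; ring.
rewrite -A0; apply/eqP; rewrite -subr_eq0.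
have [||c _ ->] := @MVT_segment R A (fun=> 0) 0 th t0.
- move=> x; rewrite in_itv/= => /andP[x0 xt]; apply: dA.
  by move: tt1 => /andP[? ?]; apply/andP; split; lra.
- apply: continuous_in_subspaceT => x; rewrite inE/= in_itv/= => /andP[x0 xt].
  apply: is_derive1_continuous; apply: dA.
  by move: tt1 => /andP[? ?]; apply/andP; split; lra.
by rewrite mul0r.
Qed.

(** As a function of [u] the integral F satisfies F' = - u F, by differentiation under the integral
    sign and integration by parts; hence F(u) exp(u^2/2) is constant. *)
Lemma gaussian_fourier u :
  intble (fun x => expR (- (x ^+ 2 / 2)) * cos (u * x)) /\
  intpos (fun x => expR (- (x ^+ 2 / 2)) * cos (u * x)) =
    Num.sqrt (pi / 2) * expR (- (u ^+ 2 / 2)).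
Proof.
have [gi ge] := gaussian_integral; have [xi _] := intpos_xgauss.
pose f u x := expR (- (x ^+ 2 / 2)) * cos (u * x) : R.
pose df u x := - (x * expR (- (x ^+ 2 / 2)) * sin (u * x)) : R.
have fi v : intble (f v).
  apply: intble_le gi _ => [|x x0].
    by apply: measurable_cont_pos => x x0; rewrite /f; continuous1.
  by rewrite normrM (ger0_norm (expR_ge0 _)) ler_piMr ?expR_ge0// norm_cos_le1.
have dfle v x : 0 < x -> `|df v x| <= x * expR (- (x ^+ 2 / 2)).
  move=> x0; have h : 0 <= x * expR (- (x ^+ 2 / 2)).
    by rewrite mulr_ge0 ?expR_ge0// ltW.
  by rewrite normrN normrM (ger0_norm h) ler_piMr// norm_sin_le1.
have dfi v : intble (df v).
  apply: intble_le xi _; last by move=> x; exact: dfle.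
  by apply: measurable_cont_pos => x x0; rewrite /df; continuous1.
split; first exact: fi.
have dfE v : intpos (df v) = - v * intpos (f v).
  apply/eqP; rewrite mulNr -addr_eq0 -intposZ// -intposD//; last exact: intbleZ.
  apply/eqP; rewrite -[RHS](subr0 0).
  apply: (@ftc_pos R _ (fun x => expR (- (x ^+ 2 / 2)) * sin (v * x))).
  - by move=> x x0; is_derive1_by; rewrite /df /f; field.
  - by move=> x x0; rewrite /df /f; continuous1.
  - by apply: intbleD => //; exact: intbleZ.
  - by apply: continuous_at_right; [continuous1|rewrite mulr0 sin0 mulr0].
  - apply: (@squeeze_norm0 _ _ _ _ (fun x => expR (1 / 2) * expR (- x))).
      near=> x; rewrite normrM (ger0_norm (expR_ge0 _)).
      apply: (@le_trans _ _ (expR (- (x ^+ 2 / 2)))).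
        by rewrite ler_piMr ?expR_ge0// norm_sin_le1.
      exact: expR_sqr_le.
    rewrite -[X in _ --> X](mulr0 (expR (1 / 2))).
    by apply: cvgM; [exact: cvg_cst|exact: cvgr_expR].
have dF v : is_derive v (1 : R) (fun v => intpos (f v)) (intpos (df v)).
  have [v1 v2] : v - 1 < v /\ v < v + 1 by split; lra.
  apply: (is_derive_under v1 v2 _ _ xi) => //.
  - by move=> w x _ x0; rewrite /f; is_derive1_by; rewrite /df; ring.
  - by move=> w x _; exact: dfle.
have := @is_derive_0_is_cst R (fun v => intpos (f v) * expR (v ^+ 2 / 2)) u 0.
rewrite expr0n/= mul0r expR0 mulr1 => h.
have f0 : intpos (f 0) = Num.sqrt (pi / 2).
  by rewrite -ge; apply: eq_intpos => x _; rewrite /f mul0r cos0 mulr1.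
have dg v : is_derive v (1 : R) (fun v => intpos (f v) * expR (v ^+ 2 / 2)) 0.
  notypeclasses refine (is_derive_eq _ _).
    notypeclasses refine (is_derive1_mul _ _); first exact: dF.
    by is_derive1.
  by cbv beta; rewrite dfE; field.
rewrite -f0 -(h dg).
by rewrite -mulrA -expRD subrr expR0 mulr1.
Unshelve. all: by end_near. Qed.

End GaussianIntegrals.

(** * The cosine identity between Gamma and Gaussian moments *)

Section KeyIdentity.
Context {R : realType}.
Local Notation mu := (@lebesgue_measure R).
Local Notation pos := (`]0%R, +oo[%classic : set R).
Implicit Types (f g F dF : R -> R) (x p z k s u th : R).
Hint Resolve measurable_pos : core.

Lemma continuous_seq f (v : nat -> R) (l : R) : {for l, continuous f} ->
  v n @[n --> \oo] --> l -> f (v n) @[n --> \oo] --> f l.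
Proof. by move=> cf vl; exact: (cvg_comp _ _ vl cf). Qed.

(** The Gaussian times the real part of exp(-u x e^(-i th)); at th = pi/2 the second factor becomes
    cos (u x). *)
Let h th u x : R := expR (- (x ^+ 2 / 2)) *
  (expR (- (cos th * (u * x))) * cos (sin th * (u * x))).

Let h_cont th u (x : R) : 0 < x -> {for x, continuous (h th u)}.
Proof. by move=> x0; rewrite /h; continuous1. Qed.

Let expcos_le1 th u x : 0 <= cos th -> 0 < u -> 0 < x ->
  expR (- (cos th * (u * x))) <= 1.
Proof. by move=> c0 u0 x0; rewrite expR_le1 oppr_le0 !mulr_ge0// ltW. Qed.

Let h_le th u x : 0 <= cos th -> 0 < u -> 0 < x ->
  `|h th u x| <= expR (- (x ^+ 2 / 2)).
Proof.
move=> c0 u0 x0; rewrite /h !normrM !(ger0_norm (expR_ge0 _)).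
rewrite ler_piMr ?expR_ge0// mulr_ile1 ?expR_ge0 ?norm_cos_le1//.
exact: expcos_le1.
Qed.

Let intble_h th u : 0 <= cos th -> 0 < u -> intble (h th u).
Proof.
move=> c0 u0; have [gi _] := @gaussian_integral R.
apply: intble_le gi _ => [|x x0]; last exact: h_le.
by apply: measurable_cont_pos; exact: h_cont.
Qed.

(* Integration by parts against the antiderivative
   [- e^(-u x cos th) cos (u x sin th + th) / u] of the oscillating factor. *)
Lemma rotated_gauss_le th u : 0 <= cos th -> 0 < u ->
  `|intpos (h th u)| <= 2 / u.
Proof.
move=> c0 u0.
have [xi xe] := @intpos_xgauss R.
pose w x : R := x * expR (- (x ^+ 2 / 2)) *
  (expR (- (cos th * (u * x))) * cos (sin th * (u * x) + th)).
have wle x : 0 < x -> `|w x| <= x * expR (- (x ^+ 2 / 2)).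
  move=> x0; rewrite /w !normrM !(ger0_norm (expR_ge0 _)) (gtr0_norm x0).
  rewrite ler_piMr ?mulr_ge0 ?expR_ge0 ?(ltW x0)//.
  by rewrite mulr_ile1 ?expR_ge0 ?norm_cos_le1// expcos_le1.
have wi : intble w.
  apply: intble_le xi wle.
  by apply: measurable_cont_pos => x x0; rewrite /w; continuous1.
have hi := intble_h c0 u0.
have E : intpos (fun x => w x + u * h th u x) = 0 - (- cos th).
  apply: (@ftc_pos R _ (fun x => - (expR (- (x ^+ 2 / 2)) *
     (expR (- (cos th * (u * x))) * cos (sin th * (u * x) + th))))).
  - move=> x x0; is_derive1_by; rewrite /w /h.
    set y := sin th * (u * x).
    have -> : cos y = cos th * cos (y + th) + sin th * sin (y + th).
      by rewrite -cosB -[LHS]cosN; congr cos; ring.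
    by field.
  - by move=> x x0; rewrite /w /h; continuous1.
  - by apply: intbleD => //; exact: intbleZ.
  - apply: continuous_at_right; first by continuous1.
    by rewrite expr0n/= !(mul0r, mulr0, oppr0, expR0, mul1r, add0r).
  - apply: (@squeeze_norm0 _ _ _ _ _ (fun x => expR (1 / 2) * expR (- x))).
      near=> x; have x0 : 0 < x by near: x; exact: nbhs_pinfty_gt.
      apply: le_trans (expR_sqr_le _).
      rewrite normrN !normrM !(ger0_norm (expR_ge0 _)).
      rewrite ler_piMr ?expR_ge0// mulr_ile1 ?expR_ge0 ?norm_cos_le1//.
      exact: expcos_le1.
    rewrite -[X in _ --> X](mulr0 (expR (1 / 2))).
    by apply: cvgM; [exact: cvg_cst|exact: cvgr_expR].
have e' : intpos w + u * intpos (h th u) = cos th.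
  by rewrite -intposZ// -intposD//; [rewrite E; ring|exact: intbleZ].
have e : cos th - intpos w = u * intpos (h th u) by rewrite -e'; ring.
rewrite ler_pdivlMr// -[X in _ * X](gtr0_norm u0) -normrM mulrC -e.
apply: le_trans (ler_normB _ _) _; rewrite (_ : 2 = 1 + 1); last by ring.
rewrite lerD ?norm_cos_le1// -xe; exact: intpos_norm.
Unshelve. all: by end_near. Qed.

(** Differentiability in [u], under the domination 2 x exp(-x^2/2), gives continuity and hence
    measurability. *)
Let h_measurable th : 0 <= cos th -> measurable_fun pos (fun u => intpos (h th u)).
Proof.
move=> c0; apply: measurable_cont_pos => u u0.
have [xi _] := @intpos_xgauss R.
pose dh v x : R := expR (- (x ^+ 2 / 2)) *
  (expR (- (cos th * (v * x))) * - (x * (cos th * cos (sin th * (v * x)) +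
     sin th * sin (sin th * (v * x))))).
apply: (@is_derive1_continuous _ _ _ (intpos (dh u))).
apply: (@is_derive_under R (h th) dh
  (fun x => 2 * (x * expR (- (x ^+ 2 / 2)))) 0 (u + 1)) => //.
- by rewrite ltrDl.
- by move=> v /andP[v0 _]; exact: intble_h.
- by move=> v x _ _; rewrite /h; is_derive1_by; rewrite /dh; ring.
- exact: intbleZ.
move=> v x /andP[v0 _] x0; rewrite /dh !normrM normrN !normrM.
rewrite !(ger0_norm (expR_ge0 _)) (gtr0_norm x0).
have -> : 2 * (x * expR (- (x ^+ 2 / 2))) = expR (- (x ^+ 2 / 2)) * (1 * (x * 2)).
  by ring.
rewrite ler_wpM2l ?expR_ge0// ler_pM ?expR_ge0 ?mulr_ge0 ?(ltW x0) ?expcos_le1//.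
rewrite ler_wpM2l ?(ltW x0)// (le_trans (ler_normD _ _))// !normrM.
have := norm_cos_le1 th; have := norm_sin_le1 th.
have := norm_cos_le1 (sin th * (v * x)); have := norm_sin_le1 (sin th * (v * x)).
move=> A B C D; rewrite (_ : 2 = 1 + 1); last by ring.
by rewrite lerD// mulr_ile1.
Qed.

Section Limit.
Variable s : R.
Hypothesis s01 : 0 < s < 1.
Let s0 : 0 < s. Proof. by case/andP: s01. Qed.

Let M : R := intpos (fun x => x `^ (- s) * expR (- (x ^+ 2 / 2))).

Let Mi : intble (fun x => x `^ (- s) * expR (- (x ^+ 2 / 2))).
Proof.
have s1 : 0 < 1 - s by case/andP: s01 => _ ?; rewrite subr_gt0.
have [i _] := intpos_powgauss s1; apply: eq_intble i => x _.
by congr (_ `^ _ * _); ring.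
Qed.

Let rotated_fubini th : 0 <= th -> th < pi / 2 ->
  intpos (fun u => u `^ (s - 1) * intpos (h th u)) = Gamma s * cos (s * th) * M.
Proof.
move=> t0 tp; have pi0 := @pi_gt0 R.
have c0 : 0 < cos th by rewrite cos_gt0_pihalf// tp andbT; lra.
have [gi _] := @gaussian_integral R.
have [ri re] := rotated_Gamma s0 t0 tp.
pose f x u : R := u `^ (s - 1) * h th u x.
(* Homogeneity: for fixed [x] the integrand in [u] is the rotated Gamma integrand at the point x u,
   up to a factor in [x] alone. *)
have fxE x u : 0 < x -> 0 < u -> f x u = expR (- (x ^+ 2 / 2)) * x `^ (1 - s) *
   ((x * u) `^ (s - 1) * (expR (- (cos th * (x * u))) * cos (sin th * (x * u)))).
  move=> x0 u0; rewrite /f /h powRM ?(ltW x0) ?(ltW u0)// [u * x]mulrC.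
  have : x `^ (1 - s) * x `^ (s - 1) = 1.
    rewrite -powRD ?(gt_eqF x0) ?implybT// (_ : _ + _ = 0) ?powRr0//; ring.
  set P := x `^ (1 - s); set Q := x `^ (s - 1) => PQ.
  by rewrite -[LHS]mul1r -PQ; ring.
have fle x u : 0 < x -> 0 < u -> `|f x u| <=
    expR (- (x ^+ 2 / 2)) * (u `^ (s - 1) * expR (- (cos th * x * u))).
  move=> x0 u0; rewrite /f /h !normrM !(ger0_norm (expR_ge0 _)).
  rewrite (ger0_norm (powR_ge0 _ _)) mulrCA ler_wpM2l ?expR_ge0//.
  rewrite ler_wpM2l ?powR_ge0// -mulrA [x * u]mulrC ler_piMr ?expR_ge0//.
  exact: norm_cos_le1.
have fx x : 0 < x -> intble (f x).
  move=> x0; have := intbleZ (expR (- (x ^+ 2 / 2)) * x `^ (1 - s)) (intble_scale x0 ri).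
  by apply: eq_intble => u u0; rewrite fxE.
have fxi x : 0 < x -> intpos (f x) =
    Gamma s * cos (s * th) * (x `^ (- s) * expR (- (x ^+ 2 / 2))).
  move=> x0; rewrite (eq_intpos (fun u => fxE x u x0)).
  rewrite intposZ; last exact: (intble_scale x0 ri).
  rewrite (intpos_scale x0 ri) re -[x^-1]powR_inv1 ?(ltW x0)//.
  have -> : x `^ (- s) = x `^ (1 - s) * x `^ (-1).
    by rewrite -powRD ?(gt_eqF x0) ?implybT//; congr (_ `^ _); ring.
  ring.
have fy u : 0 < u -> intble (f ^~ u).
  by move=> u0; apply: intbleZ; apply: intble_h => //; exact: ltW.
have mf : measurable_fun [set: measurableTypeR R * measurableTypeR R]
    (fun w => f w.1 w.2).
  have m1 : measurable_fun [set: measurableTypeR R * measurableTypeR R]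
    (fun w => w.1 : R) by exact: measurable_fst.
  have m2 : measurable_fun [set: measurableTypeR R * measurableTypeR R]
    (fun w => w.2 : R) by exact: measurable_snd.
  have m21 := measurable_funM m2 m1.
  have mexp (k : _ -> R) : measurable_fun [set: measurableTypeR R * measurableTypeR R]
      k -> measurable_fun setT (fun w => expR (- k w)).
    by move=> mk; do 2 apply: measurableT_comp => //.
  apply: measurable_funM.
    exact: (measurableT_comp (measurable_powR (s - 1)) m2).
  apply: measurable_funM.
    apply: mexp; apply: measurable_funM => //.
    exact: (measurable_funX 2 m1).
  apply: measurable_funM; first by apply: mexp; exact: measurable_funM.
  have mcos : measurable_fun setT (@cos R).
    by apply: continuous_measurable_fun; exact: continuous_cos.
  by apply: (measurableT_comp mcos); exact: measurable_funM.
transitivity (intpos (fun u => intpos (f ^~ u))).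
  by apply: eq_intpos => u u0; rewrite /f intposZ//; apply: intble_h => //; exact: ltW.
(* The bound for the inner integral of [|f|], obtained by replacing the oscillating cosine by 1. Its
   factor (cos th)^(-s) is infinite at pi/2, which is why the angle stays below. *)
pose g x : R := cos th `^ (- s) * Gamma s * (x `^ (- s) * expR (- (x ^+ 2 / 2))).
rewrite -(@fubini_pos R f g)//.
- rewrite (eq_intpos fxi) intposZ//.
- exact: intbleZ.
- move=> x x0.
  have cx : 0 < cos th * x by rewrite mulr_gt0.
  have i := intbleZ (expR (- (x ^+ 2 / 2))) (intble_powexp s0 cx).
  apply: (@le_trans _ _ (intpos (fun u => expR (- (x ^+ 2 / 2)) *
     (u `^ (s - 1) * expR (- (cos th * x * u)))))).
    apply: intpos_le i _ => [|u u0]; last exact: fle.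
    by have := integrable_abse (fx _ x0).
  rewrite intposZ; last exact: intble_powexp.
  rewrite intpos_powexp// powRM ?(ltW x0) ?(ltW c0)// /g.
  rewrite le_eqVlt; apply/orP; left; apply/eqP; ring.
Qed.

(* The two orders of integration of [u^(s-1) e^(-x^2/2) cos (u x)]; absolute
   convergence is obtained by rotating the kernel to an angle [th < pi/2]. *)
Lemma Gamma_cos_gauss :
  Gamma s * cos (s * (pi / 2)) *
    intpos (fun x => x `^ (- s) * expR (- (x ^+ 2 / 2))) =
  Num.sqrt (pi / 2) * (2 `^ (s / 2 - 1) * Gamma (s / 2)).
Proof.
have pi0 := @pi_gt0 R.
have [gi ge] := @gaussian_integral R.
(* Angles in [0, pi/2) tending to pi/2. *)
pose t (n : nat) : R := pi / 2 - pi / 2 * n.+1%:R^-1.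
have t0 n : 0 <= t n.
  rewrite /t -[X in X - _]mulr1 -mulrBr mulr_ge0 ?subr_ge0 ?invf_le1 ?ler1n//.
  by rewrite divr_ge0// ltW.
have tp n : t n < pi / 2.
  by rewrite /t gtrBl mulr_gt0 ?invr_gt0// divr_gt0.
have tl : t n @[n --> \oo] --> (pi / 2 : R).
  rewrite -[X in _ --> X]subr0 -[X in _ - X](mulr0 (pi / 2)).
  apply: cvgB; first exact: cvg_cst.
  by apply: cvgM; [exact: cvg_cst|exact: cvg_harmonic].
have ct n : 0 <= cos (t n).
  rewrite cos_ge0_pihalf// (ltW (tp n)) andbT (le_trans _ (t0 n))//; lra.
have [_ <-] := intpos_powgauss s0.
have L1 : Gamma s * cos (s * t n) * M @[n --> \oo] -->
    Gamma s * cos (s * (pi / 2)) * M.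
  apply: cvgM; last exact: cvg_cst.
  apply: cvgM; first exact: cvg_cst.
  apply: (@continuous_seq (fun x => cos (s * x))) => //.
  by continuous1.
have L2 : intpos (fun u => u `^ (s - 1) * intpos (h (t n) u)) @[n --> \oo] -->
    intpos (fun u => u `^ (s - 1) *
      (Num.sqrt (pi / 2) * expR (- (u ^+ 2 / 2)))).
  (* The inner integral is at most sqrt(pi/2) by absolute values and at most 2/u by
     [rotated_gauss_le], so (1 + u) times it is at most [K], uniformly in the angle. The resulting
     majorant K u^(s-1) / (1 + u) is integrable as 0 < s < 1, and is split into two functions x^p /
     (1 + x)^2. *)
  pose K : R := Num.sqrt (pi / 2) + 2.
  apply: (@intpos_dct R _ _ (fun u => K * (u `^ (s - 1) / (1 + u) ^+ 2) +
      K * (u `^ s / (1 + u) ^+ 2))).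
  - move=> n; apply: measurable_funM; last exact: h_measurable.
    by apply: measurable_cont_pos => x x0; continuous1.
  - by apply: measurable_cont_pos => x x0; continuous1.
  - by apply: intbleD; apply: intble_pow1; move: s01; lra.
  - move=> n u u0; rewrite normrM (ger0_norm (powR_ge0 _ _)).
    have -> : u `^ s = u * u `^ (s - 1) by rewrite mulr_powRB1// ltW.
    have u1 : 0 < 1 + u by rewrite addr_gt0.
    have -> : K * (u `^ (s - 1) / (1 + u) ^+ 2) +
        K * (u * u `^ (s - 1) / (1 + u) ^+ 2) = u `^ (s - 1) * (K / (1 + u)).
      by field; rewrite gt_eqF.
    rewrite ler_wpM2l ?powR_ge0// ler_pdivlMr// mulrDr mulr1 lerD//.
      rewrite -ge; apply: intpos_norm => //; first exact: intble_h.
      by move=> x x0; exact: h_le.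
    by rewrite -ler_pdivlMr//; exact: rotated_gauss_le.
  - move=> u u0; apply: cvgM; first exact: cvg_cst.
    have [_ <-] := gaussian_fourier u.
    apply: (@intpos_dct R _ _ (fun x => expR (- (x ^+ 2 / 2)))) => //.
    + by move=> n; apply: measurable_cont_pos; exact: h_cont.
    + by apply: measurable_cont_pos => x x0; continuous1.
    + by move=> n x x0; exact: h_le.
    + move=> x x0.
      have : {for (pi / 2), continuous (fun th => h th u x)}.
        by rewrite /h; continuous1.
      move=> ch; have := continuous_seq ch tl.
      by rewrite /h cos_pihalf sin_pihalf mul0r oppr0 expR0 !mul1r.
have E n : Gamma s * cos (s * t n) * M =
  intpos (fun u => u `^ (s - 1) * intpos (h (t n) u)) by rewrite rotated_fubini.
rewrite (_ : (fun n => _) = (fun n => intpos (fun u => u `^ (s - 1) * intpos (h (t n) u)))) in L1; last by apply/funext.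
rewrite -/M (cvg_unique _ L1 L2)//.
have [i _] := intpos_powgauss s0; rewrite -intposZ//.
by apply: eq_intpos => u _; ring.
Qed.

End Limit.

End KeyIdentity.

(** * Modified Bessel functions *)

Section BesselK.
Context {R : realType}.
Local Notation mu := (@lebesgue_measure R).
Local Notation pos := (`]0%R, +oo[%classic : set R).
Implicit Types (f g : R -> R) (x y m u v w : R).
Hint Resolve measurable_pos : core.

Let k m x u : R := expR (- x * ((expR u + expR (- u)) / 2)) *
  ((expR (m * u) + expR (- (m * u))) / 2).

Let k_cont m x (u : R) : {for u, continuous (k m x)}.
Proof. by rewrite /k; continuous1. Qed.

Let k_ge0 m x u : 0 <= k m x u.
Proof. by rewrite !mulr_ge0 ?addr_ge0 ?expR_ge0. Qed.

Let k_gt0 m x u : 0 < k m x u.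
Proof. by rewrite !mulr_gt0 ?addr_gt0 ?expR_gt0. Qed.

Lemma besselKE m x : besselK m x = intpos (k m x).
Proof.
rewrite /intpos /Rintegral integral_itv_obnd_cbnd//.
by apply/measurable_EFinP; apply: measurable_cont_pos.
Qed.

Lemma intble_expN : intble (fun u : R => expR (- u)).
Proof.
apply: eq_intble (intble_powexp1 (ltr01 : 0 < (1 : R))) => u u0.
by rewrite subrr powRr0 mul1r.
Qed.

Lemma intpos_expN : intpos (fun u : R => expR (- u)) = 1.
Proof.
rewrite -[RHS](@Gamma1 R) GammaE; apply: eq_intpos => u u0.
by rewrite subrr powRr0 mul1r.
Qed.

Lemma expRN_le_sqr x : 0 < x -> expR (- x) <= 2 / x ^+ 2.
Proof.
move=> x0; rewrite expRN -[leRHS]invrK lef_pV2 ?posrE ?expR_gt0 ?invr_gt0 ?divr_gt0 ?exprn_gt0//.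
rewrite invf_div; have := @expR_ge1Dxn _ x 1 (ltW x0); apply: le_trans.
by rewrite -[leLHS]add0r; apply: lerD.
Qed.

(** From exp(-v) <= 2/v^2 at v = x e^u / 2 comes 8 e^(-2u) / x^2, and cosh (m u) <= e^u since
    [m <= 1]. *)
Let k_le m x u : 0 <= m <= 1 -> 0 < x -> 0 < u -> k m x u <= 8 / x ^+ 2 * expR (- u).
Proof.
move=> /andP[m0 m1] x0 u0; rewrite /k mulNr.
have eu := expR_gt0 u; have enu := expR_gt0 (- u).
have e1 : expR (m * u) <= expR u by rewrite ler_expR ler_piMl// ltW.
have e2 : expR (- (m * u)) <= expR u.
  by rewrite ler_expR; have := mulr_ge0 m0 (ltW u0); lra.
have xe : 0 < x * (expR u / 2) by rewrite !mulr_gt0.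
have h1 : expR (- (x * ((expR u + expR (- u)) / 2))) <= expR (- (x * (expR u / 2))).
  by rewrite ler_expR lerN2 ler_pM2l// ler_pM2r// lerDl expR_ge0.
apply: (@le_trans _ _ (2 / (x * (expR u / 2)) ^+ 2 * expR u)).
  apply: ler_pM; last lra.
  - exact: expR_ge0.
  - by rewrite divr_ge0// addr_ge0 ?expR_ge0.
  - exact: le_trans h1 (expRN_le_sqr xe).
rewrite expRN le_eqVlt; apply/orP; left; apply/eqP; field.
by rewrite !gt_eqF.
Qed.

Lemma besselK_intble m x : 0 <= m <= 1 -> 0 < x -> intble (k m x).
Proof.
move=> m01 x0; apply: intble_le (intbleZ (8 / x ^+ 2) intble_expN) _.
  by apply: measurable_cont_pos.
by move=> u u0; rewrite ger0_norm// k_le.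
Qed.

Lemma besselK_gt0 m x : 0 <= m <= 1 -> 0 < x -> 0 < besselK m x.
Proof.
by move=> m01 x0; rewrite besselKE; apply: intpos_gt0 => //; exact: besselK_intble.
Qed.

Lemma besselK_nincr m x y : 0 <= m <= 1 -> 0 < x -> x <= y ->
  besselK m y <= besselK m x.
Proof.
move=> m01 x0 xy; have y0 := lt_le_trans x0 xy.
rewrite !besselKE; apply: intpos_le; try exact: besselK_intble.
move=> u u0; rewrite /k ler_wpM2r ?divr_ge0 ?addr_ge0 ?expR_ge0//.
by rewrite ler_expR ler_wpM2r ?lerN2// divr_ge0 ?addr_ge0 ?expR_ge0.
Qed.

(** Since cosh u >= 1, exp(-x cosh u) <= exp(1 - x) exp(-cosh u) for [x >= 1]. *)
Lemma besselK_le_exp m x : 0 <= m <= 1 -> 1 <= x ->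
  besselK m x <= besselK m 1 * expR (1 - x).
Proof.
move=> m01 x1; have x0 : 0 < x by rewrite (lt_le_trans _ x1).
rewrite mulrC !besselKE -intposZ; last exact: besselK_intble.
apply: intpos_le => [||u u0]; first exact: besselK_intble.
  by apply: intbleZ; exact: besselK_intble.
rewrite /k [leRHS]mulrA -expRD ler_wpM2r ?divr_ge0 ?addr_ge0 ?expR_ge0// ler_expR.
have : 1 <= (expR u + expR (- u)) / 2.
  rewrite expRN; have eu := expR_gt0 u.
  rewrite ler_pdivlMr// mul1r -subr_ge0.
  have -> : expR u + (expR u)^-1 - 2 = (expR u - 1) ^+ 2 / expR u.
    by field; rewrite gt_eqF.
  by rewrite divr_ge0 ?sqr_ge0// ltW.
set C := _ / 2 => C1; nra.
Qed.

Lemma is_derive1_lnf f x (a : R) : 0 < f x -> is_derive x 1 f a ->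
  is_derive x 1 (fun t => ln (f t)) ((f x)^-1 * a).
Proof. by move=> f0 fa; exact: (is_derive1_comp (is_derive1_ln f0)). Qed.

(* The substitution [u = ln (1 + 2 w / x)], that is [v = x e^u / 2 = w + x / 2]. *)
Lemma subst_ln g x : 0 < x -> intble g -> (forall u, 0 < u -> 0 <= g u) ->
  (forall u : R, 0 < u -> {for u, continuous g}) ->
  intble (fun w => g (ln (1 + 2 / x * w)) * (w + x / 2)^-1) /\
  intpos (fun w => g (ln (1 + 2 / x * w)) * (w + x / 2)^-1) = intpos g.
Proof.
move=> x0 gi g0 cg.
have p1 w : 0 < w -> 0 < 1 + 2 / x * w by move=> w0; rewrite addr_gt0 ?mulr_gt0 ?invr_gt0.
apply: intpos_subst => //.
- by move=> w w0; rewrite ln_gt0// ltrDl mulr_gt0// divr_gt0.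
- by move=> w w0; rewrite invr_ge0 addr_ge0// ?divr_ge0// ltW.
- move=> w w0; notypeclasses refine (is_derive_eq _ _).
    notypeclasses refine (is_derive1_lnf _ _); first exact: p1.
    by is_derive1.
  by cbv beta; field; rewrite !gt_eqF//; have := p1 _ w0; nra.
- by move=> w w0; continuous1; rewrite gt_eqF// addr_gt0// divr_gt0.
- apply: continuous_at_right; last by rewrite mulr0 addr0 ln1.
  eapply is_derive1_continuous.
  notypeclasses refine (is_derive1_lnf _ _); last by is_derive1.
  by rewrite mulr0 addr0.
- apply/cvgryPge => A; near=> w.
  have wA : x / 2 * expR A <= w by near: w; apply: nbhs_pinfty_ge; rewrite num_real.
  have w0 : 0 < w by near: w; exact: nbhs_pinfty_gt.
  rewrite -ler_expR lnK ?posrE ?p1//.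
  have : expR A <= 2 / x * w.
    rewrite (le_trans _ (ler_wpM2l _ wA))// ?divr_ge0 ?(ltW x0)//.
    by rewrite mulrA (_ : 2 / x * (x / 2) = 1) ?mul1r//; field; rewrite gt_eqF.
  lra.
Unshelve. all: by end_near. Qed.

End BesselK.

(** * K_m near 0 for 0 < m <= 1 *)

Section BesselKSmall.
Context {R : realType}.
Local Notation mu := (@lebesgue_measure R).
Local Notation pos := (`]0%R, +oo[%classic : set R).
Implicit Types (f g : R -> R) (x y m u v w : R).

Lemma intpos_dct_right (f_ : R -> R -> R) f g (a : R) :
  (forall x, a < x -> measurable_fun pos (f_ x)) -> measurable_fun pos f ->
  intble g -> (forall x y, a < x -> 0 < y -> `|f_ x y| <= g y) ->
  (forall y, 0 < y -> f_ x y @[x --> a^'+] --> f y) ->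
  intpos (f_ x) @[x --> a^'+] --> intpos f.
Proof.
move=> mf_ mf gi fg ff; apply/cvg_at_rightP => t [ta tl].
apply: (intpos_dct _ mf gi) => [n|n y y0|y y0]; [exact: mf_|exact: fg|].
by move/cvg_at_rightP : (ff _ y0); apply.
Qed.

Lemma cvg_at_right_scale (f : R -> R) (k l : R) : 0 < k -> f @ 0^'+ --> l ->
  (fun x => f (k * x)) @ 0^'+ --> l.
Proof.
move=> k0 fl; apply: (@cvg_comp _ _ _ (fun x => k * x) f _ (0^'+)) => //.
apply: cvg_to_at_right.
  by apply: continuous_at_right; [continuous1|rewrite mulr0].
by near=> x; rewrite mulr_gt0//; near: x; exact: nbhs_right_gt.
Unshelve. all: by end_near. Qed.

Let k m x u : R := expR (- x * ((expR u + expR (- u)) / 2)) *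
  ((expR (m * u) + expR (- (m * u))) / 2).

(** In the variable v = x e^u / 2 one has x cosh u = v + x^2 / (4 v), e^u = 2 v / x and du = dv / v.
    The integral is written in w = v - x/2, so that its domain does not depend on [x] and dominated
    convergence is available. *)
Lemma besselK_subst m x : 0 <= m <= 1 -> 0 < x ->
  let q w := expR (- (w + x / 2 + x ^+ 2 / (4 * (w + x / 2)))) *
    ((2 * (w + x / 2) / x) `^ m + (2 * (w + x / 2) / x) `^ (- m)) / 2 *
    (w + x / 2)^-1 in
  intble q /\ besselK m x = intpos q.
Proof.
move=> m01 x0 q.
have ki := besselK_intble m01 x0.
have [||i e] := subst_ln x0 ki.
- by move=> u u0; rewrite !mulr_ge0 ?addr_ge0 ?expR_ge0.
- by move=> u u0; continuous1.
have E w : 0 < w -> k m x (ln (1 + 2 / x * w)) * (w + x / 2)^-1 = q w.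
  move=> w0; have v0 : 0 < w + x / 2 by rewrite addr_gt0// divr_gt0.
  have rE : 1 + 2 / x * w = 2 * (w + x / 2) / x by field; rewrite gt_eqF.
  have r0 : 0 < 2 * (w + x / 2) / x by rewrite divr_gt0// mulr_gt0.
  rewrite /k /q rE.
  have lE p : expR (p * ln (2 * (w + x / 2) / x)) = (2 * (w + x / 2) / x) `^ p.
    by rewrite /powR gt_eqF.
  rewrite -mulNr !lE expRN lnK ?posrE//.
  have -> : - x * ((2 * (w + x / 2) / x + (2 * (w + x / 2) / x)^-1) / 2) =
      - (w + x / 2 + x ^+ 2 / (4 * (w + x / 2))).
    by move: v0; set v := w + x / 2 => v0; field; rewrite !gt_eqF.
  by rewrite !mulrA.
by split; [exact: eq_intble E i|rewrite besselKE -e; exact: eq_intpos].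
Qed.

(** Write v = w + x/2. After multiplication by x^m, the term in (2 v)^(-m) carries x^(2m) and
    vanishes in the limit, while the one in (2 v)^m gives the Gamma integrand. *)
Lemma besselK_cvg0 m : 0 < m -> m <= 1 ->
  x `^ m * besselK m x @[x --> 0^'+] --> 2 `^ (m - 1) * Gamma m.
Proof.
move=> m0 m1; have m01 : 0 <= m <= 1 by rewrite (ltW m0).
rewrite GammaE -intposZ; last exact: intble_powexp1.
pose q x w : R := expR (- (w + x / 2 + x ^+ 2 / (4 * (w + x / 2)))) *
  ((2 * (w + x / 2)) `^ m + (x `^ m) ^+ 2 * (2 * (w + x / 2)) `^ (- m)) / 2 *
    (w + x / 2)^-1.
have qE x : 0 < x -> intble (q x) /\ x `^ m * besselK m x = intpos (q x).
  move=> x0; have [i ->] := besselK_subst m01 x0.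
  have E w : 0 < w -> x `^ m * (expR (- (w + x / 2 + x ^+ 2 / (4 * (w + x / 2)))) *
    ((2 * (w + x / 2) / x) `^ m + (2 * (w + x / 2) / x) `^ (- m)) / 2 *
    (w + x / 2)^-1) = q x w.
    move=> w0; have v0 : 0 < 2 * (w + x / 2) by rewrite mulr_gt0// addr_gt0// divr_gt0.
    have xm := powR_gt0 m x0.
    have h : x^-1 `^ m = (x `^ m)^-1.
      by rewrite -powRN -powR_inv1 ?(ltW x0)// -powRrM mulN1r.
    have h' : x^-1 `^ (- m) = x `^ m.
      by rewrite -powR_inv1 ?(ltW x0)// -powRrM mulrNN mul1r.
    have e p : (2 * (w + x / 2) / x) `^ p = (2 * (w + x / 2)) `^ p * x^-1 `^ p.
      by rewrite powRM ?invr_ge0 ?(ltW x0) ?(ltW v0).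
    rewrite /q !e h h'.
    move: v0; set v := w + x / 2; rewrite pmulr_rgt0// => v0.
    by field; rewrite !gt_eqF.
  rewrite -intposZ//; split; last exact: eq_intpos.
  exact: eq_intble E (intbleZ _ i).
have q' : {near 0^'+, (fun x => intpos (q x)) =1 (fun x => x `^ m * besselK m x)}.
  near=> x; have x0 : 0 < x by near: x; exact: nbhs_right_gt.
  by have [_ ->] := qE _ x0.
apply: cvg_trans (near_eq_cvg q') _.
apply: (@intpos_dct_right q _ (fun w => 2 `^ m * (w `^ (m - 1) * expR (- w)))).
- by move=> x x0; have [/intble_measurable] := qE _ x0.
- by apply: measurable_cont_pos => x x0; continuous1.
- by apply: intbleZ; exact: intble_powexp1.
- move=> x w x0 w0.
  have v0 : 0 < w + x / 2 by rewrite addr_gt0// divr_gt0.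
  have v2 : 0 < 2 * (w + x / 2) by rewrite mulr_gt0.
  rewrite /q ger0_norm; last first.
    by rewrite !mulr_ge0 ?expR_ge0 ?addr_ge0 ?mulr_ge0 ?powR_ge0 ?sqr_ge0 ?invr_ge0// ltW.
  set v := w + x / 2 in v0 v2 *.
  (* As x <= 2 v, the vanishing term never exceeds the main one; the factor 1/2 of cosh absorbs the
     resulting 2. *)
  have h1 : (x `^ m) ^+ 2 * (2 * v) `^ (- m) <= (2 * v) `^ m.
    rewrite powRN ler_pdivrMr ?powR_gt0// -expr2 ler_sqr ?nnegrE ?powR_ge0//.
    by rewrite ge0_ler_powR ?nnegrE ?(ltW m0) ?(ltW x0) ?(ltW v2)// /v; lra.
  have h2 : expR (- (v + x ^+ 2 / (4 * v))) <= expR (- w).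
    rewrite ler_expR lerN2; have : 0 <= x ^+ 2 / (4 * v).
      by rewrite divr_ge0 ?sqr_ge0// mulr_ge0// ltW.
    by rewrite /v; lra.
  have h3 : (2 * v) `^ m / v <= 2 `^ m * w `^ (m - 1).
    rewrite powRM ?(ltW v0)// -mulrA ler_wpM2l ?powR_ge0//.
    have -> : v `^ m / v = v `^ (m - 1) by rewrite powRB ?(gt_eqF v0) ?implybT// powRr1 ?(ltW v0).
    rewrite -!(opprB 1 m) !powRN lef_pV2 ?posrE ?powR_gt0//.
    by rewrite ge0_ler_powR ?nnegrE ?subr_ge0 ?(ltW w0) ?(ltW v0)// /v; lra.
  apply: (@le_trans _ _ (expR (- w) * ((2 * v) `^ m / v))).
    set P := (2 * v) `^ m in h1 *; set Q := (x `^ m) ^+ 2 * _ in h1 *.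
    have Q0 : 0 <= Q by rewrite mulr_ge0 ?powR_ge0 ?sqr_ge0.
    have P0 : 0 <= P by rewrite powR_ge0.
    have -> : expR (- (v + x ^+ 2 / (4 * v))) * (P + Q) / 2 / v =
      expR (- (v + x ^+ 2 / (4 * v))) * ((P + Q) / 2 / v) by rewrite !mulrA.
    apply: ler_pM => //.
      by rewrite !mulr_ge0 ?addr_ge0 ?invr_ge0// ltW.
    by rewrite ler_wpM2r ?invr_ge0 ?(ltW v0)//; lra.
  by rewrite mulrC [leRHS]mulrA ler_wpM2r ?expR_ge0.
- move=> w w0.
  (* The power x^m is kept apart, since the differentiation rule for powers does not cover the base
     0; [A p] is differentiable at 0 because [w > 0]. *)
  pose A p x : R := expR (- (w + x / 2 + x ^+ 2 / (4 * (w + x / 2)))) *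
     (2 * (w + x / 2)) `^ p / 2 * (w + x / 2)^-1.
  have cA p : {for 0, continuous (A p)}.
    rewrite /A; continuous1; rewrite ?mul0r ?addr0 ?mulr_gt0//.
    by rewrite gt_eqF// mulr_gt0.
    by rewrite gt_eqF.
  have -> : (fun x => q x w) = (fun x => A m x + (x `^ m) ^+ 2 * A (- m) x).
    by apply/funext => x; rewrite /q /A; ring.
  have -> : 2 `^ (m - 1) * (w `^ (m - 1) * expR (- w)) = A m 0 + 0 ^+ 2 * A (- m) 0.
    rewrite /A !expr2 !mul0r !addr0 powRM ?(ltW w0)// powRB ?pnatr_eq0 ?implybT// powRr1//.
    have -> : w `^ (m - 1) = w `^ m / w by rewrite powRB ?(gt_eqF w0) ?implybT// powRr1 ?(ltW w0).
    by rewrite -!mulrA; ring.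
  apply: cvgD; first by apply: cvg_at_right_filter; exact: cA.
  apply: cvgM; last by apply: cvg_at_right_filter; exact: cA.
  by apply: (cvgM (powR_cvg0 m0) (powR_cvg0 m0)).
Unshelve. all: by end_near. Qed.

End BesselKSmall.

(** * K_0 near 0 and the exponential integral *)

Section BesselKZero.
Context {R : realType}.
Local Notation mu := (@lebesgue_measure R).
Local Notation pos := (`]0%R, +oo[%classic : set R).
Implicit Types (f g : R -> R) (x y m u v w s t r : R).

(** The integrand of the exponential integral E_1(t), the integral of e^(-v)/v over (t, oo), moved
    to the half-line by v = w + t. Since only w + t occurs, [df] is the derivative in either
    variable, and the derivative of [D] = E_1 can be integrated explicitly. *)
Let f (t w : R) : R := expR (- (w + t)) / (w + t).
Let df (t w : R) : R := - (expR (- (w + t)) / (w + t) + expR (- (w + t)) / (w + t) ^+ 2).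

Let f_derivew t w : 0 < t -> 0 <= w -> is_derive w (1 : R) (f t) (df t w).
Proof.
move=> t0 w0; have wt : 0 < w + t by rewrite ltr_wpDl.
rewrite /f; is_derive1_by; first by rewrite gt_eqF.
by rewrite /df; field; rewrite gt_eqF.
Qed.

Let f_derivet t w : 0 < t -> 0 < w -> is_derive t (1 : R) (f ^~ w) (df t w).
Proof.
move=> t0 w0; have wt : 0 < w + t by rewrite addr_gt0.
rewrite /f; is_derive1_by; first by rewrite gt_eqF.
by rewrite /df; field; rewrite gt_eqF.
Qed.

Let df_le t s w : 0 < s -> s <= t -> 0 < w ->
  `|df t w| <= (s^-1 + (s ^+ 2)^-1) * expR (- w).
Proof.
move=> s0 st w0; have t0 := lt_le_trans s0 st.
have wt : 0 < w + t by rewrite addr_gt0.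
have wst : s <= w + t by lra.
rewrite /df normrN ger0_norm; last first.
  by rewrite addr_ge0// divr_ge0 ?expR_ge0 ?sqr_ge0// ltW.
rewrite -mulrDr mulrC; apply: ler_pM.
- by rewrite addr_ge0 ?invr_ge0 ?sqr_ge0// ltW.
- exact: expR_ge0.
- apply: lerD; first by rewrite lef_pV2 ?posrE.
  by rewrite lef_pV2 ?posrE ?exprn_gt0// ler_sqr ?nnegrE// ltW.
- by rewrite ler_expR lerN2 lerDl ltW.
Qed.

Let df_intble t : 0 < t -> intble (df t).
Proof.
move=> t0; apply: intble_le (intbleZ (t^-1 + (t ^+ 2)^-1) intble_expN) _; last first.
  by move=> w w0; exact: (df_le t0 (lexx t)).
apply: measurable_cont_pos => w w0.
have wt : w + t != 0 by rewrite gt_eqF// addr_gt0.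
by rewrite /df; continuous1; rewrite ?expf_eq0/= ?(negbTE wt).
Qed.

Let f_intble t : 0 < t -> intble (f t).
Proof.
move=> t0; apply: intble_le (intbleZ t^-1 intble_expN) _; last first.
  move=> w w0; have wt : 0 < w + t by rewrite addr_gt0.
  rewrite /f ger0_norm ?divr_ge0 ?expR_ge0 ?(ltW wt)// mulrC ler_pM ?expR_ge0 ?invr_ge0 ?(ltW wt)//.
    by rewrite lef_pV2 ?posrE//; lra.
  by rewrite ler_expR lerN2 lerDl ltW.
apply: measurable_cont_pos => w w0.
by apply: is_derive1_continuous (f_derivew t0 (ltW w0)).
Qed.

Let df_int t : 0 < t -> intpos (df t) = - (expR (- t) / t).
Proof.
move=> t0; rewrite -[RHS]add0r; apply: (@ftc_pos R (df t) (f t) (expR (- t) / t) 0).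
- by move=> w w0; apply: f_derivew => //; exact: ltW.
- move=> w w0; have wt : w + t != 0 by rewrite gt_eqF// addr_gt0.
  by rewrite /df; continuous1; rewrite ?expf_eq0/= ?(negbTE wt).
- exact: df_intble.
- apply: continuous_at_right; last by rewrite /f add0r.
  exact: is_derive1_continuous (f_derivew t0 (lexx _)).
- apply: (@squeeze_norm0 _ _ _ _ _ (fun w => t^-1 * expR (- w))).
    near=> w; have w0 : 0 < w by near: w; exact: nbhs_pinfty_gt.
    have wt : 0 < w + t by rewrite addr_gt0.
    rewrite /f ger0_norm ?divr_ge0 ?expR_ge0 ?(ltW wt)// mulrC.
    apply: ler_pM; rewrite ?expR_ge0 ?invr_ge0 ?(ltW wt)//.
      by rewrite lef_pV2 ?posrE//; lra.
    by rewrite ler_expR lerN2 lerDl ltW.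
  rewrite -[X in _ --> X](mulr0 t^-1).
  by apply: cvgM; [exact: cvg_cst|exact: cvgr_expR].
Unshelve. all: by end_near. Qed.

Let D t := intpos (f t).

Let D_derive t : 0 < t -> is_derive t (1 : R) D (- (expR (- t) / t)).
Proof.
move=> t0; rewrite -df_int//.
have t1 : t / 2 < t by lra.
have t2 : t < t + 1 by lra.
have h0 : 0 < t / 2 by lra.
apply: (is_derive_under t1 t2 _ _ (intbleZ ((t / 2)^-1 + ((t / 2) ^+ 2)^-1) intble_expN)).
- by move=> s /andP[s1 _]; apply: f_intble; exact: lt_trans s1.
- by move=> s w /andP[s1 _] w0; apply: f_derivet => //; exact: lt_trans s1.
- by move=> s w /andP[s1 _] w0; apply: df_le => //; exact: ltW.
Qed.

(** Adding the logarithm removes the singularity of E_1: the derivative (1 - e^(-r)) / r of the sum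
    lies between 0 and 1. *)
Let D_diff s t : 0 < s -> s <= t -> 0 <= D t + ln t - (D s + ln s) <= t - s.
Proof.
move=> s0 st.
have H r : 0 < r -> is_derive r (1 : R) (fun r => D r + ln r) ((1 - expR (- r)) / r).
  move=> r0; notypeclasses refine (is_derive_eq _ _).
    notypeclasses refine (is_derive1_add _ _); first exact: D_derive.
    exact: is_derive1_ln.
  by cbv beta; ring.
have [||r rI ->] := @MVT_segment R (fun r => D r + ln r) (fun r => (1 - expR (- r)) / r) s t st.
- move=> r; rewrite in_itv/= => /andP[sr _]; apply: H; exact: lt_trans sr.
- apply: continuous_in_subspaceT => r; rewrite inE/= in_itv/= => /andP[sr _].
  by apply: is_derive1_continuous; apply: H; exact: lt_le_trans sr.
move: rI; rewrite in_itv/= => /andP[sr _]; have r0 := lt_le_trans s0 sr.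
have h1 : 0 <= (1 - expR (- r)) / r.
  by rewrite divr_ge0 ?(ltW r0)// subr_ge0 expR_le1 oppr_le0 ltW.
have h2 : (1 - expR (- r)) / r <= 1.
  rewrite ler_pdivrMr// mul1r; have := @expR_ge1Dx R (- r); lra.
by rewrite mulr_ge0 ?subr_ge0//= ler_piMl// subr_ge0.
Qed.

Let E_D x : 0 < x -> 
  intble (fun u => expR (- (x * expR u / 2))) /\
  intpos (fun u => expR (- (x * expR u / 2))) = D (x / 2).
Proof.
move=> x0.
have gi : intble (fun u => expR (- (x * expR u / 2))).
  apply: intble_le (intbleZ (8 / x ^+ 2) intble_expN) _.
    by apply: measurable_cont_pos => u u0; continuous1.
  move=> u u0; rewrite ger0_norm ?expR_ge0//.
  have xe : 0 < x * expR u / 2 by rewrite divr_gt0// mulr_gt0// expR_gt0.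
  apply: (le_trans (expRN_le_sqr xe)).
  apply: (@le_trans _ _ (8 / x ^+ 2 * expR (- u) ^+ 2)).
    rewrite expRN; have eu := expR_gt0 u.
    rewrite le_eqVlt; apply/orP; left; apply/eqP; field.
    by rewrite !gt_eqF.
  rewrite ler_wpM2l// ?divr_ge0 ?sqr_ge0// expr2 ler_piMl ?expR_ge0//.
  by rewrite expR_le1 oppr_le0 ltW.
split => //.
have [||_ <-] := subst_ln x0 gi.
- by move=> u _; rewrite expR_ge0.
- by move=> u _; continuous1.
apply: eq_intpos => w w0.
have rE : 1 + 2 / x * w = 2 * (w + x / 2) / x by field; rewrite gt_eqF.
have r0 : 0 < 2 * (w + x / 2) / x by rewrite divr_gt0// mulr_gt0// addr_gt0// divr_gt0.
by rewrite rE lnK ?posrE// /f; congr (expR (- _) / _); field; rewrite gt_eqF.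
Qed.

(** The integrand of K_0 is exp(-x e^u / 2) times exp(-x e^(-u) / 2); the second factor lies between
    1 - x e^(-u) / 2 and 1, and the first integrates to E_1(x/2). *)
Let E_K x : 0 < x -> D (x / 2) - x / 2 <= besselK 0 x <= D (x / 2).
Proof.
move=> x0; have [Ei <-] := E_D x0.
have m01 : 0 <= (0 : R) <= 1 by rewrite lexx ler01.
have Ki := besselK_intble m01 x0.
have kE u : expR (- x * ((expR u + expR (- u)) / 2)) *
    ((expR (0 * u) + expR (- (0 * u))) / 2) =
    expR (- (x * expR u / 2)) * expR (- (x * expR (- u) / 2)).
  by rewrite mul0r oppr0 expR0 -expRD -[RHS]mulr1; congr (expR _ * _); field.
rewrite besselKE; apply/andP; split.
  have -> : x / 2 = intpos (fun u => x / 2 * expR (- u)).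
    by rewrite (intposZ _ intble_expN) intpos_expN mulr1.
  have hi := intbleZ (x / 2) intble_expN.
  rewrite -intposB//; apply: intpos_le => [||u u0]; first exact: intbleB.
    exact: Ki.
  rewrite kE lerBlDr -lerBlDl -[X in X - _]mulr1 -mulrBr.
  apply: (@le_trans _ _ (1 - expR (- (x * expR (- u) / 2)))).
    rewrite ler_piMl// ?subr_ge0 ?expR_le1 ?oppr_le0 ?divr_ge0 ?mulr_ge0 ?expR_ge0// ltW//.
  have := @expR_ge1Dx R (- (x * expR (- u) / 2)); lra.
apply: intpos_le => // u u0; rewrite kE ler_piMr ?expR_ge0// expR_le1 oppr_le0.
by rewrite divr_ge0// mulr_ge0 ?expR_ge0// ltW.
Qed.

(** The errors are at most x/2 and y/2 for replacing K_0 by E_1, and (y - x)/2 for replacing the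
    difference of E_1 by a logarithm. Taking a difference cancels the additive constant in the
    expansion of K_0. *)
Lemma besselK0_log x y : 0 < x -> x <= y ->
  `|besselK 0 x - besselK 0 y - ln (y / x)| <= y.
Proof.
move=> x0 xy; have y0 := lt_le_trans x0 xy.
have x2 : 0 < x / 2 by rewrite divr_gt0.
have xy2 : x / 2 <= y / 2 by rewrite ler_pM2r.
have /andP[a1 a2] := E_K x0; have /andP[b1 b2] := E_K y0.
have /andP[c1 c2] := D_diff x2 xy2.
move: a1 a2 b1 b2 c1 c2; rewrite !ln_div ?posrE// ler_norml.
move: (besselK 0 x) (besselK 0 y) (D (x / 2)) (D (y / 2)) (ln x) (ln y) (ln 2).
by move=> Kx Ky Dx Dy lx ly l2 a1 a2 b1 b2 c1 c2; apply/andP; split; lra.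
Qed.

End BesselKZero.

(** * Bounds for I_m from its power series *)

Section BesselI.
Context {R : realType}.
Variable m : R.
Hypothesis m0 : 0 <= m.
Implicit Types (x y : R).

Let t x (k : nat) : R :=
  (x / 2) `^ (m + 2 * k%:R) / (k`!%:R * Gamma (m + k%:R + 1)).

Let Gk_gt0 (k : nat) : 0 < Gamma (m + k%:R + 1).
Proof. by apply: Gamma_gt0; rewrite ltr_wpDl// addr_ge0. Qed.

Let Gm1 : 0 < Gamma (m + 1).
Proof. by apply: Gamma_gt0; rewrite ltr_wpDl. Qed.

Let t_ge0 x k : 0 <= t x k.
Proof.
by apply: divr_ge0; [exact: powR_ge0|exact: mulr_ge0 (ler0n _ _) (ltW (Gk_gt0 k))].
Qed.

Let Gk_ge (k : nat) : k`!%:R * Gamma (m + 1) <= Gamma (m + k%:R + 1).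
Proof.
elim: k => [|k IH]; first by rewrite fact0 mul1r addr0.
have -> : m + k.+1%:R + 1 = (m + k%:R + 1) + 1 by rewrite -natr1; ring.
have k0 : 0 < m + k%:R + 1 by rewrite ltr_wpDl// addr_ge0.
rewrite (GammaS k0).
rewrite factS natrM -mulrA; apply: ler_pM IH; first exact: ler0n.
  exact: mulr_ge0 (ler0n _ _) (ltW Gm1).
by rewrite -natr1 lerD2r lerDr.
Qed.

Let P x := (x / 2) `^ m / Gamma (m + 1).

Let t_le x k : 0 < x -> t x k <= P x * (exp_coeff (x / 2) k) ^+ 2.
Proof.
move=> x0; have x2 : 0 < x / 2 by rewrite divr_gt0.
have kf : 0 < k`!%:R :> R by rewrite ltr0n fact_gt0.
rewrite /t /P /exp_coeff powRD ?(gt_eqF x2) ?implybT//.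
have -> : (x / 2) `^ (2 * k%:R) = ((x / 2) ^+ k) ^+ 2.
  by rewrite -natrM powR_mulrn ?(ltW x2)// mulnC exprM.
have -> : (x / 2) `^ m / Gamma (m + 1) * ((x / 2) ^+ k / k`!%:R) ^+ 2 =
  (x / 2) `^ m * ((x / 2) ^+ k) ^+ 2 / (k`!%:R * (k`!%:R * Gamma (m + 1))).
  by field; rewrite !gt_eqF.
apply: ler_wpM2l; first by apply: mulr_ge0; [exact: powR_ge0|exact: sqr_ge0].
have := Gk_ge k; have := Gk_gt0 k; have := Gm1; move: (Gamma _) (Gamma _) => g g' g0 g'0 gg.
by rewrite lef_pV2 ?posrE ?mulr_gt0// ler_wpM2l// ltW.
Qed.

(** Each term is at most [P x] times the square of an exponential coefficient at x/2; a sum of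
    squares of nonnegative numbers is at most the square of the sum, here at most (e^(x/2))^2. *)
Let series_le x n : 0 < x -> series (t x) n <= P x * expR x.
Proof.
move=> x0; have x2 : 0 < x / 2 by rewrite divr_gt0.
have P0 : 0 <= P x by rewrite divr_ge0 ?powR_ge0// ltW.
have c0 k : 0 <= exp_coeff (x / 2) k by apply: exp_coeff_ge0; exact: ltW.
apply: (@le_trans _ _ (P x * (series (exp_coeff (x / 2)) n) ^+ 2)).
  elim: n => [|n IH]; first by rewrite /series/= !big_geq// expr2 !mulr0.
  rewrite !seriesSr.
  have := t_le n x0; have := IH.
  have S0 : 0 <= series (exp_coeff (x / 2)) n by rewrite sumr_ge0.
  have := mulr_ge0 P0 (mulr_ge0 S0 (c0 n)).
  set a := series (t x) n; set b := series _ n; set c := exp_coeff _ n.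
  move=> h1 h2 h3.
  have -> : P x * (b + c) ^+ 2 = P x * b ^+ 2 + P x * c ^+ 2 + 2 * (P x * (b * c)) by ring.
  lra.
rewrite ler_wpM2l// {2}[x](_ : x = x / 2 + x / 2); last by field.
rewrite expRD expr2.
have S0 : 0 <= series (exp_coeff (x / 2)) n by rewrite sumr_ge0.
have Se : series (exp_coeff (x / 2)) n <= expR (x / 2).
  apply: nondecreasing_cvgn_le; last exact: is_cvg_series_exp_coeff.
  apply/nondecreasing_seqP => k; rewrite seriesSr lerDl; exact: c0.
by apply: ler_pM.
Qed.

Let series_nd x : nondecreasing_seq (series (t x)).
Proof.
by apply/nondecreasing_seqP => k; rewrite seriesSr lerDl t_ge0.
Qed.

Let series_cvg x : 0 < x -> cvgn (series (t x)).
Proof.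
move=> x0; apply: nondecreasing_is_cvgn => //.
by exists (P x * expR x) => _ [n _ <-]; exact: series_le.
Qed.

Let partial_le x n : 0 < x -> series (t x) n <= besselI m x.
Proof. by move=> x0; apply: nondecreasing_cvgn_le => //; exact: series_cvg. Qed.

Lemma besselI_le x : 0 < x ->
  besselI m x <= (x / 2) `^ m / Gamma (m + 1) * expR x.
Proof.
move=> x0; apply: limr_le; first exact: series_cvg.
by near=> n; exact: series_le.
Unshelve. all: by end_near. Qed.

Lemma besselI_ge x : 0 < x -> (x / 2) `^ m / Gamma (m + 1) <= besselI m x.
Proof.
move=> x0; apply: le_trans (partial_le 1 x0).
by rewrite seriesEord/= big_ord1/= /t fact0 mulr0 !addr0 mul1r.
Qed.

Lemma besselI_gt0 x : 0 < x -> 0 < besselI m x.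
Proof.
move=> x0; apply: lt_le_trans (besselI_ge x0).
by rewrite divr_gt0// powR_gt0// divr_gt0.
Qed.

(** The term k = 1 of the series. Its extra factor x^2 over the leading term is what produces the
    decay x^(-4) in [hitting_L_large]. *)
Lemma besselI_ge2 x : 0 < x ->
  (x / 2) `^ (m + 2) / Gamma (m + 1 + 1) <= besselI m x.
Proof.
move=> x0; apply: le_trans (partial_le 2 x0).
rewrite seriesSr; apply: (@le_trans _ _ (t x 1)).
  by rewrite /t (_ : 1`! = 1%N)// mul1r mulr1.
by rewrite lerDr sumr_ge0.
Qed.

Lemma besselI_ndecr x y : 0 < x -> x <= y -> besselI m x <= besselI m y.
Proof.
move=> x0 xy; have y0 := lt_le_trans x0 xy.
apply: lim_series_le; [exact: series_cvg|exact: series_cvg|move=> k].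
apply: ler_wpM2r.
  by rewrite invr_ge0; exact: mulr_ge0 (ler0n _ _) (ltW (Gk_gt0 k)).
by rewrite ge0_ler_powR ?nnegrE ?addr_ge0 ?divr_ge0 ?mulr_ge0 ?(ltW x0) ?(ltW y0)// ler_pM2r.
Qed.

End BesselI.

(** * The kernel [hitting_L] *)

Section HittingL.
Context {R : realType}.
Local Notation pos := (`]0%R, +oo[%classic : set R).
Variables m c : R.
Hypotheses (m0 : 0 <= m) (m2 : m < 1 / 2) (c1 : 1 < c).
Implicit Types (x y : R).

Let m01 : 0 <= m <= 1. Proof. by rewrite m0/=; move: m2; lra. Qed.
Let c0 : 0 < c. Proof. by move: c1; lra. Qed.

Local Notation I := (besselI m).
Local Notation K := (besselK m).
Let num x := I (c * x) * K x - I x * K (c * x).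
Let den x := K x ^+ 2 + pi ^+ 2 * I x ^+ 2 + 2 * pi * sin (pi * m) * K x * I x.

Lemma cos_pim : 0 < cos (pi * m) <= 1.
Proof.
rewrite cos_le1 andbT cos_gt0_pihalf//; have := @pi_gt0 R => p.
have h : 0 <= pi * m by rewrite mulr_ge0// ltW.
have : pi * m < pi * (1 / 2) by rewrite ltr_pM2l.
by move=> ?; apply/andP; split; lra.
Qed.

Let sin_pim : 0 <= sin (pi * m).
Proof.
have p := @pi_gt0 R; apply: sin_ge0_pi.
rewrite mulr_ge0 ?(ltW p)//= ler_piMr ?(ltW p)//; move: m2; lra.
Qed.

Let I0 x : 0 < x -> 0 < I x. Proof. exact: besselI_gt0. Qed.
Let K0 x : 0 < x -> 0 < K x. Proof. exact: besselK_gt0. Qed.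

Let cx0 x : 0 < x -> 0 < c * x. Proof. by move=> x0; rewrite mulr_gt0. Qed.
Let xcx x : 0 < x -> x <= c * x.
Proof. by move=> x0; rewrite ler_peMl// ltW. Qed.

Let num_ge0 x : 0 < x -> 0 <= num x.
Proof.
move=> x0; rewrite /num subr_ge0; apply: ler_pM.
- by rewrite ltW// I0.
- by rewrite ltW// K0// cx0.
- exact: besselI_ndecr (xcx x0).
- exact: besselK_nincr (xcx x0).
Qed.

(** All three terms of [den] are nonnegative, as sin (pi m) >= 0 for 0 <= m < 1/2, so each bounds it
    from below: K^2 is used near 0 and pi^2 I^2 at infinity. *)
Let den_K x : 0 < x -> K x ^+ 2 <= den x.
Proof.
move=> x0; rewrite /den -addrA lerDl addr_ge0// !mulr_ge0// ?pi_ge0 ?sqr_ge0 ?ltW ?I0 ?K0//.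
Qed.

Let den_I x : 0 < x -> pi ^+ 2 * I x ^+ 2 <= den x.
Proof.
move=> x0; rewrite /den addrAC lerDr addr_ge0 ?sqr_ge0// !mulr_ge0// ?pi_ge0 ?ltW ?I0 ?K0//.
Qed.

Let den_gt0 x : 0 < x -> 0 < den x.
Proof. by move=> x0; apply: lt_le_trans (den_K x0); rewrite exprn_gt0// K0. Qed.

Lemma hitting_L_den_gt0 x : 0 < x ->
  0 < K x ^+ 2 + pi ^+ 2 * I x ^+ 2 + 2 * pi * sin (pi * m) * K x * I x.
Proof. exact: den_gt0. Qed.

Lemma hitting_L_ge0 x : 0 < x -> 0 <= hitting_L m c x.
Proof.
move=> x0; have /andP[cp _] := cos_pim.
by rewrite /hitting_L divr_ge0 ?mulr_ge0 ?(ltW cp) ?num_ge0// ltW// den_gt0.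
Qed.

Lemma hitting_L_le x d : 0 < x -> 0 < d -> d <= den x ->
  hitting_L m c x <= num x / d.
Proof.
move=> x0 d0 dd; have /andP[cp cp1] := cos_pim.
rewrite /hitting_L -/(num x) -/(den x); apply: ler_pM.
- by rewrite mulr_ge0 ?num_ge0// ltW.
- by rewrite invr_ge0 ltW// den_gt0.
- by rewrite ler_piMl// num_ge0.
- by rewrite lef_pV2 ?posrE ?den_gt0.
Qed.

Lemma hitting_L_leK x : 0 < x ->
  hitting_L m c x <= (I (c * x) * K x - I x * K (c * x)) / K x ^+ 2.
Proof.
by move=> x0; apply: hitting_L_le; rewrite ?exprn_gt0 ?K0// den_K.
Qed.

Lemma hitting_num_le x : 0 < x -> num x <= I (c * x) * K x.
Proof.
by move=> x0; rewrite /num lerBlDr lerDl mulr_ge0// ltW ?I0 ?K0 ?cx0.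
Qed.

(** The exponentials of I(c x) and K(x) already combine to exp((c - 1) x). The denominator, bounded
    below by pi^2 I(x)^2, has only to supply powers of x, and the term k = 1 of the series does
    so. *)
Lemma hitting_L_large : exists2 C, 0 <= C & forall x, 1 <= x ->
  hitting_L m c x <= C * (expR ((c - 1) * x) / x ^+ 4).
Proof.
have m1 : 0 < m + 1 by rewrite ltr_wpDl.
have G1 : 0 < Gamma (m + 1) by exact: Gamma_gt0.
have G2 : 0 < Gamma (m + 1 + 1) by rewrite Gamma_gt0// addr_gt0.
have K1 : 0 < K 1 by exact: K0.
have p0 := @pi_gt0 R.
have h0 : 0 < (1 / 2 : R) `^ m by rewrite powR_gt0.
have cm : 0 < c `^ m by rewrite powR_gt0.
have lK x : 1 <= x -> K x <= K 1 * expR (1 - x) by exact: besselK_le_exp.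
have lI x : 0 < x -> I (c * x) <= c `^ m * (x / 2) `^ m / Gamma (m + 1) * expR (c * x).
  move=> x0; apply: (le_trans (besselI_le m0 (cx0 x0))).
  rewrite (_ : (c * x / 2) `^ m = c `^ m * (x / 2) `^ m)//.
  by rewrite -powRM ?(ltW c0) ?divr_ge0 ?(ltW x0)// mulrA.
have lI2 x : 0 < x -> (x / 2) `^ m * (x / 2) ^+ 2 / Gamma (m + 1 + 1) <= I x.
  move=> x0; apply: le_trans (besselI_ge2 m0 x0).
  have x2 : 0 < x / 2 by rewrite divr_gt0.
  by rewrite ler_pM2r ?invr_gt0// powRD ?(gt_eqF x2) ?implybT// (powR_mulrn 2 (ltW x2)).
have lL x : 0 < x -> hitting_L m c x <= I (c * x) * K x / (pi ^+ 2 * I x ^+ 2).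
  move=> x0; have pI : 0 < pi ^+ 2 * I x ^+ 2 by rewrite mulr_gt0 ?exprn_gt0// I0.
  apply: (le_trans (hitting_L_le x0 pI (den_I x0))).
  by rewrite ler_pM2r ?invr_gt0//; exact: hitting_num_le.
have I0' := I0; have K0' := K0; have cx0' := cx0.
move: lL K1 lK lI lI2 I0' K0' G1 G2.
move: (hitting_L m c) (besselI m) (besselK m) (Gamma (m + 1)) (Gamma (m + 1 + 1)).
move=> L I K g g' lL K1 lK lI lI2 I0' K0' G1 G2.
(* Here 16 comes from (x/2)^4, g' from the lower bound on I(x), and (1/2)^m bounds the leftover
   power (x/2)^m from below for x >= 1. *)
exists (c `^ m / g * K 1 * expR 1 * g' ^+ 2 * 16 / (pi ^+ 2 * (1 / 2) `^ m)).
  by rewrite ltW// divr_gt0 ?mulr_gt0 ?exprn_gt0 ?invr_gt0 ?expR_gt0.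
move=> x x1; have x0 : 0 < x by lra.
have pI : 0 < pi ^+ 2 * I x ^+ 2 by rewrite mulr_gt0 ?exprn_gt0// I0'.
apply: (le_trans (lL x x0)); rewrite ler_pdivrMr//.
pose P := (x / 2) `^ m.
have P0 : 0 < P by rewrite powR_gt0// divr_gt0.
have PE : (1 / 2) `^ m <= P.
  by rewrite ge0_ler_powR ?nnegrE ?divr_ge0 ?(ltW x0)// ler_pM2r.
have hI : I (c * x) <= c `^ m * P / g * expR (c * x) by exact: lI.
have hK : K x <= K 1 * expR (1 - x) by exact: lK.
have hI2 : P * (x / 2) ^+ 2 / g' <= I x by exact: lI2.
apply: (@le_trans _ _ (c `^ m * P / g * expR (c * x) * (K 1 * expR (1 - x)))).
  by apply: ler_pM => //; apply: ltW; [exact/I0'/cx0'|exact: K0'].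
apply: (@le_trans _ _ (c `^ m / g * K 1 * expR 1 *
    g' ^+ 2 * 16 / (pi ^+ 2 * P) * (expR ((c - 1) * x) / x ^+ 4) *
    (pi ^+ 2 * (P * (x / 2) ^+ 2 / g') ^+ 2))).
  rewrite le_eqVlt; apply/orP; left; apply/eqP.
  rewrite mulrBl mul1r !expRB; move: p0; generalize (@pi R) => q q0; field.
  by rewrite !gt_eqF ?expR_gt0//.
apply: ler_pM.
- by rewrite ltW// mulr_gt0 ?divr_gt0 ?mulr_gt0 ?exprn_gt0 ?invr_gt0 ?expR_gt0.
- by rewrite mulr_ge0 ?sqr_ge0.
- rewrite ler_pM2r ?divr_gt0 ?exprn_gt0 ?expR_gt0//.
  rewrite ler_pM2l ?mulr_gt0 ?exprn_gt0 ?invr_gt0 ?expR_gt0//.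
  by rewrite lef_pV2 ?posrE ?mulr_gt0 ?exprn_gt0// ler_pM2l ?exprn_gt0.
- have Ix := ltW (I0' _ x0); rewrite ler_pM2l ?exprn_gt0// ler_sqr ?nnegrE//.
  by rewrite !mulr_ge0 ?invr_ge0 ?(ltW x0) ?(ltW P0) ?(ltW G2)//.
Qed.

Lemma hitting_L_measurable : measurable_fun pos (hitting_L m c).
Proof.
have mI : measurable_fun pos I.
  by apply: measurable_mono_pos => x y x0; exact: besselI_ndecr.
have mK : measurable_fun pos K.
  rewrite (_ : K = (fun x => - - K x)); last by apply/funext => x; rewrite opprK.
  apply: measurableT_comp => //; apply: measurable_mono_pos => x y x0 xy.
  by rewrite lerN2; exact: besselK_nincr.
have mIc := measurable_scale c0 mI.
have mKc := measurable_scale c0 mK.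
have den0 := den_gt0.
have -> : hitting_L m c = fun x => cos (pi * m) * num x / den x by [].
move: mIc mKc den0; rewrite /num /den; move: (besselI m) (besselK m) mI mK.
move=> I' K' mI mK mIc mKc den0.
have mden : measurable_fun pos (fun x => K' x ^+ 2 + pi ^+ 2 * I' x ^+ 2 +
    2 * pi * sin (pi * m) * K' x * I' x).
  apply: measurable_funD; last by do 2 (apply: measurable_funM => //).
  apply: measurable_funD; first exact: measurable_funX.
  by apply: measurable_funM => //; exact: measurable_funX.
(* The denominator is positive on the half-line, so its inverse is the power with exponent -1, a
   measurable function of it. *)
apply: (eq_measurable_fun (fun x => cos (pi * m) *
    (I' (c * x) * K' x - I' x * K' (c * x)) *
    (K' x ^+ 2 + pi ^+ 2 * I' x ^+ 2 + 2 * pi * sin (pi * m) * K' x * I' x) `^ (-1))).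
  by move=> x; rewrite inE in_posE => x0; rewrite powR_inv1 ?(ltW (den0 _ x0)).
apply: measurable_funM.
  apply: measurable_funM => //; apply: measurable_funB; exact: measurable_funM.
exact: (measurableT_comp (measurable_powR (-1)) mden).
Qed.

End HittingL.

(** * The kernel for order 0 < m < 1/2 *)

Section HittingLPos.
Context {R : realType}.
Local Notation pos := (`]0%R, +oo[%classic : set R).
Variables m c : R.
Hypotheses (m0 : 0 < m) (m2 : m < 1 / 2) (c1 : 1 < c).
Implicit Types (x y : R).

Let m01 : 0 <= m <= 1. Proof. by rewrite ltW//=; move: m2; lra. Qed.
Let m0' : 0 <= m := ltW m0.
Let c0 : 0 < c. Proof. by move: c1; lra. Qed.

Local Notation I := (besselI m).
Local Notation K := (besselK m).
Local Notation L := (hitting_L m c).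

Let G1 : 0 < Gamma (m + 1).
Proof. by rewrite Gamma_gt0// ltr_wpDl. Qed.

(** Near 0 the positive limit of x^m K(x) gives a bound; on the rest of (0, 1] both factors are
    bounded below by monotonicity. *)
Let K_lower : exists2 k, 0 < k & forall x, 0 < x <= 1 -> k <= x `^ m * K x.
Proof.
have m1 : m <= 1 by case/andP: m01.
have lim := besselK_cvg0 m0 m1.
set l := _ * _ in lim.
have l0 : 0 < l by rewrite mulr_gt0 ?powR_gt0 ?Gamma_gt0.
have l2 : l / 2 < l by lra.
have [d /= d0 dP] : \forall x \near 0^'+, l / 2 < x `^ m * K x.
  by move/cvgr_gt : lim; apply.
have K1 : 0 < K 1 by exact: besselK_gt0.
exists (Num.min (l / 2) (d `^ m * K 1)).
  by rewrite lt_min divr_gt0//= mulr_gt0// powR_gt0.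
move=> x /andP[x0 x1]; rewrite ge_min.
have [xd|dx] := ltP x d.
  by rewrite ltW//; apply: dP => //=; rewrite sub0r normrN gtr0_norm.
apply/orP; right; have KK : K 1 <= K x by exact: besselK_nincr.
move: (K 1) (K x) K1 KK => k1 kx k1_gt0 KK.
apply: ler_pM; rewrite ?powR_ge0 ?(ltW k1_gt0)//.
by rewrite ge0_ler_powR ?nnegrE ?(ltW x0) ?(ltW d0).
Qed.

(** Near 0 the kernel is at most I(c x) / K(x), of order x^(2m). The factor 1 / (1 + x) is retained
    to absorb the factor 1 + (c - 1) x of the Gaussian tail bound. *)
Lemma hitting_L_bound_pos : exists2 C, 0 <= C & forall x, 0 < x ->
  L x <= C * (x `^ (2 * m) * expR ((c - 1) * x) / (1 + x)).
Proof.
have [C C0 CE] := hitting_L_large m0' m2 c1.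
have [k k0 kE] := K_lower.
pose C' := (c / 2) `^ m / Gamma (m + 1) * expR c / k.
have C'0 : 0 <= C' by rewrite !mulr_ge0 ?invr_ge0 ?powR_ge0 ?expR_ge0// ltW.
(* [C'] serves for x < 1 and [C] for x >= 1; the doubling pays for 1 / (1 + x), as 1 + x <= 2 in the
   first range and 1 + x <= 2 x^4 in the second. *)
exists (2 * C + 2 * C'); first by apply: addr_ge0; exact: mulr_ge0.
move=> x x0; have x10 : 0 < 1 + x by rewrite addr_gt0.
rewrite mulrDl; have [x1|x1] := ltP x 1.
  apply: (@le_trans _ _ (2 * C' * (x `^ (2 * m) * expR ((c - 1) * x) / (1 + x)))); last first.
    by rewrite lerDr !mulr_ge0 ?powR_ge0 ?expR_ge0 ?invr_ge0// ltW.
  have K0 : 0 < K x by exact: besselK_gt0.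
  have xm : 0 < x `^ m by rewrite powR_gt0.
  apply: (le_trans (hitting_L_leK m0' m2 c1 x0)).
  apply: (@le_trans _ _ (I (c * x) / K x)).
    rewrite expr2 invfM mulrA ler_pM2r ?invr_gt0// ler_pdivrMr//.
    exact: (hitting_num_le m0' m2 c1 x0).
  apply: (@le_trans _ _ (C' * (x `^ (2 * m)))).
    have -> : x `^ (2 * m) = x `^ m * x `^ m.
      by rewrite -powRD ?(gt_eqF x0) ?implybT//; congr (_ `^ _); ring.
    rewrite ler_pdivrMr// /C'.
    apply: (@le_trans _ _ ((c / 2) `^ m / Gamma (m + 1) * expR c * x `^ m)).
      apply: (le_trans (besselI_le m0' (mulr_gt0 c0 x0))).
      rewrite (_ : c * x / 2 = c / 2 * x); last by ring.
      rewrite powRM ?divr_ge0 ?(ltW c0) ?(ltW x0)//.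
      rewrite (_ : _ * expR c * x `^ m = (c / 2) `^ m * x `^ m / Gamma (m + 1) * expR c); last by ring.
      rewrite ler_wpM2l ?mulr_ge0 ?powR_ge0 ?invr_ge0 ?(ltW G1)//.
      by rewrite ler_expR ler_piMr ?(ltW c0)// ltW.
    rewrite (_ : _ / k * _ * K x = (c / 2) `^ m / Gamma (m + 1) * expR c * x `^ m * ((x `^ m * K x) / k)); last by ring.
    rewrite ler_peMr//; last by rewrite ler_pdivlMr// mul1r kE// x0 ltW.
    by rewrite !mulr_ge0 ?invr_ge0 ?powR_ge0 ?expR_ge0// ltW.
  rewrite (_ : 2 * C' * _ = C' * (x `^ (2 * m) * (2 * expR ((c - 1) * x) / (1 + x)))); last by ring.
  rewrite ler_wpM2l// ler_peMr ?powR_ge0// ler_pdivlMr// mul1r.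
  have : 1 <= expR ((c - 1) * x).
    by rewrite -[leLHS]expR0 ler_expR mulr_ge0 ?subr_ge0 ?ltW.
  lra.
apply: (@le_trans _ _ (2 * C * (x `^ (2 * m) * expR ((c - 1) * x) / (1 + x)))); last first.
  by rewrite lerDl !mulr_ge0 ?powR_ge0 ?expR_ge0 ?invr_ge0// ltW.
apply: (le_trans (CE _ x1)).
rewrite (_ : 2 * C * _ = C * (expR ((c - 1) * x) * (2 * x `^ (2 * m) / (1 + x)))); last by ring.
rewrite ler_wpM2l// ler_wpM2l ?expR_ge0// ler_pdivlMr// mulrC ler_pdivrMr ?exprn_gt0//.
have h1 : 1 <= x `^ (2 * m).
  by rewrite -[leLHS](powRr0 x) ler_powR// mulr_ge0.
have h2 : x <= x ^+ 4 by rewrite ler_eXnr.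
have h3 : 0 <= x ^+ 4 by rewrite exprn_ge0// ltW.
have : 2 * x ^+ 4 <= 2 * x `^ (2 * m) * x ^+ 4.
  by rewrite -mulrA ler_pM2l// ler_peMl.
lra.
Qed.

(** With I ~ i x^m and K ~ k x^(-m) at 0, the numerator tends to cos (pi m) (c^m - c^(-m)) i k and
    the denominator is equivalent to k^2 x^(-2m); this is the constant with i/k made explicit. *)
Definition hitting_L_const : R :=
  cos (pi * m) * (c `^ m - c `^ (- m)) * 2 `^ (- m) /
    (Gamma (m + 1) * (2 `^ (m - 1) * Gamma m)).

Lemma besselI_cvg0 : (fun x => I x / x `^ m) @ 0^'+ --> 2 `^ (- m) / Gamma (m + 1).
Proof.
set l := 2 `^ (- m) / Gamma (m + 1).
apply: (@squeeze_cvgr _ _ _ _ (fun=> l) (fun x => l * expR x)).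
- near=> x; have x0 : 0 < x by near: x; exact: nbhs_right_gt.
  have xm : 0 < x `^ m by rewrite powR_gt0.
  have e : (x / 2) `^ m / Gamma (m + 1) = l * x `^ m.
    rewrite powRM ?invr_ge0 ?(ltW x0)// -[2^-1]powR_inv1// -powRrM mulN1r /l.
    by ring.
  rewrite ler_pdivlMr// ler_pdivrMr// -e besselI_ge//=.
  by rewrite mulrAC -e besselI_le.
- exact: cvg_cst.
- apply: continuous_at_right; first by continuous1.
  by rewrite expR0 mulr1.
Unshelve. all: by end_near. Qed.

Lemma hitting_L_cvg_pos :
  (fun x => L x / x `^ (2 * m)) @ 0^'+ --> hitting_L_const.
Proof.
have m1 : m <= 1 by case/andP: m01.
have K1 := besselK_cvg0 m0 m1; have I1 := besselI_cvg0.
have Kc := cvg_at_right_scale c0 K1; have Ic := cvg_at_right_scale c0 I1.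
set k := 2 `^ (m - 1) * Gamma m in K1 Kc.
set i := 2 `^ (- m) / Gamma (m + 1) in I1 Ic.
have k0 : 0 < k by rewrite mulr_gt0 ?powR_gt0 ?Gamma_gt0.
have pow0 := powR_cvg0 m0.
(* The powers of x cancel in the numerator; in the denominator times x^(2m) the two terms containing
   I vanish in the limit, because x^m I(x) is of order x^(2m). *)
have lim : (fun x => cos (pi * m) *
   (c `^ m * (I (c * x) / (c * x) `^ m) * (x `^ m * K x) -
    I x / x `^ m * (c `^ (- m) * ((c * x) `^ m * K (c * x)))) *
   ((x `^ m * K x) ^+ 2 + pi ^+ 2 * ((x `^ m * x `^ m) * (I x / x `^ m)) ^+ 2 +
    2 * pi * sin (pi * m) * (x `^ m * K x) * ((x `^ m * x `^ m) * (I x / x `^ m)))^-1)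
  @ 0^'+ --> cos (pi * m) * (c `^ m * i * k - i * (c `^ (- m) * k)) *
   (k ^+ 2 + pi ^+ 2 * ((0 * 0) * i) ^+ 2 + 2 * pi * sin (pi * m) * k * ((0 * 0) * i))^-1.
  have J1 : (x `^ m * x `^ m) * (I x / x `^ m) @[x --> 0^'+] --> (0 * 0) * i.
    by apply: cvgM; [exact: (cvgM pow0 pow0)|exact: I1].
  apply: cvgM.
    apply: cvgM; first exact: cvg_cst.
    apply: cvgB.
      apply: cvgM; last exact: K1.
      by apply: cvgM; [exact: cvg_cst|exact: Ic].
    apply: cvgM; first exact: I1.
    by apply: cvgM; [exact: cvg_cst|exact: Kc].
  apply: cvgV.
    by rewrite !mul0r expr0n/= !mulr0 !addr0 gt_eqF// exprn_gt0.
  apply: cvgD; last first.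
    apply: cvgM; last exact: J1.
    by apply: cvgM; [exact: cvg_cst|exact: K1].
  apply: cvgD; first by rewrite expr2; exact: (cvgM K1 K1).
  by apply: cvgM; [exact: cvg_cst|rewrite expr2; exact: (cvgM J1 J1)].
have -> : hitting_L_const = cos (pi * m) * (c `^ m * i * k - i * (c `^ (- m) * k)) *
   (k ^+ 2 + pi ^+ 2 * ((0 * 0) * i) ^+ 2 + 2 * pi * sin (pi * m) * k * ((0 * 0) * i))^-1.
  rewrite !mul0r expr0n/= !mulr0 !addr0 /hitting_L_const -/k /i.
  clear lim K1 Kc; move: k (Gamma (m + 1)) k0 G1 => k g k0 g0.
  by field; rewrite !gt_eqF.
apply: cvg_trans lim; apply: near_eq_cvg; near=> x.
have x0 : 0 < x by near: x; exact: nbhs_right_gt.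
have xm : 0 < x `^ m by rewrite powR_gt0.
have cm : 0 < c `^ m by rewrite powR_gt0.
have -> : x `^ (2 * m) = x `^ m * x `^ m.
  by rewrite -powRD ?(gt_eqF x0) ?implybT//; congr (_ `^ _); ring.
rewrite powRM ?(ltW c0) ?(ltW x0)// powRN /hitting_L.
have d0 : 0 < K x ^+ 2 + pi ^+ 2 * I x ^+ 2 + 2 * pi * sin (pi * m) * K x * I x.
  exact: hitting_L_den_gt0.
have -> : (x `^ m * K x) ^+ 2 + pi ^+ 2 * ((x `^ m * x `^ m) * (I x / x `^ m)) ^+ 2 +
    2 * pi * sin (pi * m) * (x `^ m * K x) * ((x `^ m * x `^ m) * (I x / x `^ m)) =
  (x `^ m * x `^ m) * (K x ^+ 2 + pi ^+ 2 * I x ^+ 2 + 2 * pi * sin (pi * m) * K x * I x).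
  by generalize (@pi R) => q; field; rewrite gt_eqF.
move: d0; set D := K x ^+ 2 + _ + _ => d0.
clearbody D; move: (I x) (I (c * x)) (K x) (K (c * x)) => i1 i2 k1 k2.
by generalize (@pi R) => q; field; rewrite !gt_eqF.
Unshelve. all: by end_near. Qed.

End HittingLPos.

(* The small-argument behaviour for order [0] only uses the following properties
   of [I = besselI 0] and [K = besselK 0]. *)
Section OrderZero.
Context {R : realType}.
Variables (c : R) (I K : R -> R).
Implicit Types (x y h : R).
Hypotheses (c1 : 1 < c) (I_ge1 : forall x, 0 < x -> 1 <= I x)
  (I_le : forall x, 0 < x -> I x <= expR x)
  (I_nd : forall x y, 0 < x -> x <= y -> I x <= I y)
  (K_gt0 : forall x, 0 < x -> 0 < K x)
  (K_ni : forall x y, 0 < x -> x <= y -> K y <= K x)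
  (K_log : forall x y, 0 < x -> x <= y -> `|K x - K y - ln (y / x)| <= y).

Let c0 : 0 < c. Proof. by move: c1; lra. Qed.
Let lnc : 0 < ln c. Proof. exact: ln_gt0. Qed.
Let num x := I (c * x) * K x - I x * K (c * x).
Let K1 : 0 < K 1. Proof. exact: K_gt0. Qed.

Let K_near x : 0 < x <= 1 -> `|K x - K 1 + ln x| <= 1.
Proof.
move=> /andP[x0 x1]; have := K_log x0 x1.
by rewrite ln_div ?posrE// ln1 sub0r opprK.
Qed.

Let sqrt_ge x : 0 < x <= 1 -> x <= x `^ (1 / 2).
Proof.
by move=> x01; rewrite ger1_powR//; lra.
Qed.

(** The logarithmic growth of K is beaten by x. With s = sqrt x, the inequality ln (1/s) < 1/s gives
    - ln x <= 2/s, hence x (- ln x) <= 2 s. *)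
Let xK_le x : 0 < x <= 1 -> x * K x <= (K 1 + 3) * x `^ (1 / 2).
Proof.
move=> /andP[x0 x1]; have x01 : 0 < x <= 1 by rewrite x0.
have hK := K_near x01; have hx := sqrt_ge x01.
pose s := x `^ (1 / 2).
have s0 : 0 < s by rewrite powR_gt0.
have ss : x = s * s.
  by rewrite -powRD ?(gt_eqF x0) ?implybT// -splitr powRr1// ltW.
have hl : - ln x <= 2 / s.
  have : ln s^-1 < s^-1 by apply: ln_sublinear; rewrite invr_gt0.
  rewrite lnV ?posrE// => h.
  have -> : ln x = ln s + ln s by rewrite ss lnM ?posrE.
  by rewrite (_ : 2 / s = s^-1 + s^-1); [lra|ring].
have hK2 : K x <= K 1 + 1 + 2 / s.
  by move: hK; rewrite ler_norml => /andP[_]; lra.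
apply: (@le_trans _ _ (x * (K 1 + 1) + x * (2 / s))).
  by rewrite -mulrDr ler_pM2l.
rewrite -/s in hx *.
have -> : x * (2 / s) = 2 * s by rewrite ss; field; rewrite gt_eqF.
have : x * (K 1 + 1) <= s * (K 1 + 1) by rewrite ler_wpM2r// addr_ge0// ltW.
lra.
Qed.

Let expm1_le (y z : R) : 0 <= y -> y <= z -> expR y - 1 <= y * expR z.
Proof.
move=> y0 yz; apply: (@le_trans _ _ (y * expR y)).
  have := @expR_ge1Dx R (- y); rewrite expRN => h.
  have e0 := expR_gt0 y.
  have : (1 - y) * expR y <= 1 by rewrite -ler_pdivlMr// mul1r.
  lra.
by rewrite ler_wpM2l// ler_expR.
Qed.

(** As I tends to 1, the numerator is close to K(x) - K(c x), where the singularities cancel and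
    leave ln c. The differences of I are O(x), so even against K(x) they contribute O(sqrt x). *)
Let num_near : exists2 B, 0 <= B & forall x, 0 < x <= 1 ->
  `|num x - ln c| <= B * x `^ (1 / 2).
Proof.
(* One summand for each of the bounds [t1], [t2] and [t3]. *)
exists (c * expR c * (K 1 + 3) + expR 1 * (ln c + c) + c).
  by rewrite !addr_ge0 ?mulr_ge0 ?addr_ge0 ?expR_ge0 ?(ltW c0) ?(ltW lnc) ?(ltW K1).
move=> x x01; have /andP[x0 x1] := x01.
have cx0 : 0 < c * x by rewrite mulr_gt0.
have xcx : x <= c * x by rewrite ler_peMl ?(ltW x0)// ltW.
have hs := sqrt_ge x01; have hxK := xK_le x01.
set s := x `^ (1 / 2) in hs hxK *.
have K0 : 0 < K x by exact: K_gt0.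
have hd := K_log x0 xcx.
rewrite mulfK ?gt_eqF// in hd.
set d := K x - K (c * x) in hd.
rewrite /num; have dE : I (c * x) * K x - I x * K (c * x) - ln c =
   (I (c * x) - I x) * K x + (I x - 1) * d + (d - ln c) by rewrite /d; ring.
have dle : `|d| <= ln c + c.
  have -> : d = (d - ln c) + ln c by ring.
  apply: (le_trans (ler_normD _ _)); rewrite (gtr0_norm lnc) addrC lerD2l.
  by apply: (le_trans hd); rewrite ler_piMr// ltW.
have t1 : `|(I (c * x) - I x) * K x| <= c * expR c * ((K 1 + 3) * s).
  rewrite normrM (gtr0_norm K0) ger0_norm ?subr_ge0 ?I_nd//.
  apply: (@le_trans _ _ (c * x * expR c * K x)).
    rewrite ler_pM2r//; apply: (@le_trans _ _ (expR (c * x) - 1)).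
      by rewrite lerB ?I_le ?I_ge1.
    by apply: expm1_le; [exact: ltW|rewrite ler_piMr// ltW].
  rewrite (_ : c * x * expR c * K x = c * expR c * (x * K x)); last by ring.
  by rewrite ler_wpM2l// mulr_ge0 ?expR_ge0 ?(ltW c0).
have t2 : `|(I x - 1) * d| <= expR 1 * s * (ln c + c).
  rewrite normrM ger0_norm ?subr_ge0 ?I_ge1//; apply: ler_pM => //.
    by rewrite subr_ge0 I_ge1.
  apply: (@le_trans _ _ (x * expR 1)).
    by apply: le_trans (expm1_le (ltW x0) x1); rewrite lerB ?I_le.
  by rewrite mulrC ler_wpM2l ?expR_ge0.
have t3 : c * x <= c * s by rewrite ler_pM2l.
rewrite dE; apply: (le_trans (ler_normD _ _)).
have := ler_normD ((I (c * x) - I x) * K x) ((I x - 1) * d).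
lra.
Qed.

Let K_lower : exists2 k, 0 < k & forall x, 0 < x <= 1 ->
  k * (1 + ln x ^+ 2) <= K x ^+ 2.
Proof.
(* The goal is K(x) >= k (1 - ln x). If - ln x <= 2 the right side is at most 3 k <= K(1); otherwise
   K(x) >= - ln x - 1 >= (1 - ln x)/3. The claim follows by squaring, since - ln x >= 0. *)
pose k := Num.min (1 / 3) (K 1 / 3).
have k0 : 0 < k by rewrite lt_min !divr_gt0.
have k1 : k <= 1 / 3 by rewrite ge_min lexx.
have k2 : k <= K 1 / 3 by rewrite ge_min lexx orbT.
exists (k ^+ 2); first by rewrite exprn_gt0.
move=> x x01; have /andP[x0 x1] := x01.
have Kx : K 1 <= K x by exact: K_ni.
have l0 : 0 <= - ln x by rewrite oppr_ge0 ln_le0.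
have := K_near x01; rewrite ler_norml => /andP[hK _].
have h : k * (1 - ln x) <= K x.
  have [l2|l2] := leP (- ln x) 2.
    apply: (@le_trans _ _ (K 1 / 3 * 3)); last lra.
    by apply: ler_pM => //; [exact: ltW|lra|lra].
  apply: (@le_trans _ _ (1 / 3 * (1 - ln x))); last by move: K1; lra.
  by rewrite ler_wpM2r//; lra.
apply: (@le_trans _ _ ((k * (1 - ln x)) ^+ 2)).
  rewrite exprMn ler_pM2l ?exprn_gt0// sqrrB expr1n mul1r mulr2n.
  lra.
rewrite ler_sqr ?nnegrE// ?mulr_ge0 ?(ltW k0)//; first lra.
by rewrite ltW// (lt_le_trans K1).
Qed.

Lemma order_zero_small : exists2 C, 0 <= C & forall x, 0 < x <= 1 ->
  (I (c * x) * K x - I x * K (c * x)) / K x ^+ 2 <= C * (1 + ln x ^+ 2)^-1.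
Proof.
have [B B0 BE] := num_near.
have [k k0 kE] := K_lower.
exists ((ln c + B) / k); first by rewrite divr_ge0 ?addr_ge0// ltW.
move=> x x01; have /andP[x0 x1] := x01.
have l1 : 0 < 1 + ln x ^+ 2 by rewrite ltr_pwDl// sqr_ge0.
have Kx0 := K_gt0 x0.
have -> : (ln c + B) / k * (1 + ln x ^+ 2)^-1 = (ln c + B) / (k * (1 + ln x ^+ 2)).
  by rewrite invfM mulrA.
apply: (@le_trans _ _ ((ln c + B) / K x ^+ 2)).
  rewrite ler_pM2r ?invr_gt0 ?exprn_gt0// [leRHS]addrC -lerBlDr.
  apply: (le_trans (ler_norm _)); apply: (le_trans (BE _ x01)).
  have h1 : x `^ (1 / 2) <= 1 `^ (1 / 2).
    by rewrite ge0_ler_powR ?nnegrE// ltW.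
  by rewrite powR1 in h1; rewrite ler_piMr.
rewrite ler_wpM2l ?addr_ge0 ?(ltW lnc)// lef_pV2 ?posrE ?mulr_gt0 ?exprn_gt0//.
exact: kE.
Qed.

(** The denominator is divided by ln^2 h: for fixed [y], K(h y) / ln h tends to -1 and I(h y) / ln h
    to 0. *)
Lemma order_zero_cvg y : 0 < y ->
  (fun h => ln h ^+ 2 * ((I (c * (h * y)) * K (h * y) - I (h * y) * K (c * (h * y))) /
     (K (h * y) ^+ 2 + pi ^+ 2 * I (h * y) ^+ 2))) @ 0^'+ --> ln c.
Proof.
move=> y0.
have [B B0 BE] := num_near.
have lnV0 : (fun h : R => (ln h)^-1) @ 0^'+ --> (0 : R).
  apply/ltr0_cvgV0; last exact: lnNy.
  by near=> h; apply: ln_lt0; apply/andP; split; near: h; [exact: nbhs_right_gt|exact: nbhs_right_lt].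
have smallE : \forall h \near (0 : R)^'+, 0 < h * y <= 1.
  near=> h; have h0 : 0 < h by near: h; exact: nbhs_right_gt.
  rewrite mulr_gt0//= -ler_pdivlMr// div1r.
  by near: h; apply: nbhs_right_le; rewrite invr_gt0.
have numl : (fun h => num (h * y)) @ 0^'+ --> ln c.
  have : (fun h => num (h * y) - ln c) @ 0^'+ --> (0 : R).
    apply: (@squeeze_norm0 _ _ _ _ _ (fun h => B * (h * y) `^ (1 / 2))).
      by apply: filterS smallE => h hy; exact: BE.
    rewrite -[X in _ --> X](mulr0 B); apply: cvgM; first exact: cvg_cst.
    have := cvg_at_right_scale y0 (powR_cvg0 (_ : 0 < 1 / 2 :> R)).
    rewrite (_ : (fun h => (y * h) `^ (1 / 2)) = (fun h => (h * y) `^ (1 / 2))).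
      by apply; lra.
    by apply/funext => h; rewrite mulrC.
  by move=> h; apply/subr_cvg0.
(* For fixed [y] the sum K(h y) + ln h stays bounded, by [M], so ln h is the whole growth of K(h
   y). *)
have Kl : (fun h => K (h * y) * (ln h)^-1) @ 0^'+ --> (-1 : R).
  pose M := 1 + K 1 + `|ln y|.
  have : (fun h => (K (h * y) + ln h) * (ln h)^-1) @ 0^'+ --> (0 : R).
    apply: (@squeeze_norm0 _ _ _ _ _ (fun h => M * `|(ln h)^-1|)).
      near=> h; rewrite normrM ler_wpM2r//.
      have hy : 0 < h * y <= 1 by near: h.
      have h0 : 0 < h by near: h; exact: nbhs_right_gt.
      have := K_near hy; rewrite lnM ?posrE// => hK.
      rewrite (_ : K (h * y) + ln h = (K (h * y) - K 1 + (ln h + ln y)) + K 1 - ln y); last by ring.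
      apply: (le_trans (ler_normB _ _)); rewrite lerD2r.
      by apply: (le_trans (ler_normD _ _)); rewrite (gtr0_norm K1) lerD2r.
    rewrite -[X in _ --> X](mulr0 M); apply: cvgM; first exact: cvg_cst.
    by rewrite -[X in _ --> X](normr0 R); apply: cvg_norm.
  move=> h; have : (fun h => (K (h * y) + ln h) * (ln h)^-1 - 1) @ 0^'+ --> (0 - 1 : R).
    by apply: cvgB; [exact: h|exact: cvg_cst].
  rewrite sub0r; apply: cvg_trans; apply: near_eq_cvg; near=> z.
  have l0 : ln z < 0.
    by apply: ln_lt0; apply/andP; split; near: z; [exact: nbhs_right_gt|exact: nbhs_right_lt].
  by field; rewrite lt_eqF.
have Il : (fun h => I (h * y) * (ln h)^-1) @ 0^'+ --> (0 : R).
  apply: (@squeeze_norm0 _ _ _ _ _ (fun h => expR 1 * `|(ln h)^-1|)).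
    near=> h; rewrite normrM ler_wpM2r//.
    have /andP[hy0 hy1] : 0 < h * y <= 1 by near: h.
    have I0 : 0 < I (h * y) by exact: lt_le_trans (I_ge1 hy0).
    by rewrite (gtr0_norm I0) (le_trans (I_le hy0))// ler_expR.
  rewrite -[X in _ --> X](mulr0 (expR 1)); apply: cvgM; first exact: cvg_cst.
  by rewrite -[X in _ --> X](normr0 R); apply: cvg_norm.
have lim : (fun h => num (h * y) * ((K (h * y) * (ln h)^-1) ^+ 2 +
    pi ^+ 2 * (I (h * y) * (ln h)^-1) ^+ 2)^-1) @ 0^'+ -->
    ln c * ((-1) ^+ 2 + pi ^+ 2 * 0 ^+ 2)^-1.
  apply: cvgM; first exact: numl.
  apply: cvgV.
    by rewrite expr0n/= mulr0 addr0 sqrrN expr1n oner_eq0.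
  apply: cvgD; first by rewrite expr2; exact: (cvgM Kl Kl).
  by apply: cvgM; [exact: cvg_cst|rewrite expr2; exact: (cvgM Il Il)].
rewrite expr0n/= mulr0 addr0 sqrrN expr1n invr1 mulr1 in lim.
apply: cvg_trans lim; apply: near_eq_cvg; near=> h.
have l0 : ln h < 0.
  by apply: ln_lt0; apply/andP; split; near: h; [exact: nbhs_right_gt|exact: nbhs_right_lt].
have /andP[hy0 hy1] : 0 < h * y <= 1 by near: h.
have d0 : 0 < K (h * y) ^+ 2 + pi ^+ 2 * I (h * y) ^+ 2.
  by rewrite ltr_wpDr ?exprn_gt0 ?K_gt0// mulr_ge0 ?sqr_ge0.
rewrite -/(num (h * y)).
rewrite !exprMn.
have -> : K (h * y) ^+ 2 * (ln h)^-1 ^+ 2 + pi ^+ 2 * (I (h * y) ^+ 2 * (ln h)^-1 ^+ 2) =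
  (K (h * y) ^+ 2 + pi ^+ 2 * I (h * y) ^+ 2) / ln h ^+ 2.
  by generalize (@pi R) => q; field; rewrite lt_eqF.
move: d0; set D := K _ ^+ 2 + _ => d0.
by field; rewrite gt_eqF//= lt_eqF.
Unshelve. all: by end_near. Qed.

End OrderZero.

(** * The kernel for order zero *)

Section HittingLZero.
Context {R : realType}.
Variable c : R.
Hypothesis c1 : 1 < c.
Implicit Types (x y h : R).

Let m2 : (0 : R) < 1 / 2. Proof. lra. Qed.
Let m01 : 0 <= (0 : R) <= 1. Proof. by rewrite lexx ler01. Qed.

Lemma besselI0_ge1 x : 0 < x -> 1 <= besselI 0 x.
Proof.
move=> x0; have := besselI_ge (lexx 0) x0.
by rewrite powRr0 add0r Gamma1 divr1.
Qed.

Lemma besselI0_le x : 0 < x -> besselI 0 x <= expR x.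
Proof.
move=> x0; have := besselI_le (lexx 0) x0.
by rewrite powRr0 add0r Gamma1 divr1 mul1r.
Qed.

Local Notation L := (hitting_L (0 : R) c).

(** The shape 1 + ln^2 x records the logarithmic smallness at 0 without a singularity at x = 1. For
    x > 1 it is absorbed by the decay x^(-4), as (1 + x)(1 + ln^2 x) <= 4 x^3. *)
Lemma hitting_L_bound_zero : exists2 C, 0 <= C & forall x, 0 < x ->
  L x <= C * (expR ((c - 1) * x) / ((1 + x) * (1 + ln x ^+ 2))).
Proof.
have [C C0 CE] := hitting_L_large (lexx 0) m2 c1.
have [C' C'0 C'E] := order_zero_small c1 besselI0_ge1 besselI0_le
  (besselI_ndecr (lexx 0)) (fun x => besselK_gt0 m01)
  (fun x y => besselK_nincr m01) (@besselK0_log R).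
exists (4 * C + 2 * C'); first by apply: addr_ge0; exact: mulr_ge0.
move=> x x0; have x10 : 0 < 1 + x by rewrite addr_gt0.
have l1 : 0 < 1 + ln x ^+ 2 by rewrite ltr_pwDl// sqr_ge0.
have rhs0 : 0 <= expR ((c - 1) * x) / ((1 + x) * (1 + ln x ^+ 2)).
  by rewrite divr_ge0 ?expR_ge0// mulr_ge0// ltW.
rewrite mulrDl; have [x1|x1] := leP x 1.
  have x01 : 0 < x <= 1 by rewrite x0.
  apply: (@le_trans _ _ (2 * C' * (expR ((c - 1) * x) / ((1 + x) * (1 + ln x ^+ 2))))); last first.
    by rewrite lerDr; apply: mulr_ge0 => //; exact: mulr_ge0.
  apply: (le_trans (hitting_L_leK (lexx 0) m2 c1 x0)).
  apply: (le_trans (C'E _ x01)).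
  rewrite (_ : 2 * C' * _ = C' * ((1 + ln x ^+ 2)^-1 * (2 * expR ((c - 1) * x) / (1 + x)))); last first.
    by field; rewrite !gt_eqF.
  rewrite ler_wpM2l// ler_peMr ?invr_ge0 ?(ltW l1)// ler_pdivlMr// mul1r.
  have : 1 <= expR ((c - 1) * x).
    by rewrite -[leLHS]expR0 ler_expR mulr_ge0 ?subr_ge0 ?ltW.
  lra.
apply: (@le_trans _ _ (4 * C * (expR ((c - 1) * x) / ((1 + x) * (1 + ln x ^+ 2))))); last first.
  by rewrite lerDl; apply: mulr_ge0 => //; exact: mulr_ge0.
apply: (le_trans (CE _ (ltW x1))).
rewrite (_ : 4 * C * _ = C * (expR ((c - 1) * x) * (4 / ((1 + x) * (1 + ln x ^+ 2))))); last by ring.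
rewrite ler_wpM2l// ler_wpM2l ?expR_ge0// ler_pdivlMr ?mulr_gt0// mulrC ler_pdivrMr ?exprn_gt0//.
have x3 : x ^+ 3 <= x ^+ 4 by rewrite ler_weXn2l// ltW.
have lx : ln x ^+ 2 <= x ^+ 2.
  by rewrite ler_sqr ?nnegrE ?ln_ge0 ?(ltW x0) ?(ltW x1)// ltW// ln_sublinear.
have x2 : 1 <= x ^+ 2 by rewrite exprn_ege1// ltW.
have : (1 + x) * (1 + ln x ^+ 2) <= (2 * x) * (2 * x ^+ 2).
  by apply: ler_pM; rewrite ?(ltW x10) ?(ltW l1)//; lra.
rewrite (_ : (2 * x) * (2 * x ^+ 2) = 4 * x ^+ 3); last by ring.
lra.
Qed.

Lemma hitting_L_cvg_zero y : 0 < y ->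
  (fun h => ln h ^+ 2 * L (h * y)) @ 0^'+ --> ln c.
Proof.
move=> y0; have := order_zero_cvg c1 besselI0_ge1 besselI0_le
  (besselI_ndecr (lexx 0)) (fun x => besselK_gt0 m01)
  (@besselK0_log R) y0.
rewrite (_ : (fun h => _) = (fun h => ln h ^+ 2 * L (h * y)))//.
apply/funext => h; rewrite /hitting_L !mulr0 cos0 sin0 mul1r.
by rewrite !(mulr0, mul0r, addr0).
Qed.

End HittingLZero.

(** * Asymptotics of the density *)

Section Abel.
Context {R : realType}.
Local Notation mu := (@lebesgue_measure R).
Local Notation pos := (`]0%R, +oo[%classic : set R).
Implicit Types (x y d h k t : R).
Hint Resolve measurable_pos : core.

(** The cutoff at [d] sits in the integrand, so that the integrals for all [d] share one domain and
    dominated convergence in [d] applies. *)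
Definition gauss_tail d y : R -> R :=
  (fun x => x * expR (- (x ^+ 2 / 2) - y * x)) \_ `[d, +oo[.

Lemma gauss_tailE d y x :
  gauss_tail d y x = if d <= x then x * expR (- (x ^+ 2 / 2) - y * x) else 0.
Proof. by rewrite /gauss_tail patchE mem_setE in_itv/= andbT. Qed.

Lemma gauss_tail_ge0 d y x : 0 < x -> 0 <= gauss_tail d y x.
Proof.
by move=> x0; rewrite gauss_tailE; case: ifPn => // _; rewrite mulr_ge0 ?expR_ge0// ltW.
Qed.

Lemma gauss_tail_le d y x : 0 <= y -> 0 < x ->
  `|gauss_tail d y x| <= expR (- (d * y)) * (x * expR (- (x ^+ 2 / 2))).
Proof.
move=> y0 x0; rewrite ger0_norm ?gauss_tail_ge0// gauss_tailE; case: ifPn => dx.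
  rewrite [leRHS]mulrCA ler_wpM2l ?(ltW x0)// -expRD ler_expR.
  have := mulr_ge0 y0 (ltac:(by rewrite subr_ge0) : 0 <= x - d); lra.
by rewrite !mulr_ge0 ?expR_ge0// ltW.
Qed.

Let F_measurable d y : measurable_fun pos (gauss_tail d y).
Proof.
apply: measurable_funTS; apply/(measurable_restrictT _ _).1 => //.
apply: measurable_funTS; apply: continuous_measurable_fun => x.
by continuous1.
Qed.

Lemma gauss_tail_intble d y : 0 <= y -> intble (gauss_tail d y).
Proof.
move=> y0; have [xi _] := @intpos_xgauss R.
by apply: intble_le (intbleZ (expR (- (d * y))) xi) _ => // x; exact: gauss_tail_le.
Qed.

Let G d y := intpos (gauss_tail d y).

(** For y <= 1 the factor e^(-d y) is pulled out, the rest integrates to at most 1, and (1 + y)^2 <=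
    4. For y > 1 the Gaussian factor is dropped: the integral of x e^(-y x) over (d, oo) is e^(-d y)
    (1 + d y) / y^2, and (1 + y)^2 <= 4 y^2. *)
Lemma gauss_tail_bound d y : 0 <= d -> 0 < y ->
  0 <= G d y <= expR (- (d * y)) * (1 + d * y) * (4 / (1 + y) ^+ 2).
Proof.
move=> d0 y0; have y10 : 0 < 1 + y by rewrite addr_gt0.
have dy0 : 0 <= d * y by rewrite mulr_ge0// ltW.
rewrite intpos_ge0/=; last by move=> x; exact: gauss_tail_ge0.
have [xi xe] := @intpos_xgauss R.
have Gi := gauss_tail_intble d (ltW y0).
have [y1|y1] := leP y 1.
  apply: (@le_trans _ _ (expR (- (d * y)))).
    rewrite -[leRHS]mulr1 -xe -intposZ//; apply: intpos_le => //.
      exact: intbleZ.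
    by move=> x x0; apply: le_trans (gauss_tail_le d (ltW y0) x0); exact: ler_norm.
  rewrite -mulrA ler_peMr ?expR_ge0//.
  apply: (@le_trans _ _ (1 * 1)); first by rewrite mulr1.
  apply: ler_pM => //; first by rewrite lerDl.
  by rewrite ler_pdivlMr ?exprn_gt0// mul1r expr2; nra.
apply: (@le_trans _ _ (expR (- (d * y)) * (1 + d * y) / y ^+ 2)); last first.
  rewrite ler_wpM2l ?mulr_ge0 ?expR_ge0 ?addr_ge0//.
  rewrite ler_pdivlMr ?exprn_gt0// mulrC ler_pdivrMr ?exprn_gt0// !expr2; nra.
pose f x : R := x * expR (- (y * x)).
have fi : intble f.
  apply: eq_intble (intble_powexp (ltr0n R 2) y0) => x x0.
  by rewrite (_ : 2 - 1 = 1) ?powRr1 ?(ltW x0)//; ring.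
pose P x : R := - (expR (- (y * x)) * (x / y + (y ^+ 2)^-1)).
have yn0 : y != 0 by rewrite gt_eqF.
have dP x : is_derive x (1 : R) P (f x).
  by rewrite /P; is_derive1_by; rewrite /f; field; rewrite gt_eqF.
have FTC : (\int[mu]_(x in `[d, +oo[) (f x)%:E)%E = (0%:E - (P d)%:E)%E.
  apply: ge0_continuous_FTC2y.
  - by move=> x dx; rewrite mulr_ge0 ?expR_ge0// (le_trans d0).
  - by apply: continuous_subspaceT => x; rewrite /f; continuous1.
  - rewrite -[X in _ --> X]oppr0; apply: cvgN.
    have -> : (fun x => expR (- (y * x)) * (x / y + (y ^+ 2)^-1)) =
      (fun x => y^-1 * (x * expR (- (y * x))) + (y ^+ 2)^-1 * (x `^ 0 * expR (- (y * x)))).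
      by apply/funext => x; rewrite powRr0; ring.
    rewrite -[X in _ --> X]addr0 -[X in _ --> X + _](mulr0 y^-1) -[X in _ --> _ + X](mulr0 (y ^+ 2)^-1).
    apply: cvgD; apply: cvgM; [exact: cvg_cst| |exact: cvg_cst|exact: cvgy_powexpk].
    have := cvgy_powexpk ler01 y0; apply: cvg_trans; apply: near_eq_cvg; near=> x.
    have x0 : 0 < x by near: x; exact: nbhs_pinfty_gt.
    by rewrite powRr1// ltW.
  - by move=> x _; case: (dP x).
  - by apply: cvg_at_right_filter; exact: is_derive1_continuous (dP d).
  - by move=> x _; rewrite derive1E; case: (dP x).
have dint : (`[d, +oo[%classic : set R) `<=` `[0, +oo[%classic.
  by move=> x/=; rewrite !in_itv/= !andbT; exact: le_trans.
rewrite -lee_fin -EFin_intpos//.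
have -> : (expR (- (d * y)) * (1 + d * y) / y ^+ 2)%:E = (0%:E - (P d)%:E)%E.
  rewrite -EFinB; congr EFin; rewrite /P [y * d]mulrC; field.
  by rewrite gt_eqF.
rewrite -FTC integral_mkcond [leRHS]integral_mkcond.
apply: ge0_le_integral => //.
- move=> x _; rewrite patchE mem_setE in_itv/= andbT; case: ifPn => // x0.
  by rewrite lee_fin gauss_tail_ge0.
- apply/(measurable_restrictT _ _).1 => //.
  by apply/measurable_EFinP; exact: F_measurable.
- apply/(measurable_restrictT _ _).1 => //; apply/measurable_EFinP.
  apply: measurable_funTS; apply: continuous_measurable_fun => x.
  by rewrite /f; continuous1.
move=> x _; rewrite !patchE !mem_setE !in_itv/= !andbT gauss_tailE.
case: ifPn => x0; case: ifPn => dx //; rewrite lee_fin.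
- rewrite /f ler_wpM2l ?(ltW x0)// ler_expR lerBlDr addNr oppr_le0.
  by rewrite divr_ge0 ?sqr_ge0.
- by rewrite mulr_ge0 ?expR_ge0// (le_trans d0).
Unshelve. all: by end_near. Qed.

Lemma gauss_tail_cvg y : 0 < y -> (fun d => G d y) @ 0^'+ --> G 0 y.
Proof.
move=> y0; have [xi xe] := @intpos_xgauss R.
apply: (@intpos_dct_right R (fun d => gauss_tail d y) _
  (fun x => x * expR (- (x ^+ 2 / 2)))) => //.
- move=> d x d0 x0; apply: (le_trans (gauss_tail_le d (ltW y0) x0)).
  rewrite ler_piMl ?mulr_ge0 ?expR_ge0 ?(ltW x0)// expR_le1 oppr_le0.
  by rewrite mulr_ge0// ltW.
- move=> x x0; apply: cvg_near_cst; near=> d.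
  have dx : d <= x by near: d; exact: nbhs_right_le.
  by rewrite !gauss_tailE dx (ltW x0).
Unshelve. all: by end_near. Qed.

Lemma gauss_tail_measurable d : 0 <= d -> measurable_fun pos (G d).
Proof.
move=> d0; rewrite (_ : G d = (fun y => - - G d y)); last first.
  by apply/funext => y; rewrite opprK.
apply: measurableT_comp => //; apply: measurable_mono_pos => x y x0 xy.
have y0 := lt_le_trans x0 xy.
rewrite lerN2; apply: intpos_le; try (apply: gauss_tail_intble; exact: ltW).
move=> z z0; rewrite !gauss_tailE; case: ifPn => // _.
by rewrite ler_wpM2l ?(ltW z0)// ler_expR lerB// ler_pM2r.
Qed.

(** The exponential in the bound on [L] is cancelled exactly by e^(-k h y) from the cutoff [k * h],
    and (1 + k z) / (1 + z) <= 1 + k with z = h y. What remains, (y^p + y^(-p)) / (1 + y)^2, is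
    integrable as p < 1. The normalisation [w] is left abstract to cover both a power and a squared
    logarithm. *)
Lemma Abel_gauss_tail (L w l : R -> R) (C p k : R) :
  0 <= C -> 0 <= p < 1 -> 0 < k ->
  measurable_fun pos L -> measurable_fun pos l ->
  (forall h y, 0 < h -> 0 < y -> `|w h * L (h * y)| <=
     C * ((y `^ p + y `^ (- p)) * (expR (k * (h * y)) / (1 + h * y)))) ->
  (forall y, 0 < y -> (fun h => w h * L (h * y)) @ 0^'+ --> l y) ->
  (forall h, 0 < h -> intble (fun y => w h * L (h * y) * G (k * h) y)) /\
  (fun h => intpos (fun y => w h * L (h * y) * G (k * h) y)) @ 0^'+ -->
     intpos (fun y => l y * G 0 y).
Proof.
move=> C0 /andP[p0 p1] k0 mL ml LE Ll.
pose g y := 4 * C * (1 + k) * (y `^ p / (1 + y) ^+ 2) +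
  4 * C * (1 + k) * (y `^ (- p) / (1 + y) ^+ 2).
have gi : intble g by apply: intbleD; apply: intble_pow1; apply/andP; split; lra.
have bnd h y : 0 < h -> 0 < y -> `|w h * L (h * y) * G (k * h) y| <= g y.
  move=> h0 y0; have kh : 0 <= k * h by rewrite mulr_ge0// ltW.
  have /andP[G0 GE] := gauss_tail_bound kh y0.
  have z0 : 0 < h * y by rewrite mulr_gt0.
  have y10 : 0 < 1 + y by rewrite addr_gt0.
  have z10 : 0 < 1 + h * y by rewrite addr_gt0.
  rewrite normrM (ger0_norm G0).
  apply: (le_trans (ler_pM _ _ (LE h y h0 y0) GE)) => //.
  rewrite -!(mulrA k).
  set P := y `^ p; set Q := y `^ (- p); set z := h * y in z0 z10 *.
  have PQ : 0 <= P + Q by rewrite addr_ge0 ?powR_ge0.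
  apply: (@le_trans _ _ (C * (P + Q) * ((1 + k * z) / (1 + z)) * (4 / (1 + y) ^+ 2))).
    rewrite expRN le_eqVlt; apply/orP; left; apply/eqP; field.
    by rewrite !gt_eqF ?expR_gt0.
  rewrite /g -/P -/Q.
  rewrite [leRHS](_ : _ = C * (P + Q) * (1 + k) * (4 / (1 + y) ^+ 2)); last by ring.
  rewrite ler_wpM2r ?divr_ge0 ?sqr_ge0// ler_wpM2l ?mulr_ge0//.
  by rewrite ler_pdivrMr//; nra.
have meas h : 0 < h -> measurable_fun pos (fun y => w h * L (h * y) * G (k * h) y).
  move=> h0; apply: measurable_funM.
    by apply: measurable_funM => //; exact: measurable_scale.
  by apply: gauss_tail_measurable; rewrite mulr_ge0// ltW.
split; first by move=> h h0; apply: intble_le gi _ => [|y y0]; [exact: meas|exact: bnd].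
apply: (@intpos_dct_right R (fun h y => w h * L (h * y) * G (k * h) y) _ g) => //.
- by apply: measurable_funM => //; exact: gauss_tail_measurable.
- move=> y y0; apply: cvgM; first exact: Ll.
  exact: (cvg_at_right_scale k0 (gauss_tail_cvg y0)).
Qed.

End Abel.

(** * Evaluation of the limiting integral *)

Section GaussConstant.
Context {R : realType}.
Local Notation mu := (@lebesgue_measure R).
Local Notation pos := (`]0%R, +oo[%classic : set R).
Implicit Types (x y d h k t : R).
Hint Resolve measurable_pos : core.

(** Fubini, the integral of y^p e^(-x y) in [y] being Gamma(p + 1) x^(-p-1). The integrand is
    nonnegative, so its inner integral is its own majorant. *)
Lemma intpos_pow_gauss_tail p : 0 <= p < 1 ->
  intpos (fun y => y `^ p * intpos (gauss_tail 0 y)) =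
  Gamma (p + 1) * intpos (fun x : R => x `^ (- p) * expR (- (x ^+ 2 / 2))).
Proof.
move=> /andP[p0 p1]; have p10 : 0 < p + 1 by rewrite ltr_wpDl.
have pE : p = p + 1 - 1 by rewrite addrK.
have ge i : i = - p -> 0 < i + 1 ->
    intble (fun x : R => x `^ i * expR (- (x ^+ 2 / 2))).
  by move=> _ i0; have [+ _] := intpos_powgauss i0; rewrite addrK.
have gi := ge (- p) erefl (ltac:(lra)).
pose f x y : R := x * expR (- (x ^+ 2 / 2)) * (y `^ p * expR (- (x * y))).
have fx x : 0 < x -> intble (f x).
  by move=> x0; apply: intbleZ; rewrite pE; exact: intble_powexp.
have fxi x : 0 < x -> intpos (f x) =
    Gamma (p + 1) * (x `^ (- p) * expR (- (x ^+ 2 / 2))).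
  move=> x0; rewrite /f intposZ; last by rewrite pE; exact: intble_powexp.
  rewrite [in LHS]pE intpos_powexp//.
  have -> : x `^ (- p) = x * x `^ (- (p + 1)).
    rewrite -[X in X * _ `^ _]powRr1 ?(ltW x0)// -powRD ?(gt_eqF x0) ?implybT//.
    by congr (_ `^ _); ring.
  ring.
have fyE x y : 0 < x -> y `^ p * gauss_tail 0 y x = f x y.
  by move=> x0; rewrite gauss_tailE (ltW x0) /f expRD [y * x]mulrC; ring.
have fy y : 0 < y -> intble (f ^~ y).
  move=> y0; have := intbleZ (y `^ p) (gauss_tail_intble 0 (ltW y0)).
  by apply: eq_intble => x x0; rewrite fyE.
have mf : measurable_fun [set: measurableTypeR R * measurableTypeR R]
    (fun w => f w.1 w.2).
  have m1 : measurable_fun [set: measurableTypeR R * measurableTypeR R]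
    (fun w => w.1 : R) by exact: measurable_fst.
  have m2 : measurable_fun [set: measurableTypeR R * measurableTypeR R]
    (fun w => w.2 : R) by exact: measurable_snd.
  have m12 := measurable_funM m1 m2.
  have mexp (k : _ -> R) : measurable_fun [set: measurableTypeR R * measurableTypeR R]
      k -> measurable_fun setT (fun w => expR (- k w)).
    by move=> mk; do 2 apply: measurableT_comp => //.
  apply: measurable_funM.
    apply: measurable_funM => //; apply: mexp; apply: measurable_funM => //.
    exact: (measurable_funX 2 m1).
  apply: measurable_funM; last exact: mexp.
  exact: (measurableT_comp (measurable_powR p) m2).
transitivity (intpos (fun y => intpos (f ^~ y))).
  apply: eq_intpos => y y0; rewrite -intposZ; last exact: gauss_tail_intble (ltW y0).
  by apply: eq_intpos => x x0; rewrite fyE.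
rewrite -(@fubini_pos R f (fun x => intpos (f x)))//.
- by rewrite (eq_intpos fxi) intposZ.
- have := intbleZ (Gamma (p + 1)) gi.
  by apply: eq_intble => x x0; rewrite fxi.
- move=> x x0; rewrite le_eqVlt; apply/orP; left; apply/eqP.
  apply: eq_intpos => y y0; rewrite ger0_norm//.
  by rewrite !mulr_ge0 ?powR_ge0 ?expR_ge0// ltW.
Qed.

Lemma integral_gauss_tail (d b t x : R) : 0 < d -> 0 < b -> 0 < t -> 0 < x ->
  \int[mu]_(xi in `[d, +oo[) (xi * expR (- (xi ^+ 2 / (2 * t)) - x * xi / b)) =
  t * intpos (gauss_tail (d / Num.sqrt t) (x * Num.sqrt t / b)).
Proof.
move=> d0 b0 t0 x0; have s0 : 0 < Num.sqrt t by rewrite sqrtr_gt0.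
have ts : t = Num.sqrt t ^+ 2 by rewrite sqr_sqrtr// ltW.
set s := Num.sqrt t in s0 ts *; rewrite ts.
have y0 : 0 <= x * s / b by rewrite !mulr_ge0 ?invr_ge0// ltW.
have gi := gauss_tail_intble (d / s) y0.
have s10 : 0 < s^-1 by rewrite invr_gt0.
transitivity (intpos (fun xi => s * gauss_tail (d / s) (x * s / b) (s^-1 * xi))).
  rewrite (_ : `[d, +oo[%classic = pos `&` `[d, +oo[); last first.
    apply/seteqP; split => z /=; rewrite !in_itv/= !andbT.
      by move=> dz; rewrite dz (lt_le_trans d0).
    by case.
  rewrite Rintegral_mkcondr; apply: eq_intpos => z z0.
  rewrite patchE mem_setE in_itv/= andbT gauss_tailE [s^-1 * z]mulrC ler_pM2r//.
  case: ifPn => _; last by rewrite mulr0.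
  rewrite [RHS]mulrA [s * _]mulrC divfK ?gt_eqF//; congr (_ * expR _).
  by field; rewrite !gt_eqF.
rewrite intposZ; last exact: intble_scale s10 gi.
by rewrite (intpos_scale s10 gi) invrK mulrA -expr2.
Qed.

End GaussConstant.

(** * Passage to large times *)

Section AtInfinity.
Context {R : realType}.
Local Notation mu := (@lebesgue_measure R).
Local Notation pos := (`]0%R, +oo[%classic : set R).
Implicit Types (x y h k t : R).
Hint Resolve measurable_pos : core.

(** The normalisation [v] turns the target [g] into the constant [l], so the relative error is v f /
    l - 1. *)
Lemma asymp_eq_of_cvg (f g v : R -> R) (l : R) : l != 0 ->
  (\forall t \near +oo, v t != 0 /\ v t * g t = l) ->
  (fun t => v t * f t) @ +oo --> l -> asymp_eq_pinfty f g.
Proof.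
move=> l0 vg vf; exists (fun t => v t * f t / l - 1).
  rewrite -[X in _ --> X](subrr 1); apply: cvgB; last exact: cvg_cst.
  by rewrite -[X in _ --> X](divff l0); apply: cvgM => //; exact: cvg_cst.
near=> t; have [v0 <-] : v t != 0 /\ v t * g t = l by near: t.
have : v t * g t != 0 by have [_ ->] : v t != 0 /\ v t * g t = l by near: t.
rewrite mulf_eq0 (negbTE v0)/= => g0.
by field; rewrite v0 g0.
Unshelve. all: by end_near. Qed.

Lemma cvgy_div_sqrt (b : R) : 0 < b -> (fun t => b / Num.sqrt t) @ +oo --> 0^'+.
Proof.
move=> b0; apply: cvg_to_at_right; last first.
  by near=> t; rewrite divr_gt0// sqrtr_gt0; near: t; exact: nbhs_pinfty_gt (num_real _).
apply/cvgrPdist_le => e e0; near=> t.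
have t0 : 0 < t by near: t; exact: nbhs_pinfty_gt (num_real _).
have tb : (b / e) ^+ 2 < t by near: t; exact: nbhs_pinfty_gt (num_real _).
rewrite sub0r normrN gtr0_norm ?divr_gt0 ?sqrtr_gt0//.
rewrite ler_pdivrMr ?sqrtr_gt0// -ler_pdivrMl// mulrC.
rewrite -[leLHS]ger0_norm ?divr_ge0 ?(ltW b0) ?(ltW e0)// -sqrtr_sqr.
by rewrite ler_sqrt// ltW.
Unshelve. all: by end_near. Qed.

Lemma cvgy_ln : (@ln R) @ +oo --> +oo.
Proof.
apply/cvgryPge => A; near=> t.
have t0 : expR A < t by near: t; exact: nbhs_pinfty_gt (num_real _).
by rewrite -[leLHS]expRK ler_ln ?posrE ?expR_gt0 ?(lt_trans _ t0) ?expR_gt0// ltW.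
Unshelve. all: by end_near. Qed.

Lemma cvgy_powN0 (q : R) : 0 < q -> (fun t => t `^ (- q)) @ +oo --> (0 : R).
Proof.
move=> q0; have := cvg_comp _ _ cvgy_ln (cvgy_powexpk (lexx 0) q0).
apply: cvg_trans; apply: near_eq_cvg; near=> t => /=.
have t0 : 0 < t by near: t; exact: nbhs_pinfty_gt (num_real _).
by rewrite powRr0 mul1r /powR gt_eqF// mulNr.
Unshelve. all: by end_near. Qed.

Lemma cvgy_sqr_ln_div_sqrt : (fun t => ln t ^+ 2 / Num.sqrt t) @ +oo --> (0 : R).
Proof.
have h0 : (0 : R) < 2^-1 by rewrite invr_gt0.
have := cvg_comp _ _ cvgy_ln (cvgy_powexpk (ler0n R 2) h0).
apply: cvg_trans; apply: near_eq_cvg; near=> t => /=.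
have t1 : 1 < t by near: t; exact: nbhs_pinfty_gt (num_real _).
have t0 : 0 < t := lt_trans ltr01 t1.
rewrite powR_mulrn ?ln_ge0 ?(ltW t1)//; congr (_ * _).
by rewrite -powR12_sqrt ?(ltW t0)// /powR gt_eqF// expRN.
Unshelve. all: by end_near. Qed.

(** Since ln (b / sqrt t) = ln b - (ln t)/2, the squared ratio tends to 4. *)
Lemma cvgy_ln_ratio (b : R) : 0 < b ->
  (fun t => ln t ^+ 2 / ln (b / Num.sqrt t) ^+ 2) @ +oo --> (4 : R).
Proof.
move=> b0.
have lnV0 : (fun t : R => (ln t)^-1) @ +oo --> 0.
  apply/gtr0_cvgV0; last exact: cvgy_ln.
  by near=> t; rewrite ln_gt0//; near: t; exact: nbhs_pinfty_gt (num_real _).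
have h1 : (fun t => ln b * (ln t)^-1 - 1 / 2) @ +oo --> ln b * 0 - 1 / 2.
  by apply: cvgB; [apply: cvgM => //|]; exact: cvg_cst.
have h : (fun t => (ln b * (ln t)^-1 - 1 / 2) ^- 2) @ +oo --> (4 : R).
  have e4 : (4 : R) = ((ln b * 0 - 1 / 2) * (ln b * 0 - 1 / 2))^-1.
    by rewrite mulr0 sub0r mulrNN -expr2 expr_div_n expr1n div1r invrK expr2; ring.
  have n0 : (ln b * 0 - 1 / 2) * (ln b * 0 - 1 / 2) != 0.
    by rewrite -invr_eq0 -e4 pnatr_eq0.
  by rewrite e4; exact: (cvgV n0 (cvgM h1 h1)).
apply: cvg_trans h; apply: near_eq_cvg; near=> t => /=.
have t1 : 1 < t by near: t; exact: nbhs_pinfty_gt (num_real _).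
have t0 : 0 < t := lt_trans ltr01 t1.
have l0 : 0 < ln t by rewrite ln_gt0.
rewrite ln_div ?posrE ?sqrtr_gt0// -powR12_sqrt ?(ltW t0)// ln_powR.
rewrite (_ : ln b - 2^-1 * ln t = (ln b * (ln t)^-1 - 1 / 2) * ln t).
  move: (_ - 1 / 2) => X; have N0 : ln t ^+ 2 != 0 by rewrite expf_neq0// gt_eqF.
  rewrite exprMn; move: (X ^+ 2) (ln t ^+ 2) N0 => M N N0.
  by rewrite invfM mulrCA divff// mulr1.
by rewrite mulrBl divfK ?gt_eqF// mul1r.
Unshelve. all: by end_near. Qed.

(* [rho] is the normalisation in the variable [t] and [w] the corresponding one
   in the variable [h = b / sqrt t]. *)
Lemma cvgy_hitting_density (nu a b : R) (w l rho : R -> R) (C p r : R) :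
  let c := a / b in let L := hitting_L `|nu| c in
  0 < b -> b < a -> `|nu| < 1 / 2 -> 0 <= C -> 0 <= p < 1 ->
  (forall h, 0 < h < 1 -> w h != 0) -> measurable_fun pos l ->
  (forall h y, 0 < h -> 0 < y -> `|w h * L (h * y)| <=
     C * ((y `^ p + y `^ (- p)) * (expR ((c - 1) * (h * y)) / (1 + h * y)))) ->
  (forall y, 0 < y -> (fun h => w h * L (h * y)) @ 0^'+ --> l y) ->
  (fun t => rho t / w (b / Num.sqrt t)) @ +oo --> r ->
  (fun t => rho t / Num.sqrt t) @ +oo --> (0 : R) ->
  (fun t => rho t * t * hitting_density_formula nu a b t) @ +oo -->
    c `^ (- nu) * (Num.sqrt (2 * pi))^-1 * r *
    intpos (fun y => l y * intpos (gauss_tail 0 y)).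
Proof.
move=> c L b0 ab nu2 C0 p01 w0 ml LE Ll rw rs.
have c1 : 1 < c by rewrite /c ltr_pdivlMr// mul1r.
have k0 : 0 < c - 1 by rewrite subr_gt0.
have mL := hitting_L_measurable (normr_ge0 nu) nu2 c1.
have [Ai Al] := Abel_gauss_tail C0 p01 k0 mL ml LE Ll.
pose J h := intpos (fun y => w h * L (h * y) * intpos (gauss_tail ((c - 1) * h) y)).
have JL := cvg_comp _ _ (cvgy_div_sqrt b0) Al.
(* [A] does not depend on t: after multiplication by rho(t) t, the first term of the closed form is
   [A] times rho(t) / sqrt t times a bounded factor, and tends to 0. *)
pose A := c `^ (- `|nu|) - \int[mu]_(x in `]0, +oo[)
  (x^-1 * expR (- (c - 1) * x) * L x).
pose s2 : R := Num.sqrt (2 * pi).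
have s20 : 0 < s2 by rewrite sqrtr_gt0 mulr_gt0// pi_gt0.
have ex : (fun t => expR (- ((a - b) ^+ 2 / 2 * t^-1))) @ +oo --> (1 : R).
  have tV : (fun t => - ((a - b) ^+ 2 / 2 * t^-1)) @ +oo --> - ((a - b) ^+ 2 / 2 * 0).
    apply: cvgN; apply: cvgM; first exact: cvg_cst.
    by apply/gtr0_cvgV0; [exact: nbhs_pinfty_gt|exact: cvg_id].
  by have := cvg_comp _ _ tV (@continuous_expR R _); rewrite mulr0 oppr0 expR0.
have main : (fun t => c `^ (- nu) * A * ((a - b) / s2) * (rho t / Num.sqrt t) *
     expR (- ((a - b) ^+ 2 / 2 * t^-1)) +
   c `^ (- nu) * s2^-1 * (rho t / w (b / Num.sqrt t)) * J (b / Num.sqrt t))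
   @ +oo --> c `^ (- nu) * A * ((a - b) / s2) * 0 * 1 +
     c `^ (- nu) * s2^-1 * r * intpos (fun y => l y * intpos (gauss_tail 0 y)).
  apply: cvgD; (apply: cvgM; first (apply: cvgM; first exact: cvg_cst)) => //.
rewrite mulr0 mul0r add0r in main.
apply: cvg_trans main; apply: near_eq_cvg; near=> t.
have t0 : 0 < t by near: t; exact: nbhs_pinfty_gt (num_real _).
(* This makes h < 1, where [w] does not vanish; the squared logarithm vanishes at h = 1. *)
have tb : b ^+ 2 < t by near: t; exact: nbhs_pinfty_gt (num_real _).
have s0 : 0 < Num.sqrt t by rewrite sqrtr_gt0.
have ts : t = Num.sqrt t ^+ 2 by rewrite sqr_sqrtr// ltW.
set s := Num.sqrt t in s0 ts *.
have bs : b < s.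
  by rewrite -(ltr_pXn2r (n := 2)) ?nnegrE ?(ltW b0) ?(ltW s0)// -ts.
set h := b / s.
have h0 : 0 < h by rewrite divr_gt0.
have wh : w h != 0 by apply: w0; rewrite h0 ltr_pdivrMr// mul1r.
have s3 : Num.sqrt (2 * pi * t ^+ 3) = s2 * s ^+ 3.
  rewrite sqrtrM ?mulr_ge0 ?pi_ge0//; congr (_ * _).
  by rewrite ts -exprM -[in RHS](ger0_norm (ltW s0)) -normrX -sqrtr_sqr -exprM.
(* The scaling of [xi] by sqrt t turns the cutoff a - b into (c - 1) h and the slope into x / h, so
   that x = h y brings the double integral to the form [J h]. *)
have S : \int[mu]_(x in `]0, +oo[) (L x * ((Num.sqrt (2 * pi * t ^+ 3))^-1 *
      \int[mu]_(xi in `[a - b, +oo[)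
        (xi * expR (- (xi ^+ 2 / (2 * t)) - x * xi / b)))) =
    (s2 * s * w h)^-1 * (h * J h).
  pose F y := w h * L (h * y) * intpos (gauss_tail ((c - 1) * h) y).
  have h10 : 0 < h^-1 by rewrite invr_gt0.
  have Fi : intble F by exact: Ai.
  rewrite -[X in X * J h]invrK -(intpos_scale h10 Fi) -intposZ; last first.
    exact: intble_scale h10 Fi.
  apply: eq_intpos => x x0; rewrite integral_gauss_tail ?subr_gt0//.
  rewrite /F mulVKf ?gt_eqF// s3 -/s.
  have -> : x * s / b = h^-1 * x by rewrite /h invf_div -mulrA [LHS]mulrC.
  have -> : (a - b) / s = (c - 1) * h.
    by rewrite /h /c; field; rewrite !gt_eqF.
  set G := intpos _; rewrite ts; field.
  by rewrite wh !gt_eqF.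
rewrite /hitting_density_formula -/c -/L S -/A /hitting_q s3.
have -> : - (a - b) ^+ 2 / (2 * t) = - ((a - b) ^+ 2 / 2 * t^-1).
  by rewrite mulNr invfM mulrA.
set E := expR _; set Q := c `^ _; set JJ := J h; move: (w h) wh => W wh.
by rewrite /h ts; field; rewrite wh !gt_eqF.
Unshelve. all: by end_near. Qed.

End AtInfinity.

(** * The two asymptotic regimes *)

Section Asymptotics.
Context {R : realType}.
Local Notation mu := (@lebesgue_measure R).
Local Notation pos := (`]0%R, +oo[%classic : set R).
Implicit Types (x y h k t : R).
Hint Resolve measurable_pos : core.

Lemma intble_pow_gauss_tail (p : R) : 0 <= p < 1 ->
  intble (fun y => y `^ p * intpos (gauss_tail 0 y)).
Proof.
move=> /andP[p0 p1]; have p11 : -1 < p < 1 by apply/andP; split; lra.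
apply: (intble_le _ (intbleZ 4 (intble_pow1D p11))) => [|y y0].
  apply: measurable_funM; last exact: gauss_tail_measurable.
  by apply: measurable_funTS; exact: measurable_powR.
have /andP[G0] := gauss_tail_bound (lexx 0) y0.
rewrite mul0r oppr0 expR0 addr0 !mul1r => GE.
rewrite ger0_norm ?mulr_ge0 ?powR_ge0// mulrCA.
by rewrite ler_wpM2l ?powR_ge0.
Qed.

Lemma sqrt_2pi : Num.sqrt (2 * pi) = 2 * Num.sqrt (pi / 2) :> R.
Proof.
rewrite -{2}(sqr_sqrtr (ler0n R 2)).
rewrite (_ : 2 * pi = 2 ^+ 2 * (pi / 2) :> R); last by generalize (@pi R) => q; field.
by rewrite sqrtrM ?sqr_ge0// sqrtr_sqr ger0_norm// sqr_sqrtr.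
Qed.

(** With z = (ln y)/4, squaring e^|z| >= 1 + |z| gives 1 + 16 z^2 <= 16 e^(2|z|), and e^(2|z|) is
    the larger of y^(1/2) and y^(-1/2). This trades the factor in ln y of the case of index 0 for
    powers. *)
Lemma sqr_ln_le y : 0 < y -> 1 + ln y ^+ 2 <= 16 * (y `^ (1 / 2) + y `^ (- (1 / 2))).
Proof.
move=> y0; rewrite /powR gt_eqF//; set u := ln y.
have E (z : R) : 1 + 16 * z ^+ 2 <= 16 * expR (2 * `|z|).
  have := expR_ge1Dx `|z|; have := normr_ge0 z.
  have -> : 2 * `|z| = `|z| + `|z| by ring.
  rewrite expRD -(real_normK (num_real z)) expr2.
  by move: `|z| (expR _) => r e; nra.
have := E (u / 4); rewrite normrM (ger0_norm (_ : 0 <= 4^-1))//.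
have := expR_gt0 (1 / 2 * u); have := expR_gt0 (- (1 / 2) * u).
have -> : 16 * (u / 4) ^+ 2 = u ^+ 2 by rewrite !expr2; field.
case: (ger0P u) => _.
  rewrite (_ : 2 * (u / 4) = 1 / 2 * u); last by field.
  by move: (expR _) (expR _) => r s; lra.
rewrite (_ : 2 * (- u / 4) = - (1 / 2) * u); last by field.
by move: (expR _) (expR _) => r s; lra.
Qed.

Lemma asymp_index0 (a b : R) (f : R -> R) : 0 < b -> b < a ->
  (forall t, 0 < t -> f t = hitting_density_formula 0 a b t) ->
  asymp_eq_pinfty f (fun t => 2 * ln (a / b) * t^-1 * ((ln t) ^+ 2)^-1).
Proof.
move=> b0 ab fE; set c := a / b.
have c1 : 1 < c by rewrite /c ltr_pdivlMr// mul1r.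
have lc : 0 < ln c by rewrite ln_gt0.
have h2 : (0 : R) < 1 / 2 by [].
have [C C0 CE] := hitting_L_bound_zero c1.
have p01 : 0 <= (1 / 2 : R) < 1 by apply/andP; split; lra.
have C32 : 0 <= 32 * C by rewrite mulr_ge0.
have n2 : `|0 : R| < 1 / 2 by rewrite normr0.
have LE h y : 0 < h -> 0 < y -> `|ln h ^+ 2 * hitting_L `|0 : R| c (h * y)| <=
    32 * C * ((y `^ (1 / 2) + y `^ (- (1 / 2))) *
    (expR ((c - 1) * (h * y)) / (1 + h * y))).
  move=> h0 y0; have x0 : 0 < h * y by rewrite mulr_gt0.
  rewrite normr0 ger0_norm; last first.
    by rewrite mulr_ge0 ?sqr_ge0// hitting_L_ge0.
  apply: (le_trans (ler_wpM2l (sqr_ge0 _) (CE _ x0))).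
  have := sqr_ln_le y0; set Y := _ + y `^ _ => YE.
  have lx : ln (h * y) = ln h + ln y by rewrite lnM.
  set x := h * y in x0 lx *; have x10 : 0 < 1 + x by rewrite addr_gt0.
  set e := expR _; set q := 1 + ln x ^+ 2.
  have q0 : 0 < q by rewrite ltr_pwDl ?sqr_ge0.
  have -> : ln h ^+ 2 * (C * (e / ((1 + x) * q))) = C * (ln h ^+ 2 / q) * (e / (1 + x)).
    by field; rewrite !gt_eqF.
  rewrite [leRHS]mulrA ler_wpM2r ?divr_ge0 ?expR_ge0 ?(ltW x10)//.
  rewrite [32 * C]mulrC -[leRHS]mulrA ler_wpM2l// ler_pdivrMr//.
  (* As ln h = ln x - ln y, ln^2 h <= 2 (1 + ln^2 x)(1 + ln^2 y); with the 16 of [sqr_ln_le] this is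
     the origin of 32. *)
  apply: (@le_trans _ _ (2 * (1 + ln y ^+ 2) * q)); last first.
    by rewrite ler_wpM2r ?(ltW q0)//; move: YE; lra.
  rewrite /q; have -> : ln h = ln x - ln y by rewrite lx addrK.
  by move: (ln x) (ln y) => u v; rewrite !expr2; nra.
have w0 h : 0 < h < 1 -> ln h ^+ 2 != 0.
  by move=> h01; rewrite expf_neq0// lt_eqF// ln_lt0.
have Ll y : 0 < y -> (fun h => ln h ^+ 2 * hitting_L `|0 : R| c (h * y)) @ 0^'+ --> ln c.
  by rewrite normr0; exact: hitting_L_cvg_zero.
have key := @cvgy_hitting_density R 0 a b (fun h => ln h ^+ 2) (fun=> ln c)
  (fun t => ln t ^+ 2) _ _ _ b0 ab n2 C32 p01 w0 (measurable_cst _) LE Ll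
  (cvgy_ln_ratio b0) cvgy_sqr_ln_div_sqrt.
have p00 : 0 <= (0 : R) < 1 by rewrite lexx ltr01.
have Ii := intble_pow_gauss_tail p00.
have := intpos_pow_gauss_tail p00; rewrite add0r Gamma1 mul1r.
rewrite (_ : intpos (fun x => x `^ (- 0) * _) = Num.sqrt (pi / 2)); last first.
  have [_ <-] := @gaussian_integral R; apply: eq_intpos => x _.
  by rewrite oppr0 powRr0 mul1r.
move=> IE.
have I1 : intpos (fun y => ln c * intpos (gauss_tail 0 y)) = ln c * Num.sqrt (pi / 2).
  rewrite -IE -intposZ//; apply: eq_intpos => y _.
  by rewrite powRr0 mul1r.
rewrite I1 oppr0 powRr0 sqrt_2pi in key.
have sp : 0 < Num.sqrt (pi / 2) :> R by rewrite sqrtr_gt0 divr_gt0// pi_gt0.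
apply: (@asymp_eq_of_cvg R _ _ (fun t => ln t ^+ 2 * t) (2 * ln c)).
- by rewrite mulf_neq0// gt_eqF.
- near=> t; have t1 : 1 < t by near: t; exact: nbhs_pinfty_gt.
  have t0 : 0 < t := lt_trans ltr01 t1.
  have l0 : ln t ^+ 2 != 0 by rewrite expf_neq0// gt_eqF// ln_gt0.
  split; first by rewrite mulf_neq0// gt_eqF.
  by move: (ln t ^+ 2) l0 (ln c) => N N0 k; field; rewrite N0 gt_eqF.
(* The 4 is the limit of (ln t / ln (b / sqrt t))^2, and sqrt(2 pi) = 2 sqrt(pi/2) leaves a factor
   2. *)
have -> : 2 * ln c = 1 * (2 * Num.sqrt (pi / 2))^-1 * 4 * (ln c * Num.sqrt (pi / 2)).
  by move: (ln c) (Num.sqrt _) sp => k s s0; field; rewrite gt_eqF.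
apply: cvg_trans key; apply: near_eq_cvg; near=> t.
by rewrite fE//; near: t; exact: nbhs_pinfty_gt.
Unshelve. all: by end_near. Qed.

(** [Gamma_cos_gauss] at s = 2m replaces the product of Gamma(2m), cos (pi m) and the Gaussian
    moment by a multiple of Gamma(m), which cancels against the denominator of the constant. *)
Lemma hitting_L_const_gauss (m c : R) : 0 < m -> m < 1 / 2 ->
  hitting_L_const m c *
    (Gamma (2 * m + 1) * intpos (fun x => x `^ (- (2 * m)) * expR (- (x ^+ 2 / 2)))) =
  Num.sqrt (2 * pi) * ((c `^ m - c `^ (- m)) / (2 `^ m * Gamma m)).
Proof.
move=> m0 m2; have s0 : 0 < 2 * m by lra.
have s01 : 0 < 2 * m < 1 by rewrite s0; lra.
have := Gamma_cos_gauss s01.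
rewrite (_ : 2 * m * (pi / 2) = pi * m); last by generalize (@pi R) => q; field.
rewrite (_ : 2 * m / 2 = m); last by field.
rewrite /hitting_L_const (GammaS s0) (GammaS m0) sqrt_2pi.
have -> : 2 `^ (- m) = (2 `^ m)^-1 :> R by rewrite powRN.
have G0 := Gamma_gt0 m0.
have p0 : 0 < 2 `^ m :> R by rewrite powR_gt0.
have q0 : 0 < 2 `^ (m - 1) :> R by rewrite powR_gt0.
move: (intpos _) (Num.sqrt _) (Gamma (2 * m)) => I s G.
move: (Gamma m) (2 `^ m) (2 `^ (m - 1)) (cos _) G0 p0 q0 => g p q k g0 p0 q0 E.
move: (c `^ m) (c `^ (- m)) => u v.
transitivity (2 * (u - v) / (p * q * g ^+ 2) * (G * k * I)).
  by field; rewrite !gt_eqF.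
by rewrite E; field; rewrite !gt_eqF.
Qed.

Lemma asymp_index_pos (nu a b : R) (f : R -> R) : 0 < b -> b < a ->
  0 < `|nu| < 1 / 2 ->
  (forall t, 0 < t -> f t = hitting_density_formula nu a b t) ->
  asymp_eq_pinfty f (fun t => b `^ (2 * `|nu|) *
    ((a / b) `^ `|nu| - (a / b) `^ (- `|nu|)) /
    ((a / b) `^ nu * 2 `^ `|nu| * Gamma `|nu|) * t `^ (- `|nu| - 1)).
Proof.
move=> b0 ab /andP[n0 n2] fE; set c := a / b.
have c1 : 1 < c by rewrite /c ltr_pdivlMr// mul1r.
have c0 : 0 < c := lt_trans ltr01 c1.
set m := `|nu| in n0 n2 *.
have [C C0 CE] := hitting_L_bound_pos n0 n2 c1.
have p01 : 0 <= 2 * m < 1 by apply/andP; split; lra.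
have wL h y : 0 < h -> 0 < y ->
    h `^ (- (2 * m)) * (h * y) `^ (2 * m) = y `^ (2 * m).
  move=> h0 y0; rewrite powRM ?(ltW h0) ?(ltW y0)// mulrA -powRD.
    by rewrite addNr powRr0 mul1r.
  by rewrite (gt_eqF h0) implybT.
have LE h y : 0 < h -> 0 < y -> `|h `^ (- (2 * m)) * hitting_L m c (h * y)| <=
    C * ((y `^ (2 * m) + y `^ (- (2 * m))) *
    (expR ((c - 1) * (h * y)) / (1 + h * y))).
  move=> h0 y0; have x0 : 0 < h * y by rewrite mulr_gt0.
  rewrite ger0_norm; last by rewrite mulr_ge0 ?powR_ge0// hitting_L_ge0// ltW.
  apply: (le_trans (ler_wpM2l (powR_ge0 _ _) (CE _ x0))).
  rewrite mulrCA ler_wpM2l// !mulrA wL// -!mulrA ler_wpM2r//.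
    by rewrite divr_ge0 ?expR_ge0// addr_ge0// ltW.
  by rewrite lerDl powR_ge0.
have w0 h : 0 < h < 1 -> h `^ (- (2 * m)) != 0.
  by move=> /andP[h0 _]; rewrite gt_eqF// powR_gt0.
have Ll y : 0 < y -> (fun h => h `^ (- (2 * m)) * hitting_L m c (h * y)) @ 0^'+ -->
    hitting_L_const m c * y `^ (2 * m).
  move=> y0; have lim := cvg_at_right_scale y0 (hitting_L_cvg_pos n0 n2 c1).
  have : (fun h => hitting_L m c (y * h) / (y * h) `^ (2 * m) * y `^ (2 * m)) @ 0^'+ -->
      hitting_L_const m c * y `^ (2 * m).
    by apply: cvgM; [exact: lim|exact: cvg_cst].
  apply: cvg_trans; apply: near_eq_cvg; near=> h.
  have h0 : 0 < h by near: h; exact: nbhs_right_gt.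
  rewrite [y * h]mulrC -(wL h y)//.
  have : (h * y) `^ (2 * m) != 0 by rewrite gt_eqF// powR_gt0// mulr_gt0.
  move: (_ `^ _) => z z0.
  by rewrite mulrCA divfK.
have ml : measurable_fun pos (fun y => hitting_L_const m c * y `^ (2 * m)).
  apply: measurable_funM => //.
  by apply: measurable_funTS; exact: measurable_powR.
(* The quotient is constant for t > 0; the factor b^(2|nu|) of the result originates here. *)
have rw : (fun t => t `^ m / (b / Num.sqrt t) `^ (- (2 * m))) @ +oo --> b `^ (2 * m).
  apply: cvg_near_cst; near=> t.
  have t0 : 0 < t by near: t; exact: nbhs_pinfty_gt.
  rewrite powRN invrK powRM ?invr_ge0 ?(ltW b0)//.
  rewrite mulrCA -[RHS]mulr1; congr (_ * _).
  rewrite -powR12_sqrt ?(ltW t0)// -powRN -powRrM.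
  rewrite (_ : - 2^-1 * (2 * m) = - m) ?powRN ?mulfV ?gt_eqF ?powR_gt0//.
  by field.
(* This is where m < 1/2 makes the O(t^(-3/2)) term negligible against t^(-m-1). *)
have rs : (fun t => t `^ m / Num.sqrt t) @ +oo --> (0 : R).
  have q0 : 0 < 2^-1 - m by lra.
  have := cvgy_powN0 q0; apply: cvg_trans; apply: near_eq_cvg; near=> t.
  have t0 : 0 < t by near: t; exact: nbhs_pinfty_gt.
  rewrite -powR12_sqrt ?(ltW t0)// -powRN -powRD ?(gt_eqF t0) ?implybT//.
  by congr (_ `^ _); ring.
have := @cvgy_hitting_density R nu a b (fun h => h `^ (- (2 * m)))
  (fun y => hitting_L_const m c * y `^ (2 * m)) (fun t => t `^ m) _ _ _
  b0 ab n2 C0 p01 w0 ml LE Ll rw rs.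
rewrite -/c; under eq_fun do rewrite -mulrA.
have Ii := intble_pow_gauss_tail p01.
have -> : intpos (fun y => hitting_L_const m c * y `^ (2 * m) * intpos (gauss_tail 0 y)) =
    Num.sqrt (2 * pi) * ((c `^ m - c `^ (- m)) / (2 `^ m * Gamma m)).
  rewrite -hitting_L_const_gauss// -intpos_pow_gauss_tail// -intposZ//.
  by apply: eq_intpos => y _; rewrite mulrA.
have G0 := Gamma_gt0 n0; have p0 : 0 < 2 `^ m :> R by rewrite powR_gt0.
have cn : 0 < c `^ nu by rewrite powR_gt0.
have bm : 0 < b `^ (2 * m) by rewrite powR_gt0.
have cm : 0 < c `^ m - c `^ (- m).
  by rewrite subr_gt0 /powR gt_eqF// ltr_expR ltr_pM2r ?ln_gt0//; lra.
have s0 : 0 < Num.sqrt (2 * pi) :> R by rewrite sqrtr_gt0 mulr_gt0// pi_gt0.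
set l := _ * _ / _.
rewrite (_ : _ * _ * _ * _ = l); last first.
  rewrite /l powRN.
  move: (Gamma m) (2 `^ m) (c `^ nu) (Num.sqrt _) G0 p0 cn s0 => g p q s g0 p0 q0 s0.
  by field; rewrite !gt_eqF.
move=> key.
have l0 : l != 0 by rewrite gt_eqF// divr_gt0 ?mulr_gt0.
apply: (@asymp_eq_of_cvg R _ _ (fun t => t `^ m * t) l) => //.
- near=> t; have t0 : 0 < t by near: t; exact: nbhs_pinfty_gt.
  split; first by rewrite mulf_neq0// gt_eqF// powR_gt0.
  rewrite -[X in _ * X * _]powRr1 ?(ltW t0)// mulrCA -!powRD ?(gt_eqF t0) ?implybT//.
  by rewrite (_ : _ + _ = 0) ?powRr0 ?mulr1//; ring.
apply: cvg_trans key; apply: near_eq_cvg; near=> t.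
by rewrite fE ?mulrA//; near: t; exact: nbhs_pinfty_gt.
Unshelve. all: by end_near. Qed.

End Asymptotics.

Theorem proposition3p1 (R : realType) (nu a b : R)
    (d : measure_display) (T : measurableType d) (P : probability T R)
    (X : R -> T -> R) (f : R -> R)
    (hb : 0 < b) (hab : b < a)
    (hX : bessel_process P nu a X)
    (hf : continuous_density P (hitting_time X b) f)
    (* known explicit form of this density for `|nu| < 1/2 *)
    (hexplicit : `|nu| < 1 / 2 ->
       forall t : R, 0 < t -> f t = hitting_density_formula nu a b t) :
  let c := a / b in
  (nu = 0 ->
     asymp_eq_pinfty f (fun t => 2 * ln c * t^-1 * ((ln t) ^+ 2)^-1)) /\
  (0 < `|nu| < 1 / 2 ->
     asymp_eq_pinfty f
       (fun t => b `^ (2 * `|nu|) * (c `^ `|nu| - c `^ (- `|nu|)) /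
                 (c `^ nu * 2 `^ `|nu| * Gamma `|nu|) *
                 t `^ (- `|nu| - 1))).
Proof.
split=> [nu0|nu2].
  rewrite nu0 in hexplicit.
  by apply: asymp_index0 => // t; apply: hexplicit; rewrite normr0.
by apply: asymp_index_pos => // t; apply: hexplicit; case/andP: nu2.
Qed.
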